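(* Let $n=2$, $\omega\in\mathcal D(1,C_\omega,2)$, $\gamma>0$, $f(\mathbf y)=(2-\sin(2\pi y_1)-\sin(2\pi y_2))^\gamma$ for $\mathbf y=(y_1,y_2)\in\mathbb T^2$, $V(x)=f(\omega x)$ for $x\in\mathbb R$, and $u_0\in W^{1,\infty}(\mathbb R)$. For $\varepsilon\in(0,1)$ let $u^\varepsilon\in C(\mathbb R\times[0,\infty))$ be the viscosity solution of $$u^\varepsilon_t+\tfrac12|Du^\varepsilon|^2-V\!\left(\tfrac x\varepsilon\right)=0\ \text{ in }\mathbb R\times(0,\infty),\qquad u^\varepsilon(x,0)=u_0(x)\ \text{ on }\mathbb R,$$ and let $u$ be the viscosity solution of $u_t+\overline H(Du)=0$ in $\mathbb R\times(0,\infty)$, $u(x,0)=u_0(x)$ on $\mathbb R$, where $\overline H$ is the effective Hamiltonian. Then there exists $C>0$ independent of $\varepsilon$ such that $$u^\varepsilon(0,1)-u(0,1)\ge-C\begin{cases}\varepsilon, & \gamma>1,\\ \varepsilon|\log\varepsilon|, & \gamma=1,\\ \varepsilon^\gamma, & \gamma<1.\end{cases}$$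
   Context: $\mathbb T^2=\mathbb R^2/\mathbb Z^2$; $f$ is identified with a $\mathbb Z^2$-periodic function on $\mathbb R^2$; $|\cdot|$ is the Euclidean norm. For $\sigma>0$, $C_\omega>0$, $\mathcal D(\sigma,C_\omega,2)$ is the set of $\omega\in\mathbb R^2$ with $|k\cdot\omega|\ge C_\omega|k|^{-\sigma}$ for all $k\in\mathbb Z^2\setminus\{0\}$. Effective Hamiltonian: for $p\in\mathbb R$, $\overline H(p)$ is the unique constant such that for every $\delta>0$ there is a bounded, uniformly continuous viscosity solution $w_\delta$ (approximate corrector) of $\overline H(p)-\delta\le\frac12|p+Dw_\delta|^2-V(x)\le\overline H(p)+\delta$ in $\mathbb R$. $W^{1,\infty}(\mathbb R)$ denotes bounded Lipschitz functions.
   Formalization: For γ=1 the bound is stated for ε in (0,ε0], for every ε0<1, with C allowed to depend on ε0; as printed it fails as ε→1, since ε|log ε| tends to 0 while u^ε(0,1)−u(0,1) can stay negative. For γ≠1 all ε in (0,1) are covered. *)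

(* Defs.v *)
From Stdlib Require Import Reals ZArith.
From Coquelicot Require Import Coquelicot.
Open Scope R_scope.

(** * Potential *)

(** [x ^ a] for [0 <= x] and [0 < a].  [Rpower] alone is wrong at [x = 0]:
    [Rpower 0 a = 1] because [ln 0 = 0]. *)
Definition nonneg_power (x a : R) : R :=
  if Rlt_dec 0 x then Rpower x a else 0.

(** A function on the torus, as a [Z^2]-periodic function on the plane. *)
Definition f_torus (gamma : R) (y : R * R) : R :=
  nonneg_power (2 - sin (2 * PI * fst y) - sin (2 * PI * snd y)) gamma.

Definition potential (gamma : R) (omega : R * R) (x : R) : R :=
  f_torus gamma (fst omega * x, snd omega * x).

Definition euclidean_norm (k : Z * Z) : R :=
  sqrt (IZR (fst k) ^ 2 + IZR (snd k) ^ 2).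

(** The class [D(sigma, Comega, 2)]. *)
Definition diophantine (sigma Comega : R) (omega : R * R) : Prop :=
  forall k : Z * Z, k <> (0%Z, 0%Z) ->
    Rabs (IZR (fst k) * fst omega + IZR (snd k) * snd omega)
      >= Comega * Rpower (euclidean_norm k) (- sigma).

(** * Function classes *)

Definition bounded_fun (w : R -> R) : Prop :=
  exists M : R, forall x : R, Rabs (w x) <= M.

Definition lipschitz_fun (w : R -> R) : Prop :=
  exists L : R, forall x y : R, Rabs (w x - w y) <= L * Rabs (x - y).

Definition W1inf (w : R -> R) : Prop := bounded_fun w /\ lipschitz_fun w.

Definition BUC (w : R -> R) : Prop :=
  bounded_fun w /\ uniform_continuity w (fun _ => True).

(** [u] belongs to [C(R x [0, oo))]; its values at negative times are
    irrelevant. *)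
Definition continuous_upper (u : R -> R -> R) : Prop :=
  forall x t : R, 0 <= t ->
    filterlim (fun z : R * R => u (fst z) (snd z))
      (within (fun z : R * R => 0 <= snd z) (locally (x, t)))
      (locally (u x t)).

Definition C1_line (phi : R -> R) : Prop :=
  forall x : R, ex_derive phi x /\ continuous (Derive phi) x.

Definition C1_upper (phi : R -> R -> R) : Prop :=
  forall x t : R, 0 < t ->
    ex_derive (fun y => phi y t) x /\
    ex_derive (fun s => phi x s) t /\
    continuity_2d_pt (fun y s => Derive (fun z => phi z s) y) x t /\
    continuity_2d_pt (fun y s => Derive (fun r => phi y r) s) x t.

(** * Stationary viscosity inequalities [F(x, Dw) <= 0] and
      [F(x, Dw) >= 0] in [R], for continuous [w] *)

Definition stationary_subsolution (F : R -> R -> R) (w : R -> R) : Prop :=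
  forall (phi : R -> R) (x : R), C1_line phi ->
    locally x (fun y => w y - phi y <= w x - phi x) ->
    F x (Derive phi x) <= 0.

Definition stationary_supersolution (F : R -> R -> R) (w : R -> R) : Prop :=
  forall (phi : R -> R) (x : R), C1_line phi ->
    locally x (fun y => w y - phi y >= w x - phi x) ->
    F x (Derive phi x) >= 0.

(** * Cauchy problem [u_t + H(x, Du) = 0] in [R x (0, oo)],
      [u(x, 0) = u0(x)] *)

Definition evolution_subsolution (H : R -> R -> R) (u : R -> R -> R) : Prop :=
  forall (phi : R -> R -> R) (x t : R), 0 < t -> C1_upper phi ->
    locally_2d (fun y s => u y s - phi y s <= u x t - phi x t) x t ->
    Derive (fun s => phi x s) t + H x (Derive (fun y => phi y t) x) <= 0.

Definition evolution_supersolution (H : R -> R -> R) (u : R -> R -> R) : Prop :=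
  forall (phi : R -> R -> R) (x t : R), 0 < t -> C1_upper phi ->
    locally_2d (fun y s => u y s - phi y s >= u x t - phi x t) x t ->
    Derive (fun s => phi x s) t + H x (Derive (fun y => phi y t) x) >= 0.

Definition viscosity_solution
    (H : R -> R -> R) (u0 : R -> R) (u : R -> R -> R) : Prop :=
  continuous_upper u /\
  evolution_subsolution H u /\
  evolution_supersolution H u /\
  forall x : R, u x 0 = u0 x.

(** * Effective Hamiltonian *)

(** [c - delta <= |p + Dw|^2 / 2 - V(x) <= c + delta] in [R]. *)
Definition approximate_corrector
    (V : R -> R) (p c delta : R) (w : R -> R) : Prop :=
  BUC w /\
  stationary_subsolution
    (fun x q => (p + q) ^ 2 / 2 - V x - (c + delta)) w /\
  stationary_supersolution
    (fun x q => (p + q) ^ 2 / 2 - V x - (c - delta)) w.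

Definition effective_hamiltonian (V Hbar : R -> R) : Prop :=
  forall p : R,
    unique
      (fun c => forall delta : R, 0 < delta ->
         exists w : R -> R, approximate_corrector V p c delta w)
      (Hbar p).

(** * Convergence rate *)

Definition rate (gamma eps : R) : R :=
  match total_order_T gamma 1 with
  | inleft (left _) => Rpower eps gamma
  | inleft (right _) => eps * Rabs (ln eps)
  | inright _ => eps
  end.

(* Main.v *)
Require Import Defs.
From Stdlib Require Import Reals ZArith List Lra Lia Psatz Classical ClassicalEpsilon.
From Coquelicot Require Import Coquelicot.
Open Scope R_scope.

(** The proof gives the bound [- K eps] for every exponent; up to constants it
    is stronger than the three rates.

    Write [V] for the potential and [momentum V h = sqrt (2 (V + h))]. In terms
    of optimal control, [ueps] at [(0, 1)] is the least value of [u0] at a foot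
    point [y] plus the action of a path between [0] and [y] in time 1. For every
    level [h] this action is at least the integral of [momentum V h] at the
    stretched argument [x / eps], from [0] to [y], minus [h]. On the other hand
    [u] at [(0, 1)] is at most [u0 y] plus the supremum over [p] of
    [|p| |y| - Hbar p]. So it is enough that the integral of the momentum at level
    [Hbar p] over a segment of length [T] starting at the origin is at least
    [|p| T - K], with [K] independent of [p] and [T]; for [T = |y| / eps] the
    error is [K eps]. This is [effective_momentum].

    The mean momentum at level [Hbar p] is at least [|p|], because an approximate
    corrector is a bounded function [w] with [|p + w'|] at most the momentum in
    the viscosity sense ([corrector_growth]). The remaining question is how far
    the integral of a quasi-periodic function over a segment is from its mean.
    Cutting the torus into circles reduces the flow to a rotation by a badly
    approximable number. For a rotation the error is bounded by a constant times
    the total curvature, that is the integral of the absolute second derivative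
    ([birkhoff_sum_bound]): the Fourier coefficients decay like [k ^ (- 2)], and
    the small divisors, of size [1 / k] at worst, are of order 1 on average
    ([small_divisor_sum]). The momentum behaves at worst like [|y| ^ gamma] at one
    point of the torus, so its second derivative behaves like
    [|y| ^ (gamma - 2)], which is integrable in the plane for every [gamma > 0],
    uniformly in the level ([line2_int]). The computation is made with a
    regularised potential, and [orbit_average_compare] passes to the limit.

    The control argument is replaced by comparison, since nothing is assumed on
    the growth of the viscosity solutions. The upper bound for [u] only involves
    the neighbourhood of a line ([subsolution_along_line]). For [ueps], the exact
    solutions [h (1 - t) - S x] of the equation, with [S' = momentum] up to sign,
    are glued into one smooth subsolution by a soft minimum, which is admissible
    because the Hamiltonian is convex in the gradient ([barrier_soft_max]). A
    minimum point of [ueps] minus this subsolution has to be at the initial time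
    ([solution_above_barrier]). That the minimum is attained uses the subsolution
    property of [ueps] as well: it yields a quadratic lower bound with a small
    coefficient ([solution_lower_bound]). For a mere supersolution the estimate
    would be false, because information could arrive from infinity. *)

(** * Integrals of continuous functions *)

(* [RInt] lives in a normed module whose carrier is only convertible to [R]. *)
Ltac toR := match goal with |- @eq _ ?a ?b => change (@eq R a b) end.

Notation cts f := (forall x : R, continuous f x).

Lemma cts_of_derive (f df : R -> R) : (forall x, is_derive f x (df x)) -> cts f.
Proof.
  intros H x. apply (ex_derive_continuous f). exists (df x). apply H.
Qed.

Lemma cts_plus (f g : R -> R) : cts f -> cts g -> cts (fun x => f x + g x).
Proof. intros Hf Hg x. exact (continuous_plus f g x (Hf x) (Hg x)). Qed.

Lemma cts_minus (f g : R -> R) : cts f -> cts g -> cts (fun x => f x - g x).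
Proof. intros Hf Hg x. exact (continuous_minus f g x (Hf x) (Hg x)). Qed.

Lemma cts_mult (f g : R -> R) : cts f -> cts g -> cts (fun x => f x * g x).
Proof. intros Hf Hg x. exact (continuous_mult f g x (Hf x) (Hg x)). Qed.

Lemma cts_const (c : R) : cts (fun _ => c).
Proof. intros x. apply continuous_const. Qed.

Lemma cts_comp (f g : R -> R) : cts f -> cts g -> cts (fun x => f (g x)).
Proof. intros Hf Hg x. apply (continuous_comp g f); auto. Qed.

Lemma cts_abs (f : R -> R) : cts f -> cts (fun x => Rabs (f x)).
Proof.
  intros Hf x. apply (continuous_comp f Rabs); [apply Hf | apply continuous_Rabs].
Qed.

Lemma cts_affine (a b : R) : cts (fun x => a * x + b).
Proof.
  intros x. apply (cts_of_derive (fun x => a * x + b) (fun _ => a)).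
  intros y. auto_derive; [trivial | ring].
Qed.

Lemma cts_int (f : R -> R) (a b : R) : cts f -> ex_RInt f a b.
Proof. intros H. apply (ex_RInt_continuous f). intros; apply H. Qed.

Lemma int_plus (f g : R -> R) a b : cts f -> cts g ->
  RInt (fun x => f x + g x) a b = RInt f a b + RInt g a b.
Proof. intros Hf Hg. apply (RInt_plus f g); apply cts_int; auto. Qed.

Lemma int_minus (f g : R -> R) a b : cts f -> cts g ->
  RInt (fun x => f x - g x) a b = RInt f a b - RInt g a b.
Proof. intros Hf Hg. apply (RInt_minus f g); apply cts_int; auto. Qed.

Lemma int_scal (f : R -> R) c a b : cts f ->
  RInt (fun x => c * f x) a b = c * RInt f a b.
Proof. intros Hf. apply (RInt_scal f); apply cts_int; auto. Qed.

Lemma int_const (c a b : R) : RInt (fun _ => c) a b = (b - a) * c.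
Proof. rewrite RInt_const. reflexivity. Qed.

Lemma int_ext (f g : R -> R) a b : (forall x, f x = g x) -> RInt f a b = RInt g a b.
Proof. intros H. apply RInt_ext. intros; apply H. Qed.

Lemma int_Chasles (f : R -> R) a b c : cts f ->
  RInt f a b + RInt f b c = RInt f a c.
Proof. intros H. apply (RInt_Chasles f); apply cts_int; auto. Qed.

Lemma int_le (f g : R -> R) a b : a <= b -> cts f -> cts g ->
  (forall x, a < x < b -> f x <= g x) -> RInt f a b <= RInt g a b.
Proof. intros Hab Hf Hg H. apply RInt_le; auto using cts_int. Qed.

Lemma int_abs_le (f g : R -> R) a b : a <= b -> cts f -> cts g ->
  (forall x, a < x < b -> Rabs (f x) <= g x) -> Rabs (RInt f a b) <= RInt g a b.
Proof.
  intros Hab Hf Hg H.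
  apply Rle_trans with (RInt (fun x => Rabs (f x)) a b).
  - apply abs_RInt_le; auto using cts_int.
  - apply int_le; auto using cts_abs.
Qed.

Lemma int_deriv (f df : R -> R) a b : (forall x, is_derive f x (df x)) -> cts df ->
  RInt df a b = f b - f a.
Proof.
  intros H Hd. apply is_RInt_unique. apply (is_RInt_derive f df); auto.
Qed.

Lemma int_derive_upper (f : R -> R) (a x : R) : cts f ->
  is_derive (fun y => RInt f a y) x (f x).
Proof.
  intros Hf. apply (is_derive_RInt f (fun y => RInt f a y) a); auto.
  exists (mkposreal 1 Rlt_0_1). intros y _. apply (RInt_correct f). apply cts_int; auto.
Qed.

Lemma int_shift (f : R -> R) v a b : cts f ->
  RInt (fun x => f (x + v)) a b = RInt f (a + v) (b + v).
Proof.
  intros Hf.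
  rewrite <- (Rmult_1_l a) at 2. rewrite <- (Rmult_1_l b) at 2.
  rewrite <- (RInt_comp_lin f 1 v a b) by (apply cts_int; auto).
  apply int_ext. intros x. change (f (x + v) = 1 * f (1 * x + v)).
  rewrite !Rmult_1_l. reflexivity.
Qed.

Lemma int_dilate (f : R -> R) u a b : cts f ->
  u * RInt (fun x => f (u * x)) a b = RInt f (u * a) (u * b).
Proof.
  intros Hf.
  rewrite <- int_scal. 2:{ apply (cts_comp f (fun x => u * x)); auto.
    intros x. apply (cts_mult (fun _ => u) (fun x => x)); intros; [apply cts_const | apply continuous_id]. }
  rewrite <- (Rplus_0_r (u * a)), <- (Rplus_0_r (u * b)).
  rewrite <- (RInt_comp_lin f u 0 a b) by (apply cts_int; auto).
  apply int_ext. intros x. change (u * f (u * x) = u * f (u * x + 0)).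
  rewrite Rplus_0_r. reflexivity.
Qed.

Definition periodic (f : R -> R) : Prop := forall x, f (x + 1) = f x.

Lemma int_periodic (f : R -> R) a : cts f -> periodic f ->
  RInt f a (a + 1) = RInt f 0 1.
Proof.
  intros Hf Hp.
  assert (H : RInt f 0 a = RInt f 1 (a + 1)).
  { replace 1 with (0 + 1) at 1 by ring. rewrite <- (int_shift f 1) by auto.
    apply int_ext. intros x. symmetry. apply Hp. }
  pose proof (int_Chasles f 0 a (a + 1) Hf).
  pose proof (int_Chasles f 0 1 (a + 1) Hf). lra.
Qed.

(** * Finite sums *)

Fixpoint psum (f : nat -> R) (n : nat) : R :=
  match n with O => 0 | S m => psum f m + f m end.

Lemma psum_S f n : psum f (S n) = psum f n + f n.
Proof. reflexivity. Qed.

Lemma psum_ext f g n : (forall k, (k < n)%nat -> f k = g k) -> psum f n = psum g n.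
Proof.
  induction n; intros H; simpl; [reflexivity|].
  rewrite IHn by (intros; apply H; lia). rewrite H by lia. reflexivity.
Qed.

Lemma psum_le f g n : (forall k, (k < n)%nat -> f k <= g k) -> psum f n <= psum g n.
Proof.
  induction n; intros H; simpl; [lra|].
  assert (psum f n <= psum g n) by (apply IHn; intros; apply H; lia).
  specialize (H n ltac:(lia)). lra.
Qed.

Lemma psum_abs f n : Rabs (psum f n) <= psum (fun k => Rabs (f k)) n.
Proof.
  induction n; simpl; [rewrite Rabs_R0; lra|].
  eapply Rle_trans; [apply Rabs_triang|]. lra.
Qed.

Lemma psum_plus f g n : psum (fun k => f k + g k) n = psum f n + psum g n.
Proof. induction n; simpl; [ring|]. rewrite IHn; ring. Qed.

Lemma psum_scal c f n : psum (fun k => c * f k) n = c * psum f n.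
Proof. induction n; simpl; [ring|]. rewrite IHn; ring. Qed.

Lemma psum_const c n : psum (fun _ => c) n = INR n * c.
Proof. induction n; [simpl; ring|]. rewrite S_INR, psum_S, IHn; ring. Qed.

Lemma psum_swap (f : nat -> nat -> R) n m :
  psum (fun i => psum (fun j => f i j) m) n = psum (fun j => psum (fun i => f i j) n) m.
Proof.
  induction n; simpl.
  - rewrite psum_const. ring.
  - rewrite IHn. rewrite <- psum_plus. reflexivity.
Qed.

Lemma psum_cts (f : nat -> R -> R) n : (forall k, cts (f k)) ->
  cts (fun x => psum (fun k => f k x) n).
Proof.
  intros H. induction n; simpl; intros x; [apply continuous_const|].
  apply (cts_plus (fun x => psum (fun k => f k x) n) (f n)); auto.
Qed.

Lemma int_psum (f : nat -> R -> R) n a b : (forall k, cts (f k)) ->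
  RInt (fun x => psum (fun k => f k x) n) a b = psum (fun k => RInt (f k) a b) n.
Proof.
  intros H. induction n; simpl.
  - rewrite int_const. ring.
  - rewrite int_plus, IHn; auto. apply psum_cts; auto.
Qed.

(** * Small divisors of a badly approximable number *)

Definition badly_approximable (c alpha : R) : Prop :=
  forall (k : nat) (n : Z), (0 < k)%nat -> c / INR k <= Rabs (INR k * alpha - IZR n).

Lemma cts_cos (f : R -> R) : cts f -> cts (fun x => cos (f x)).
Proof. intros H x. apply (continuous_comp f cos); auto. apply continuous_cos. Qed.

Lemma cts_sin (f : R -> R) : cts f -> cts (fun x => sin (f x)).
Proof. intros H x. apply (continuous_comp f sin); auto. apply continuous_sin. Qed.

Lemma sin_half_bound x : 0 <= x <= PI / 2 -> x / 2 <= sin x.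
Proof.
  intros [H0 H1]. pose proof PI_RGT_0. pose proof PI_4.
  assert (Hd : forall a b, a <= b -> exists c, a <= c <= b /\
     (sin b - b / 2) - (sin a - a / 2) = (cos c - 1 / 2) * (b - a)).
  { intros a b Hab.
    destruct (MVT_gen (fun x => sin x - x / 2) a b (fun x => cos x - 1 / 2)) as [c [Hc Heq]].
    - intros y _. auto_derive; [trivial | lra].
    - intros y _. apply continuity_pt_minus; [apply continuity_sin|]. reg.
    - rewrite Rmin_left, Rmax_right in Hc by lra. exists c. auto. }
  destruct (Rle_dec x (PI / 3)) as [Hx|Hx].
  - destruct (Hd 0 x) as [c [Hc Heq]]; [lra|]. rewrite sin_0 in Heq.
    assert (1 / 2 <= cos c).
    { rewrite <- cos_PI3. apply cos_decr_1; lra. }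
    assert (0 <= (cos c - 1 / 2) * (x - 0)) by (apply Rmult_le_pos; lra). lra.
  - destruct (Hd x (PI / 2)) as [c [Hc Heq]]; [lra|]. rewrite sin_PI2 in Heq.
    assert (cos c <= 1 / 2).
    { rewrite <- cos_PI3. apply cos_decr_1; lra. }
    assert (0 <= (1 / 2 - cos c) * (PI / 2 - x)) by (apply Rmult_le_pos; lra). lra.
Qed.

Lemma sin_PI_lower z : Rabs z <= 1 / 2 -> Rabs z <= Rabs (sin (PI * z)).
Proof.
  intros Hz. pose proof PI2_3_2.
  assert (Hp : forall z, 0 <= z <= 1 / 2 -> z <= sin (PI * z)).
  { intros y Hy. pose proof (sin_half_bound (PI * y)).
    assert (0 <= PI * y <= PI / 2) by nra. nra. }
  destruct (Rle_dec 0 z).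
  - rewrite (Rabs_pos_eq z) in * by lra. eapply Rle_trans; [apply Hp; lra|]. apply Rle_abs.
  - rewrite (Rabs_left z) in * by lra.
    eapply Rle_trans; [apply (Hp (- z)); lra|].
    replace (PI * - z) with (- (PI * z)) by ring. rewrite sin_neg, <- Rabs_Ropp. apply Rle_abs.
Qed.

Lemma abs_sin_shift z (n : Z) : Rabs (sin (PI * (z - IZR n))) = Rabs (sin (PI * z)).
Proof.
  replace (PI * (z - IZR n)) with (PI * z - IZR n * PI) by ring.
  rewrite sin_minus.
  assert (Hs : sin (IZR n * PI) = 0) by (apply sin_eq_0_1; exists n; reflexivity).
  pose proof (sin2_cos2 (IZR n * PI)) as H. rewrite Hs in *.
  unfold Rsqr in H. rewrite Rmult_0_r, Rminus_0_r, Rabs_mult.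
  assert (Rabs (cos (IZR n * PI)) = 1).
  { rewrite <- sqrt_Rsqr_abs. unfold Rsqr.
    replace (cos (IZR n * PI) * cos (IZR n * PI)) with 1 by lra. apply sqrt_1. }
  rewrite H0. ring.
Qed.

Lemma inv_sin_bound z : 0 < z < 1 -> / Rabs (sin (PI * z)) <= / z + / (1 - z).
Proof.
  intros Hz.
  assert (0 < / z) by (apply Rinv_0_lt_compat; lra).
  assert (0 < / (1 - z)) by (apply Rinv_0_lt_compat; lra).
  destruct (Rle_dec z (1 / 2)).
  - pose proof (sin_PI_lower z) as H1. rewrite (Rabs_pos_eq z) in H1 by lra.
    assert (/ Rabs (sin (PI * z)) <= / z) by (apply Rinv_le_contravar; lra). lra.
  - pose proof (sin_PI_lower (z - 1)) as H1. rewrite (Rabs_left (z - 1)) in H1 by lra.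
    rewrite (abs_sin_shift z 1) in H1.
    assert (/ Rabs (sin (PI * z)) <= / (1 - z)) by (apply Rinv_le_contravar; lra). lra.
Qed.

Lemma argmax_exists (f : nat -> R) n :
  exists m, (m < S n)%nat /\ forall k, (k < S n)%nat -> f k <= f m.
Proof.
  induction n.
  - exists O. split; [lia|]. intros k Hk. replace k with O by lia. lra.
  - destruct IHn as [m [Hm H]].
    destruct (Rle_dec (f m) (f (S n))).
    + exists (S n). split; [lia|]. intros k Hk.
      destruct (Nat.eq_dec k (S n)); [subst; lra|]. specialize (H k ltac:(lia)). lra.
    + exists m. split; [lia|]. intros k Hk.
      destruct (Nat.eq_dec k (S n)); [subst; lra|]. apply H; lia.
Qed.

Lemma psum_replace (f : nat -> R) m n x : (m < n)%nat ->
  psum (fun k => if Nat.eq_dec k m then x else f k) n = psum f n - f m + x.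
Proof.
  induction n; intros H; [lia|]. simpl.
  destruct (Nat.eq_dec n m).
  - subst m.
    rewrite (psum_ext _ f); [ring|]. intros k Hk. destruct (Nat.eq_dec k n); [lia|reflexivity].
  - rewrite IHn by lia. ring.
Qed.

(** The largest of [n] points of [[d, oo)] at mutual distance [d] is at least
    [n d], and removing it leaves a configuration of the same kind. The claim on
    the largest point is part of the induction. *)
Lemma separated_inverse_sum d n : 0 < d -> forall f : nat -> R,
  (forall k, (k < n)%nat -> d <= f k) ->
  (forall i j, (i < j < n)%nat -> d <= Rabs (f i - f j)) ->
  psum (fun k => / f k) n <= / d * psum (fun i => / INR (S i)) n /\
  ((0 < n)%nat -> exists k, (k < n)%nat /\ INR n * d <= f k).
Proof.
  intros Hd. induction n; intros f Hf Hs.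
  - simpl. split; [lra | lia].
  - destruct (argmax_exists f n) as [m [Hm Hmax]].
    set (g := fun k => if Nat.eq_dec k m then f n else f k).
    destruct (IHn g) as [IH1 IH2].
    { intros k Hk. unfold g. destruct (Nat.eq_dec k m); apply Hf; lia. }
    { intros i j Hij. unfold g.
      destruct (Nat.eq_dec i m), (Nat.eq_dec j m); try lia.
      - rewrite Rabs_minus_sym. apply Hs; lia.
      - apply Hs; lia.
      - apply Hs; lia. }
    assert (Hsum : psum (fun k => / f k) (S n) = psum (fun k => / g k) n + / f m).
    { simpl. destruct (Nat.eq_dec m n) as [->|Hmn].
      - f_equal. apply psum_ext. intros k Hk. unfold g.
        destruct (Nat.eq_dec k n); [lia|reflexivity].
      - rewrite (psum_ext (fun k => / g k)
          (fun k => if Nat.eq_dec k m then / f n else / f k)).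
        + rewrite (psum_replace (fun k => / f k)) by lia. ring.
        + intros k Hk. unfold g. destruct (Nat.eq_dec k m); reflexivity. }
    assert (Hfm : INR (S n) * d <= f m).
    { destruct n.
      - simpl. rewrite Rmult_1_l. apply Hf; lia.
      - destruct IH2 as [k [Hk Hgk]]; [lia|].
        assert (exists k', (k' < S (S n))%nat /\ k' <> m /\ g k = f k') as [k' [Hk1 [Hk2 Hk3]]].
        { unfold g. destruct (Nat.eq_dec k m).
          - exists (S n). repeat split; try lia.
          - exists k. repeat split; lia. }
        rewrite Hk3 in Hgk. pose proof (Hmax k' Hk1).
        assert (d <= Rabs (f m - f k')).
        { destruct (Nat.lt_ge_cases m k'); [apply Hs; lia|].
          rewrite Rabs_minus_sym. apply Hs; lia. }
        rewrite Rabs_pos_eq in H0 by lra. rewrite (S_INR (S n)). lra. }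
    split.
    + rewrite Hsum. rewrite !psum_S. rewrite Rmult_plus_distr_l.
      apply Rplus_le_compat; [assumption|].
      rewrite <- Rinv_mult. apply Rinv_le_contravar.
      * apply Rmult_lt_0_compat; [assumption | apply lt_0_INR; lia].
      * rewrite Rmult_comm. exact Hfm.
    + intros _. exists m. auto.
Qed.

Lemma harmonic_sqrt n : psum (fun i => / INR (S i)) n <= 2 * sqrt (INR n).
Proof.
  induction n; [simpl; rewrite sqrt_0; lra|].
  rewrite !psum_S.
  pose proof (pos_INR n). pose proof (S_INR n) as HS.
  assert (H1 : 0 < sqrt (INR (S n))) by (apply sqrt_lt_R0; lra).
  assert (H2 : 0 <= sqrt (INR n)) by apply sqrt_pos.
  assert (E1 : sqrt (INR (S n)) * sqrt (INR (S n)) = INR (S n)) by (apply sqrt_sqrt; lra).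
  assert (E2 : sqrt (INR n) * sqrt (INR n) = INR n) by (apply sqrt_sqrt; lra).
  assert (H3 : sqrt (INR n) <= sqrt (INR (S n))) by (apply sqrt_le_1; lra).
  set (a := sqrt (INR (S n))) in *. set (b := sqrt (INR n)) in *.
  assert (/ INR (S n) <= 2 * a - 2 * b); [|lra].
  apply (Rmult_le_reg_l (INR (S n))); [lra|].
  rewrite Rinv_r by lra. rewrite <- E1.
  assert (E : (a - b) * (a + b) = 1) by nra.
  assert (1 <= (a - b) * (2 * a)) by nra.
  assert (1 <= a) by (rewrite <- sqrt_1; apply sqrt_le_1; lra).
  nra.
Qed.

Definition small_divisor (alpha : R) (k : nat) : R := / Rabs (sin (PI * (INR k * alpha))).

(** For [k <= n] the fractional parts of [k alpha], and those of [- k alpha], are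
    [c / n]-separated. A single one may be as small as [c / n], but their
    reciprocals add up like those of equally spaced points. *)
Lemma small_divisor_sum c alpha n : 0 < c -> badly_approximable c alpha ->
  psum (fun k => small_divisor alpha (S k)) n <= 4 / c * (INR n * sqrt (INR n)).
Proof.
  intros Hc Hb.
  destruct n as [|n']; [simpl; lra|].
  set (n := S n').
  set (f := fun k => frac_part (INR (S k) * alpha)).
  set (d := c / INR n).
  assert (Hn : 0 < INR n) by (apply lt_0_INR; unfold n; lia).
  assert (Hd : 0 < d) by (apply Rdiv_lt_0_compat; lra).
  assert (Hdk : forall k, (0 < k <= n)%nat -> d <= c / INR k).
  { intros k Hk. unfold d, Rdiv. apply Rmult_le_compat_l; [lra|].
    apply Rinv_le_contravar; [apply lt_0_INR; lia | apply le_INR; lia]. }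
  assert (Hf0 : forall k, (k < n)%nat -> d <= f k).
  { intros k Hk. eapply Rle_trans; [apply (Hdk (S k)); lia|].
    eapply Rle_trans; [apply (Hb (S k) (Int_part (INR (S k) * alpha))); lia|].
    fold (frac_part (INR (S k) * alpha)). destruct (base_fp (INR (S k) * alpha)).
    rewrite Rabs_pos_eq by lra. unfold f; lra. }
  assert (Hf1 : forall k, (k < n)%nat -> d <= 1 - f k).
  { intros k Hk. eapply Rle_trans; [apply (Hdk (S k)); lia|].
    eapply Rle_trans; [apply (Hb (S k) (Int_part (INR (S k) * alpha) + 1)%Z); lia|].
    rewrite plus_IZR. unfold f.
    destruct (base_fp (INR (S k) * alpha)). unfold frac_part in *.
    rewrite Rabs_left by lra. lra. }
  assert (Hsep : forall i j, (i < j < n)%nat -> d <= Rabs (f i - f j)).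
  { intros i j Hij. eapply Rle_trans; [apply (Hdk (j - i)%nat); lia|].
    eapply Rle_trans; [apply (Hb (j - i)%nat
      (Int_part (INR (S j) * alpha) - Int_part (INR (S i) * alpha))%Z); lia|].
    rewrite minus_IZR. unfold f, frac_part. rewrite minus_INR by lia.
    rewrite !S_INR. rewrite Rabs_minus_sym. right. f_equal. ring. }
  destruct (separated_inverse_sum d n Hd f Hf0 Hsep) as [S1 _].
  destruct (separated_inverse_sum d n Hd (fun k => 1 - f k) Hf1) as [S2 _].
  { intros i j Hij. rewrite Rabs_minus_sym.
    replace (1 - f j - (1 - f i)) with (f i - f j) by ring. auto. }
  apply Rle_trans with (psum (fun k => / f k + / (1 - f k)) n).
  - apply psum_le. intros k Hk. unfold small_divisor.
    rewrite <- (abs_sin_shift _ (Int_part (INR (S k) * alpha))).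
    apply inv_sin_bound. specialize (Hf0 k Hk). specialize (Hf1 k Hk).
    unfold f, frac_part in *. lra.
  - rewrite psum_plus. pose proof (harmonic_sqrt n).
    assert (0 < / d) by (apply Rinv_0_lt_compat; lra).
    assert (/ d = INR n / c) by (unfold d; field; lra).
    replace (4 / c * (INR n * sqrt (INR n))) with (2 * (/ d * (2 * sqrt (INR n))))
      by (rewrite H1; field; lra).
    assert (/ d * psum (fun i => / INR (S i)) n <= / d * (2 * sqrt (INR n)))
      by (apply Rmult_le_compat_l; lra).
    lra.
Qed.

(** Summation by parts: since [1 / k ^ 2 - 1 / (k + 1) ^ 2] is of order
    [k ^ (- 3)], a growth of the partial sums slower than [k ^ 2] is enough. The
    telescoping term [10 - 10 / sqrt n] stands for the sum of [k ^ (- 3 / 2)]. *)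
Lemma weighted_sum_bound (s : nat -> R) A : 0 <= A ->
  (forall n, psum s n <= A * (INR n * sqrt (INR n))) ->
  forall n, psum (fun k => s k / INR (S k) ^ 2) n <= 12 * A.
Proof.
  intros HA H n.
  assert (Hw : forall n, psum (fun k => s k / INR (S k) ^ 2) (S n) <=
     psum s (S n) / INR (S n) ^ 2 + A * (10 - 10 / sqrt (INR (S n)))).
  { clear n. induction n.
    - simpl. rewrite sqrt_1. unfold Rdiv. rewrite !Rmult_1_r, Rinv_1. lra.
    - set (T := psum (fun k => s k / INR (S k) ^ 2) (S n)) in *.
      change (psum (fun k => s k / INR (S k) ^ 2) (S (S n)))
        with (T + s (S n) / INR (S (S n)) ^ 2).
      change (psum s (S (S n))) with (psum s (S n) + s (S n)).
      specialize (H (S n)). set (P := psum s (S n)) in *.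
      pose proof (pos_INR n) as Hn.
      rewrite (S_INR (S n)).
      assert (Hx : 1 <= INR (S n)) by (rewrite S_INR; lra).
      set (x := INR (S n)) in *.
      assert (E1 : sqrt x * sqrt x = x) by (apply sqrt_sqrt; lra).
      assert (E2 : sqrt (x + 1) * sqrt (x + 1) = x + 1) by (apply sqrt_sqrt; lra).
      assert (L1 : 1 <= sqrt x) by (rewrite <- sqrt_1; apply sqrt_le_1; lra).
      assert (L2 : sqrt x <= sqrt (x + 1)) by (apply sqrt_le_1; lra).
      set (a := sqrt x) in *. set (b := sqrt (x + 1)) in *.
      assert (K : P * (/ x ^ 2 - / (x + 1) ^ 2) <= A * (10 / a - 10 / b)).
      { assert (Q : / x ^ 2 - / (x + 1) ^ 2 = (2 * x + 1) / (x ^ 2 * (x + 1) ^ 2))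
          by (field; lra).
        assert (Q0 : 0 <= (2 * x + 1) / (x ^ 2 * (x + 1) ^ 2)).
        { apply Rlt_le, Rdiv_lt_0_compat; [lra|]. apply Rmult_lt_0_compat; apply pow_lt; lra. }
        rewrite Q.
        apply Rle_trans with (A * (x * a) * ((2 * x + 1) / (x ^ 2 * (x + 1) ^ 2))).
        { apply Rmult_le_compat_r; lra. }
        rewrite Rmult_assoc. apply Rmult_le_compat_l; [assumption|].
        replace (10 / a - 10 / b) with (10 * / (a * b * (a + b))).
        2:{ assert (E : (b - a) * (b + a) = 1) by nra.
            replace (10 / a - 10 / b) with (10 * (b - a) * / (a * b)) by (field; lra).
            replace (/ (a * b * (a + b))) with ((b - a) * (b + a) * / (a * b * (a + b)))
              by (rewrite E; ring). field. lra. }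
        replace (x * a * ((2 * x + 1) / (x ^ 2 * (x + 1) ^ 2)))
          with (a * (2 * x + 1) / (x * (x + 1) ^ 2)) by (field; lra).
        assert (B2 : b <= 3 / 2 * a).
        { destruct (Rle_dec b (3 / 2 * a)); [assumption|]. nra. }
        apply (Rmult_le_reg_r (x * (x + 1) ^ 2)).
        { apply Rmult_lt_0_compat; [lra | apply pow_lt; lra]. }
        replace (a * (2 * x + 1) / (x * (x + 1) ^ 2) * (x * (x + 1) ^ 2))
          with (a * (2 * x + 1)) by (field; lra).
        apply (Rmult_le_reg_r (a * b * (a + b))); [apply Rmult_lt_0_compat; nra|].
        replace (10 * / (a * b * (a + b)) * (x * (x + 1) ^ 2) * (a * b * (a + b)))
          with (10 * (x * (x + 1) ^ 2)) by (field; nra).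
        assert (C1 : a * b <= 3 / 2 * x) by nra.
        assert (C2 : a * (a + b) <= 5 / 2 * x) by nra.
        assert (C3 : (a * b) * (a * (a + b)) <= (3 / 2 * x) * (5 / 2 * x)).
        { apply Rmult_le_compat; nra. }
        nra. }
      assert (T + s (S n) / (x + 1) ^ 2 <=
        P / x ^ 2 + A * (10 - 10 / a) + s (S n) / (x + 1) ^ 2) by lra.
      eapply Rle_trans; [eassumption|].
      replace ((P + s (S n)) / (x + 1) ^ 2)
        with (P / x ^ 2 - P * (/ x ^ 2 - / (x + 1) ^ 2) + s (S n) / (x + 1) ^ 2)
        by (field; lra).
      lra. }
  destruct n as [|n]; [simpl; lra|].
  eapply Rle_trans; [apply Hw|].
  specialize (H (S n)). set (x := INR (S n)) in *.
  assert (Hx : 1 <= x) by (unfold x; rewrite S_INR; pose proof (pos_INR n); lra).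
  assert (E1 : sqrt x * sqrt x = x) by (apply sqrt_sqrt; lra).
  assert (L1 : 1 <= sqrt x) by (rewrite <- sqrt_1; apply sqrt_le_1; lra).
  set (a := sqrt x) in *.
  assert (0 < 10 / a) by (apply Rdiv_lt_0_compat; lra).
  assert (psum s (S n) / x ^ 2 <= A).
  { apply (Rmult_le_reg_r (x ^ 2)); [apply pow_lt; lra|].
    unfold Rdiv. rewrite Rmult_assoc, Rinv_l, Rmult_1_r by (apply pow_nonzero; lra).
    eapply Rle_trans; [exact H|]. apply Rmult_le_compat_l; nra. }
  nra.
Qed.

(** * Fejer means *)

(** The index is shifted: [mode k] has frequency [k + 1], so that the constant
    mode is left out. *)
Definition mode (k : nat) (x : R) : R := cos (2 * PI * INR (S k) * x).

Definition fejer (M : nat) (x : R) : R :=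
  1 + 2 * psum (fun k => (1 - INR (S k) / INR (S M)) * mode k x) M.

Lemma mode_cts k : cts (mode k).
Proof.
  apply cts_cos. intros x.
  apply (cts_mult (fun _ => 2 * PI * INR (S k)) (fun x => x)); intros;
    [apply cts_const | apply continuous_id].
Qed.

Lemma fejer_cts M : cts (fejer M).
Proof.
  apply (cts_plus (fun _ => 1)); [apply cts_const|].
  apply (cts_mult (fun _ => 2)); [apply cts_const|].
  apply (psum_cts (fun k x => (1 - INR (S k) / INR (S M)) * mode k x)). intros k.
  apply (cts_mult (fun _ => _)); [apply cts_const | apply mode_cts].
Qed.

Lemma cos_shift_period x (n : nat) : cos (x + 2 * PI * INR n) = cos x.
Proof. replace (x + 2 * PI * INR n) with (x + 2 * INR n * PI) by ring. apply cos_period. Qed.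

Lemma mode_periodic k : periodic (mode k).
Proof.
  intros x. unfold mode.
  replace (2 * PI * INR (S k) * (x + 1)) with (2 * PI * INR (S k) * x + 2 * PI * INR (S k)) by ring.
  apply cos_shift_period.
Qed.

Lemma fejer_periodic M : periodic (fejer M).
Proof.
  intros x. unfold fejer. do 2 f_equal.
  apply psum_ext. intros. rewrite mode_periodic. reflexivity.
Qed.

Lemma dirichlet_identity n x :
  sin (PI * x) * (1 + 2 * psum (fun k => mode k x) n) = sin ((2 * INR n + 1) * (PI * x)).
Proof.
  induction n.
  - simpl. rewrite !Rmult_0_r, Rplus_0_r, Rplus_0_l, Rmult_1_l. ring.
  - rewrite psum_S.
    replace (sin (PI * x) * (1 + 2 * (psum (fun k => mode k x) n + mode n x)))
      with (sin ((2 * INR n + 1) * (PI * x)) + 2 * sin (PI * x) * mode n x)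
      by (rewrite <- IHn; ring).
    unfold mode. rewrite S_INR.
    replace ((2 * (INR n + 1) + 1) * (PI * x)) with (2 * PI * (INR n + 1) * x + PI * x) by ring.
    replace ((2 * INR n + 1) * (PI * x)) with (2 * PI * (INR n + 1) * x - PI * x) by ring.
    rewrite sin_plus, sin_minus. ring.
Qed.

Lemma fejer_identity M x :
  sin (PI * x) ^ 2 * fejer M x = sin (INR (S M) * (PI * x)) ^ 2 / INR (S M).
Proof.
  assert (H : sin (PI * x) ^ 2 *
     (INR (S M) + 2 * psum (fun k => (INR (S M) - INR (S k)) * mode k x) M)
     = sin (INR (S M) * (PI * x)) ^ 2).
  { induction M.
    - simpl. rewrite !Rmult_1_l. ring.
    - rewrite psum_S.
      rewrite (psum_ext _ (fun k => (INR (S M) - INR (S k)) * mode k x + mode k x))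
        by (intros; rewrite (S_INR (S M)); ring).
      rewrite psum_plus.
      pose proof (dirichlet_identity (S M) x) as D. rewrite psum_S in D.
      set (A := psum (fun k => (INR (S M) - INR (S k)) * mode k x) M) in *.
      set (B := psum (fun k => mode k x) M) in *.
      rewrite (S_INR (S M)).
      transitivity (sin (PI * x) ^ 2 * (INR (S M) + 2 * A) +
        sin (PI * x) * (sin (PI * x) * (1 + 2 * (B + mode M x)))); [ring|].
      rewrite IHM, D.
      replace ((2 * INR (S M) + 1) * (PI * x))
        with (INR (S M) * (PI * x) + (INR (S M) + 1) * (PI * x)) by ring.
      set (u := INR (S M) * (PI * x)).
      replace ((INR (S M) + 1) * (PI * x)) with (u + PI * x) by (unfold u; ring).
      set (v := PI * x). rewrite sin_plus, (sin_plus u v), (cos_plus u v).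
      pose proof (sin2_cos2 u) as Hu. pose proof (sin2_cos2 v) as Hv. unfold Rsqr in *.
      set (su := sin u) in *. set (cu := cos u) in *. set (sv := sin v) in *. set (cv := cos v) in *.
      assert (Eu : cu * cu = 1 - su * su) by lra.
      assert (Ev : cv * cv = 1 - sv * sv) by lra.
      ring_simplify.
      replace (cu ^ 2) with (1 - su * su) by (rewrite <- Eu; ring).
      replace (cv ^ 2) with (1 - sv * sv) by (rewrite <- Ev; ring).
      ring. }
  assert (Hp : 0 < INR (S M)) by (apply lt_0_INR; lia).
  rewrite <- H. unfold fejer.
  rewrite (psum_ext _ (fun k => / INR (S M) * ((INR (S M) - INR (S k)) * mode k x))).
  - rewrite psum_scal. field. lra.
  - intros k _. field. lra.
Qed.

Lemma fejer_pos M x : - (1 / 2) < x < 1 / 2 -> 0 <= fejer M x.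
Proof.
  intros Hx.
  assert (Hp : 0 < INR (S M)) by (apply lt_0_INR; lia).
  destruct (Req_dec x 0) as [->|H0].
  - unfold fejer.
    assert (0 <= psum (fun k => (1 - INR (S k) / INR (S M)) * mode k 0) M); [|lra].
    apply Rle_trans with (psum (fun _ => 0) M); [rewrite psum_const; lra|].
    apply psum_le. intros k Hk.
    unfold mode. rewrite Rmult_0_r, cos_0, Rmult_1_r.
    assert (INR (S k) / INR (S M) <= 1); [|lra].
    apply (Rmult_le_reg_r (INR (S M))); [assumption|]. unfold Rdiv.
    rewrite Rmult_assoc, Rinv_l, Rmult_1_r, Rmult_1_l by lra. apply le_INR; lia.
  - assert (0 < sin (PI * x) ^ 2).
    { apply pow2_gt_0. intros E.
      pose proof (sin_PI_lower x) as L. rewrite E, Rabs_R0 in L.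
      assert (0 < Rabs x) by (apply Rabs_pos_lt; assumption).
      assert (Rabs x <= 1 / 2) by (apply Rabs_le; lra). lra. }
    pose proof (fejer_identity M x) as E.
    assert (0 <= sin (PI * x) ^ 2 * fejer M x).
    { rewrite E. apply Rmult_le_pos; [apply pow2_ge_0 | apply Rlt_le, Rinv_0_lt_compat; lra]. }
    nra.
Qed.

Lemma int_mode k a : RInt (mode k) a (a + 1) = 0.
Proof.
  pose proof PI_RGT_0.
  assert (0 < INR (S k)) by (apply lt_0_INR; lia).
  set (w := 2 * PI * INR (S k)). assert (Hw : 0 < w) by (unfold w; nra).
  rewrite (int_deriv (fun x => sin (w * x) / w) (mode k)).
  - replace (w * (a + 1)) with (w * a + 2 * INR (S k) * PI) by (unfold w; ring).
    rewrite sin_period. toR. ring.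
  - intros x. unfold mode. fold w. auto_derive; [trivial|]. field. lra.
  - apply mode_cts.
Qed.

Lemma int_fejer M a : RInt (fejer M) a (a + 1) = 1.
Proof.
  unfold fejer. rewrite int_plus.
  - rewrite int_const, int_scal.
    + rewrite (int_psum (fun k x => (1 - INR (S k) / INR (S M)) * mode k x)).
      * rewrite (psum_ext _ (fun _ => 0)); [rewrite psum_const; toR; ring|].
        intros k _. rewrite int_scal by apply mode_cts. rewrite int_mode. toR. ring.
      * intros k. apply (cts_mult (fun _ => _)); [apply cts_const | apply mode_cts].
    + apply (psum_cts (fun k x => (1 - INR (S k) / INR (S M)) * mode k x)). intros k.
      apply (cts_mult (fun _ => _)); [apply cts_const | apply mode_cts].
  - apply cts_const.
  - intros x. apply (cts_mult (fun _ => 2)); [apply cts_const|].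
    apply (psum_cts (fun k x => (1 - INR (S k) / INR (S M)) * mode k x)). intros k.
    apply (cts_mult (fun _ => _)); [apply cts_const | apply mode_cts].
Qed.

Definition fejer_mean (M : nat) (a : R -> R) (th : R) : R :=
  RInt (fun phi => a phi * fejer M (phi - th)) 0 1.

Lemma cts_shift (f : R -> R) v : cts f -> cts (fun x => f (x + v)).
Proof.
  intros Hf. apply (cts_comp f (fun x => x + v)); [assumption|].
  apply (cts_plus (fun x => x)); [intros; apply continuous_id | apply cts_const].
Qed.

(** The kernel has mass 1 and the second moment of [sin (PI x)] against it is at
    most [1 / (M + 1)] by [fejer_identity]; this controls the first moment. *)
Lemma fejer_mean_error (a : R -> R) L M th : cts a -> periodic a ->
  (forall x, Rabs x <= 1 / 2 -> Rabs (a (th + x) - a th) <= L * Rabs x) ->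
  0 <= L -> Rabs (fejer_mean M a th - a th) <= L * (2 / sqrt (INR (S M))).
Proof.
  intros Ha Hp HL HL0.
  assert (Hn : 0 < INR (S M)) by (apply lt_0_INR; lia).
  assert (Hs : 0 < sqrt (INR (S M))) by (apply sqrt_lt_R0; lra).
  assert (Hss : sqrt (INR (S M)) * sqrt (INR (S M)) = INR (S M)) by (apply sqrt_sqrt; lra).
  set (r := sqrt (INR (S M))) in *.
  set (b := fun x => a (x + th)).
  assert (Hb : cts b) by (apply cts_shift; assumption).
  assert (E1 : fejer_mean M a th = RInt (fun x => b x * fejer M x) (- (1 / 2)) (- (1 / 2) + 1)).
  { unfold fejer_mean.
    assert (Hc : cts (fun phi => a phi * fejer M (phi - th))).
    { apply cts_mult; [assumption|]. apply (cts_shift (fejer M) (- th)), fejer_cts. }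
    rewrite <- (int_periodic _ (- (1 / 2) + th)) by
      (auto; intros x; simpl; rewrite Hp; f_equal;
       replace (x + 1 - th) with (x - th + 1) by ring; apply fejer_periodic).
    replace (- (1 / 2) + th + 1) with (- (1 / 2) + 1 + th) by ring.
    rewrite <- int_shift by assumption.
    apply int_ext. intros x. unfold b. do 2 f_equal; toR; ring. }
  assert (E2 : a th = RInt (fun x => a th * fejer M x) (- (1 / 2)) (- (1 / 2) + 1)).
  { rewrite int_scal by apply fejer_cts. rewrite int_fejer. toR. ring. }
  rewrite E1, E2. rewrite <- int_minus.
  2:{ apply cts_mult; [assumption | apply fejer_cts]. }
  2:{ apply (cts_mult (fun _ => _)); [apply cts_const | apply fejer_cts]. }
  eapply Rle_trans.
  { apply (int_abs_le _ (fun x => L / r * fejer M x + L * r / INR (S M))); [lra| | |].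
    - apply cts_minus; apply cts_mult; try apply fejer_cts; auto using cts_const.
    - apply cts_plus; [|apply cts_const].
      apply (cts_mult (fun _ => _)); [apply cts_const | apply fejer_cts].
    - intros x Hx.
      pose proof (fejer_pos M x ltac:(lra)) as Fp.
      replace (b x * fejer M x - a th * fejer M x) with ((a (th + x) - a th) * fejer M x)
        by (unfold b; rewrite (Rplus_comm x th); ring).
      rewrite Rabs_mult, (Rabs_pos_eq _ Fp).
      assert (Hx' : Rabs x <= 1 / 2) by (apply Rabs_le; lra).
      apply Rle_trans with (L * Rabs (sin (PI * x)) * fejer M x).
      { apply Rmult_le_compat_r; [assumption|]. eapply Rle_trans; [apply HL; assumption|].
        apply Rmult_le_compat_l; [assumption | apply sin_PI_lower; assumption]. }
      (* either [|s| <= 1 / r], or [1 <= r |s|] *)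
      assert (Hq : Rabs (sin (PI * x)) <= / r + r * sin (PI * x) ^ 2).
      { rewrite <- (pow2_abs (sin (PI * x))). set (q := Rabs (sin (PI * x))).
        assert (0 <= q) by apply Rabs_pos.
        assert (0 < / r) by (apply Rinv_0_lt_compat; lra).
        destruct (Rle_dec q (/ r)); [nra|].
        assert (1 <= r * q) by (rewrite <- (Rinv_r r) by lra; apply Rmult_le_compat_l; lra). nra. }
      apply Rle_trans with (L * (/ r + r * sin (PI * x) ^ 2) * fejer M x).
      { apply Rmult_le_compat_r; [assumption|]. apply Rmult_le_compat_l; assumption. }
      replace (L * (/ r + r * sin (PI * x) ^ 2) * fejer M x)
        with (L / r * fejer M x + L * r * (sin (PI * x) ^ 2 * fejer M x)) by (unfold Rdiv; ring).
      rewrite fejer_identity. apply Rplus_le_compat_l.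
      unfold Rdiv. rewrite <- (Rmult_assoc (L * r)).
      apply Rmult_le_compat_r; [apply Rlt_le, Rinv_0_lt_compat; lra|].
      rewrite <- (Rmult_1_r (L * r)) at 2. apply Rmult_le_compat_l; [nra|].
      pose proof (SIN_bound (INR (S M) * (PI * x))). nra. }
  rewrite int_plus, int_scal, int_fejer, int_const;
    auto using fejer_cts, cts_const.
  2:{ apply (cts_mult (fun _ => _)); [apply cts_const | apply fejer_cts]. }
  right. rewrite <- Hss. field. lra.
Qed.

Lemma fejer_mean_cv (a a' : R -> R) th : periodic a -> (forall x, is_derive a x (a' x)) -> cts a' ->
  is_lim_seq (fun M => fejer_mean M a th) (a th).
Proof.
  intros Hp Hd Ha'.
  assert (Ha : cts a) by (apply (cts_of_derive a a'); assumption).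
  destruct (continuity_ab_maj (fun x => Rabs (a' x)) (th - 1 / 2) (th + 1 / 2)) as [m [Hm _]];
    [lra | |].
  { intros x _. apply continuity_pt_filterlim. apply cts_abs; assumption. }
  set (L := Rabs (a' m)) in *.
  apply is_lim_seq_ext with (fun M => a th + (fejer_mean M a th - a th)); [intros; ring|].
  replace (Finite (a th)) with (Finite (a th + 0)) by (f_equal; ring). apply is_lim_seq_plus'; [apply is_lim_seq_const|].
  apply is_lim_seq_abs_0.
  apply is_lim_seq_le_le with (fun _ => 0) (fun M => L * (2 / sqrt (INR (S M)))).
  - intros M. split; [apply Rabs_pos|]. apply fejer_mean_error; auto; [|apply Rabs_pos].
    intros x Hx. apply Rabs_le_between in Hx.
    destruct (MVT_gen a th (th + x) a') as [c [Hc Heq]].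
    + intros; apply Hd.
    + intros; apply continuity_pt_filterlim, Ha.
    + rewrite Heq, Rabs_mult. replace (th + x - th) with x by ring.
      apply Rmult_le_compat_r; [apply Rabs_pos|]. apply Hm.
      revert Hc. unfold Rmin, Rmax. destruct (Rle_dec th (th + x)); lra.
  - apply is_lim_seq_const.
  - replace (Finite 0) with (Rbar_mult L (Finite 0)) by (simpl; f_equal; ring).
    apply is_lim_seq_scal_l.
    replace (Finite 0) with (Rbar_mult 2 (Finite 0)) by (simpl; f_equal; ring).
    apply (is_lim_seq_scal_l (fun M => / sqrt (INR (S M)))).
    replace (Finite 0) with (Rbar_inv p_infty) by reflexivity.
    apply is_lim_seq_inv; [|discriminate].
    apply (filterlim_comp _ _ _ (fun M => INR (S M)) sqrt _ (Rbar_locally p_infty)).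
    + apply (is_lim_seq_incr_1 INR p_infty). apply is_lim_seq_INR.
    + apply filterlim_sqrt_p.
Qed.

(** * Birkhoff sums of a rotation *)

Lemma mode_orbit_sum_identity alpha k x n :
  2 * sin (PI * (INR (S k) * alpha)) * psum (fun j => mode k (x - INR j * alpha)) n =
  sin (2 * PI * INR (S k) * x + PI * (INR (S k) * alpha)) -
  sin (2 * PI * INR (S k) * x + PI * (INR (S k) * alpha) - INR n * (2 * (PI * (INR (S k) * alpha)))).
Proof.
  set (b := PI * (INR (S k) * alpha)).
  induction n.
  - simpl. rewrite Rmult_0_l, Rminus_0_r. ring.
  - rewrite psum_S, Rmult_plus_distr_l, IHn. unfold mode.
    set (X := 2 * PI * INR (S k) * x) in *.
    replace (2 * PI * INR (S k) * (x - INR n * alpha)) with (X - INR n * (2 * b)) by (unfold X, b; ring).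
    rewrite S_INR.
    replace (X + b - INR n * (2 * b)) with ((X - INR n * (2 * b)) + b) by ring.
    replace (X + b - (INR n + 1) * (2 * b)) with ((X - INR n * (2 * b)) - b) by ring.
    rewrite (sin_plus (X - INR n * (2 * b)) b), (sin_minus (X - INR n * (2 * b)) b). ring.
Qed.

Lemma badly_approximable_sin c alpha k : 0 < c -> badly_approximable c alpha ->
  0 < Rabs (sin (PI * (INR (S k) * alpha))).
Proof.
  intros Hc Hb. apply Rabs_pos_lt. intros E.
  destruct (sin_eq_0_0 _ E) as [n Hn].
  assert (INR (S k) * alpha = IZR n).
  { pose proof PI_RGT_0. apply (Rmult_eq_reg_l PI); lra. }
  pose proof (Hb (S k) n ltac:(lia)) as H1.
  rewrite H, Rminus_diag, Rabs_R0 in H1.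
  assert (0 < c / INR (S k)); [|lra].
  apply Rdiv_lt_0_compat; [assumption | apply lt_0_INR; lia].
Qed.

(** A geometric sum: multiplied by [2 sin (PI k alpha)] it telescopes to a
    difference of two sines. *)
Lemma mode_orbit_sum c alpha k x n : 0 < c -> badly_approximable c alpha ->
  Rabs (psum (fun j => mode k (x - INR j * alpha)) n) <= small_divisor alpha (S k).
Proof.
  intros Hc Hb. pose proof (badly_approximable_sin c alpha k Hc Hb) as Hs.
  pose proof (mode_orbit_sum_identity alpha k x n) as E.
  unfold small_divisor. set (S := psum _ n) in *. set (s := sin (PI * _)) in *.
  apply (Rmult_le_reg_l (2 * Rabs s)); [lra|].
  replace (2 * Rabs s * / Rabs s) with 2 by (field; lra).
  replace (2 * Rabs s * Rabs S) with (Rabs (2 * s * S)).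
  - rewrite E. eapply Rle_trans; [apply Rabs_triang|]. rewrite Rabs_Ropp.
    apply Rle_trans with (1 + 1); [|lra].
    apply Rplus_le_compat; apply Rabs_le; apply SIN_bound.
  - rewrite !Rabs_mult, (Rabs_pos_eq 2) by lra. reflexivity.
Qed.

Section Birkhoff.
Variables (c alpha : R) (a a' a'' : R -> R).
Hypothesis Hc : 0 < c.
Hypothesis Hb : badly_approximable c alpha.
Hypothesis Hp : periodic a.
Hypothesis Hp' : periodic a'.
Hypothesis Hd : forall x, is_derive a x (a' x).
Hypothesis Hd' : forall x, is_derive a' x (a'' x).
Hypothesis Ha'' : cts a''.

Let Ha : cts a.
Proof. apply (cts_of_derive a a'); assumption. Qed.
Let Ha' : cts a'.
Proof. apply (cts_of_derive a' a''); assumption. Qed.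

Let freq (k : nat) := 2 * PI * INR (S k).
Let freq_pos k : 0 < freq k.
Proof.
  unfold freq. pose proof PI_RGT_0. assert (0 < INR (S k)) by (apply lt_0_INR; lia). nra.
Qed.

Let mode_shift_cts k th : cts (fun x => mode k (x - th)).
Proof. apply (cts_shift (mode k) (- th)), mode_cts. Qed.

Let fourier_coefficient k th :
  RInt (fun x => a x * mode k (x - th)) 0 1 =
  - / freq k ^ 2 * RInt (fun x => a'' x * mode k (x - th)) 0 1.
Proof.
  pose proof (freq_pos k) as Hw.
  set (w := freq k) in *.
  assert (E : RInt (fun x => a x * mode k (x - th) + / w ^ 2 * (a'' x * mode k (x - th))) 0 1 = 0).
  { rewrite (int_deriv (fun x => a x * sin (w * (x - th)) / w + a' x * cos (w * (x - th)) / w ^ 2)).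
    - replace (w * (1 - th)) with (w * (0 - th) + 2 * INR (S k) * PI) by (unfold w, freq; ring).
      rewrite sin_period, cos_period.
      replace (a 1) with (a 0) by (rewrite <- (Hp 0), Rplus_0_l; reflexivity).
      replace (a' 1) with (a' 0) by (rewrite <- (Hp' 0), Rplus_0_l; reflexivity).
      toR. ring.
    - intros x. unfold mode. fold (freq k). fold w.
      auto_derive; [repeat split; eexists; auto|].
      replace (Derive (fun x => a x) x) with (a' x) by (symmetry; apply is_derive_unique, Hd).
      replace (Derive (fun x => a' x) x) with (a'' x) by (symmetry; apply is_derive_unique, Hd').
      toR. change (x + - th) with (x - th). field. lra.
    - apply cts_plus.
      + apply cts_mult; auto.
      + apply (cts_mult (fun _ => / w ^ 2)); [apply cts_const|]. apply cts_mult; auto. }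
  rewrite int_plus, int_scal in E.
  - lra.
  - apply cts_mult; auto.
  - apply cts_mult; auto.
  - apply (cts_mult (fun _ => / w ^ 2)); [apply cts_const|]. apply cts_mult; auto.
Qed.

Let fejer_mean_expansion M th :
  fejer_mean M a th = RInt a 0 1 +
    psum (fun k => - (2 * (1 - INR (S k) / INR (S M)) / freq k ^ 2) *
                   RInt (fun x => a'' x * mode k (x - th)) 0 1) M.
Proof.
  unfold fejer_mean.
  rewrite (int_ext _ (fun x => a x +
     psum (fun k => 2 * (1 - INR (S k) / INR (S M)) * (a x * mode k (x - th))) M)).
  - assert (Hk : forall k, cts (fun x => 2 * (1 - INR (S k) / INR (S M)) * (a x * mode k (x - th)))).
    { intros k. apply (cts_mult (fun _ => _)); [apply cts_const|]. apply cts_mult; auto. }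
    rewrite int_plus; auto.
    2:{ apply (psum_cts (fun k x => 2 * (1 - INR (S k) / INR (S M)) * (a x * mode k (x - th)))); auto. }
    f_equal.
    rewrite (int_psum (fun k x => 2 * (1 - INR (S k) / INR (S M)) * (a x * mode k (x - th)))) by auto.
    apply psum_ext. intros k _.
    rewrite int_scal by (apply cts_mult; auto).
    rewrite fourier_coefficient. pose proof (freq_pos k). pose proof (lt_0_INR (S M) ltac:(lia)).
    field. lra.
  - intros x. unfold fejer. rewrite Rmult_plus_distr_l, Rmult_1_r. f_equal.
    rewrite <- psum_scal, <- psum_scal. apply psum_ext. intros; ring.
Qed.

(** Two integrations by parts gain [1 / k ^ 2] in the [k]-th Fourier coefficient,
    the summation along the orbit costs [1 / |sin (PI k alpha)|], and
    [weighted_sum_bound] sums the product. The Fejer means keep all sums finite;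
    the bound does not depend on their order. *)
Lemma birkhoff_sum_bound n th :
  Rabs (psum (fun j => a (th + INR j * alpha)) n - INR n * RInt a 0 1)
    <= 48 / c * RInt (fun x => Rabs (a'' x)) 0 1.
Proof.
  set (A := RInt (fun x => Rabs (a'' x)) 0 1).
  assert (HA : 0 <= A).
  { apply RInt_ge_0; [lra | apply cts_int, cts_abs; auto | intros; apply Rabs_pos]. }
  assert (HM : forall M, Rabs (psum (fun j => fejer_mean M a (th + INR j * alpha)) n
      - INR n * RInt a 0 1) <= 48 / c * A).
  { intros M.
    rewrite (psum_ext _ (fun j => RInt a 0 1 + psum (fun k =>
       - (2 * (1 - INR (S k) / INR (S M)) / freq k ^ 2) *
       RInt (fun x => a'' x * mode k (x - (th + INR j * alpha))) 0 1) M))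
      by (intros; apply fejer_mean_expansion).
    rewrite psum_plus, psum_const, psum_swap.
    match goal with |- Rabs ?lhs <= _ => replace lhs with (psum (fun k =>
      - (2 * (1 - INR (S k) / INR (S M)) / freq k ^ 2) *
      RInt (fun x => a'' x * psum (fun j => mode k (x - th - INR j * alpha)) n) 0 1) M) end.
    2:{ match goal with |- _ = _ + ?y - _ => transitivity y; [|ring] end.
        apply psum_ext. intros k _. rewrite psum_scal. f_equal.
        rewrite <- (int_psum (fun j x => a'' x * mode k (x - (th + INR j * alpha))))
          by (intros j; apply cts_mult; auto).
        apply int_ext. intros x. rewrite <- psum_scal. apply psum_ext. intros j _.
        do 2 f_equal. ring. }
    eapply Rle_trans; [apply psum_abs|].
    apply Rle_trans with (psum (fun k => A * (small_divisor alpha (S k) / INR (S k) ^ 2)) M).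
    - apply psum_le. intros k Hk.
      pose proof (lt_0_INR (S k) ltac:(lia)) as Hk0. pose proof (lt_0_INR (S M) ltac:(lia)) as HM0.
      pose proof (freq_pos k) as Hw.
      rewrite Rabs_mult, Rabs_Ropp.
      assert (B1 : Rabs (RInt (fun x => a'' x * psum (fun j => mode k (x - th - INR j * alpha)) n) 0 1)
         <= small_divisor alpha (S k) * A).
      { unfold A. rewrite <- int_scal by (apply cts_abs; auto).
        assert (Hc2 : cts (fun x => psum (fun j => mode k (x - th - INR j * alpha)) n)).
        { apply (psum_cts (fun j x => mode k (x - th - INR j * alpha))). intros j x.
          apply (continuous_ext (fun x => mode k (x - (th + INR j * alpha)))).
          - intros y. f_equal. ring.
          - apply mode_shift_cts. }
        apply int_abs_le; [lra | apply cts_mult; auto | |].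
        - apply (cts_mult (fun _ => _)); [apply cts_const | apply cts_abs; auto].
        - intros x _. rewrite Rabs_mult, Rmult_comm.
          apply Rmult_le_compat_r; [apply Rabs_pos|].
          apply (mode_orbit_sum c); auto. }
      assert (B2 : Rabs (2 * (1 - INR (S k) / INR (S M)) / freq k ^ 2) <= / INR (S k) ^ 2).
      { assert (Hq : 0 <= 1 - INR (S k) / INR (S M) <= 1).
        { assert (0 < INR (S k) / INR (S M)) by (apply Rdiv_lt_0_compat; lra).
          assert (INR (S k) / INR (S M) <= 1); [|lra].
          apply (Rmult_le_reg_r (INR (S M))); [assumption|]. unfold Rdiv.
          rewrite Rmult_assoc, Rinv_l, Rmult_1_r, Rmult_1_l by lra. apply le_INR; lia. }
        rewrite Rabs_pos_eq.
        2:{ apply Rmult_le_pos; [lra|]. apply Rlt_le, Rinv_0_lt_compat, pow_lt; lra. }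
        apply (Rmult_le_reg_r (freq k ^ 2)); [apply pow_lt; lra|].
        unfold Rdiv at 1. rewrite Rmult_assoc, Rinv_l, Rmult_1_r by (apply pow_nonzero; lra).
        replace (/ INR (S k) ^ 2 * freq k ^ 2) with (4 * PI ^ 2) by (unfold freq; field; lra).
        pose proof PI2_3_2. nra. }
      apply Rle_trans with (/ INR (S k) ^ 2 * (small_divisor alpha (S k) * A)).
      { apply Rmult_le_compat; auto using Rabs_pos. }
      right. field. lra.
    - rewrite psum_scal.
      rewrite Rmult_comm. apply Rmult_le_compat_r; [assumption|].
      replace (48 / c) with (12 * (4 / c)) by (field; lra).
      apply (weighted_sum_bound (fun k => small_divisor alpha (S k)) (4 / c)).
      + apply Rlt_le, Rdiv_lt_0_compat; lra.
      + intros m. apply small_divisor_sum; auto. }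
  assert (Hlim : is_lim_seq (fun M => psum (fun j => fejer_mean M a (th + INR j * alpha)) n)
     (psum (fun j => a (th + INR j * alpha)) n)).
  { clear HM. induction n; simpl; [apply is_lim_seq_const|].
    apply is_lim_seq_plus'; [assumption|]. apply (fejer_mean_cv a a'); auto. }
  assert (Hlim2 : is_lim_seq (fun M => Rabs (psum (fun j => fejer_mean M a (th + INR j * alpha)) n
      - INR n * RInt a 0 1)) (Rabs (psum (fun j => a (th + INR j * alpha)) n - INR n * RInt a 0 1))).
  { apply (is_lim_seq_abs _ (Finite _)). apply is_lim_seq_minus'; [assumption | apply is_lim_seq_const]. }
  apply (is_lim_seq_le _ (fun _ => 48 / c * A) (Finite _) (Finite _) HM Hlim2).
  apply is_lim_seq_const.
Qed.

End Birkhoff.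

(** * The momentum as a function on the torus *)

(** With [s = 2 - sin (2 PI y1) - sin (2 PI y2)] and [g] the exponent of the
    potential, this is the solution [q] of [q ^ 2 / 2 - s ^ g = h]. *)
Definition profile (g h s : R) : R := sqrt (2 * (Rpower s g + h)).
Definition profile1 (g h s : R) : R := g * Rpower s g / (s * profile g h s).
Definition profile2 (g h s : R) : R :=
  g * (g - 1) * Rpower s g / (s ^ 2 * profile g h s)
  - g ^ 2 * Rpower s g ^ 2 / (s ^ 2 * profile g h s ^ 3).

Lemma Rpower_pos s g : 0 < Rpower s g.
Proof. apply exp_pos. Qed.

Lemma profile_pos g h s : 0 <= h -> 0 < profile g h s.
Proof. intros H. apply sqrt_lt_R0. pose proof (Rpower_pos s g). lra. Qed.

Lemma profile_sqr g h s : 0 <= h -> profile g h s * profile g h s = 2 * (Rpower s g + h).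
Proof. intros H. apply sqrt_sqrt. pose proof (Rpower_pos s g). lra. Qed.

Lemma is_derive_Rpower g s : 0 < s ->
  is_derive (fun x => Rpower x g) s (g * Rpower s g / s).
Proof.
  intros Hs. unfold Rpower. auto_derive; [assumption|]. field. lra.
Qed.

Lemma is_derive_profile g h s : 0 <= h -> 0 < s ->
  is_derive (profile g h) s (profile1 g h s).
Proof.
  intros Hh Hs. unfold profile1.
  pose proof (profile_pos g h s Hh) as Hp. unfold profile in *.
  evar_last.
  - apply (is_derive_comp sqrt (fun s => 2 * (Rpower s g + h))).
    + apply is_derive_Reals, derivable_pt_lim_sqrt. pose proof (Rpower_pos s g). lra.
    + apply (is_derive_scal (fun s => Rpower s g + h) s 2).
      apply (is_derive_plus (fun s => Rpower s g) (fun _ => h)).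
      * apply is_derive_Rpower; assumption.
      * apply (is_derive_const h).
  - unfold scal, plus, zero; simpl. unfold mult; simpl. toR. field. lra.
Qed.

Lemma is_derive_profile1 g h s : 0 <= h -> 0 < s ->
  is_derive (profile1 g h) s (profile2 g h s).
Proof.
  intros Hh Hs. unfold profile1.
  pose proof (profile_pos g h s Hh) as Hp.
  pose proof (is_derive_profile g h s Hh Hs) as D1.
  pose proof (is_derive_Rpower g s Hs) as D2.
  auto_derive.
  - repeat split; try (eexists; eassumption). apply Rgt_not_eq. nra.
  - replace (Derive (fun x => Rpower x g) s) with (g * Rpower s g / s)
      by (symmetry; apply is_derive_unique; assumption).
    replace (Derive (fun x => profile g h x) s) with (profile1 g h s)
      by (symmetry; apply is_derive_unique; assumption).
    unfold profile1, profile2. toR. field. lra.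
Qed.

Lemma profile1_bound g h s : 0 < g -> 0 <= h -> 0 < s ->
  Rabs (profile1 g h s) <= g * (Rpower s (g / 2) / s).
Proof.
  intros Hg Hh Hs.
  pose proof (profile_pos g h s Hh) as Hp. pose proof (profile_sqr g h s Hh) as Hq.
  pose proof (Rpower_pos s (g / 2)) as Hr.
  assert (E : Rpower s (g / 2) * Rpower s (g / 2) = Rpower s g)
    by (rewrite <- Rpower_plus; f_equal; field).
  unfold profile1. set (P := profile g h s) in *. set (r := Rpower s (g / 2)) in *.
  rewrite <- E in *.
  assert (r <= P) by nra.
  assert (0 < g * (r * r) / (s * P)) by (apply Rdiv_lt_0_compat; repeat apply Rmult_lt_0_compat; lra).
  rewrite Rabs_pos_eq by lra.
  apply (Rmult_le_reg_r (s * P)); [apply Rmult_lt_0_compat; lra|].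
  replace (g * (r * r) / (s * P) * (s * P)) with (g * r * r) by (field; lra).
  replace (g * (r / s) * (s * P)) with (g * r * P) by (field; lra).
  apply Rmult_le_compat_l; nra.
Qed.

Lemma profile2_bound g h s : 0 < g -> 0 <= h -> 0 < s ->
  Rabs (profile2 g h s) <= (g * Rabs (g - 1) + g ^ 2) * (Rpower s (g / 2) / s ^ 2).
Proof.
  intros Hg Hh Hs.
  pose proof (profile_pos g h s Hh) as Hp. pose proof (profile_sqr g h s Hh) as Hq.
  pose proof (Rpower_pos s (g / 2)) as Hr.
  assert (E : Rpower s (g / 2) * Rpower s (g / 2) = Rpower s g)
    by (rewrite <- Rpower_plus; f_equal; field).
  unfold profile2. set (P := profile g h s) in *. set (r := Rpower s (g / 2)) in *.
  rewrite <- E in *.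
  assert (HrP : r <= P) by nra.
  assert (Hs2 : 0 < / s ^ 2) by (apply Rinv_0_lt_compat, pow_lt; lra).
  set (q := r / P).
  assert (Hq1 : 0 <= q <= 1).
  { unfold q. split; [apply Rlt_le, Rdiv_lt_0_compat; lra|].
    apply (Rmult_le_reg_r P); [assumption|]. unfold Rdiv.
    rewrite Rmult_assoc, Rinv_l by lra. lra. }
  replace (g * (g - 1) * (r * r) / (s ^ 2 * P) - g ^ 2 * (r * r) ^ 2 / (s ^ 2 * P ^ 3))
    with ((g * (g - 1) * q - g ^ 2 * q ^ 3) * (r * / s ^ 2)) by (unfold q; field; lra).
  rewrite Rabs_mult, (Rabs_pos_eq (r * / s ^ 2)) by nra.
  apply Rmult_le_compat_r; [nra|].
  eapply Rle_trans; [apply Rabs_triang|]. rewrite Rabs_Ropp.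
  rewrite !Rabs_mult, (Rabs_pos_eq g), (Rabs_pos_eq q), (Rabs_pos_eq (g ^ 2)), (Rabs_pos_eq (q ^ 3)) by
    (try apply pow_le; lra).
  pose proof (Rabs_pos (g - 1)).
  assert (q ^ 3 <= 1) by (rewrite <- (pow1 3); apply pow_incr; lra).
  assert (0 <= g * Rabs (g - 1)) by nra.
  assert (0 <= g ^ 2) by (apply pow_le; lra).
  nra.
Qed.

(** One coordinate of [2 - sin (2 pi y1) - sin (2 pi y2)]. *)
Definition gap (y : R) : R := 1 - sin (2 * PI * y).

Lemma gap_bound y : 0 <= gap y <= 2.
Proof. unfold gap. pose proof (SIN_bound (2 * PI * y)). lra. Qed.

Lemma gap_cts : cts gap.
Proof.
  apply (cts_minus (fun _ => 1)); [apply cts_const|]. apply cts_sin.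
  intros x. apply (cts_mult (fun _ => 2 * PI) (fun x => x)); intros;
    [apply cts_const | apply continuous_id].
Qed.

Lemma gap_periodic : periodic gap.
Proof.
  intros x. unfold gap. replace (2 * PI * (x + 1)) with (2 * PI * x + 2 * INR 1 * PI) by (simpl; ring).
  rewrite sin_period. reflexivity.
Qed.

Lemma gap_half x : gap (- x) = gap (x + 1 / 2).
Proof.
  unfold gap. replace (2 * PI * - x) with (- (2 * PI * x)) by ring.
  replace (2 * PI * (x + 1 / 2)) with (2 * PI * x + PI) by field.
  rewrite sin_neg, neg_sin. reflexivity.
Qed.

Section Line.
Variables (g h b : R).
Hypothesis Hg : 0 < g.
Hypothesis Hh : 0 <= h.
Hypothesis Hb : 0 < b.

Definition line (x : R) := profile g h (b + gap x).
Definition line1 (x : R) := profile1 g h (b + gap x) * (- (2 * PI * cos (2 * PI * x))).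
Definition line2 (x : R) :=
  profile2 g h (b + gap x) * (2 * PI * cos (2 * PI * x)) ^ 2
  + profile1 g h (b + gap x) * (4 * PI ^ 2 * sin (2 * PI * x)).

Let Hs x : 0 < b + gap x.
Proof. pose proof (gap_bound x). lra. Qed.

Let is_derive_gap x : is_derive (fun x => b + gap x) x (- (2 * PI * cos (2 * PI * x))).
Proof. unfold gap. auto_derive; [trivial|]. ring. Qed.

Lemma is_derive_line x : is_derive line x (line1 x).
Proof.
  unfold line, line1. evar_last.
  - apply (is_derive_comp (profile g h) (fun x => b + gap x)).
    + apply is_derive_profile; auto.
    + apply is_derive_gap.
  - unfold scal; simpl; unfold mult; simpl. toR. ring.
Qed.

Lemma is_derive_line1 x : is_derive line1 x (line2 x).
Proof.
  unfold line1, line2.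
  assert (D : is_derive (fun x => profile1 g h (b + gap x)) x
    (profile2 g h (b + gap x) * (- (2 * PI * cos (2 * PI * x))))).
  { evar_last.
    - apply (is_derive_comp (profile1 g h) (fun x => b + gap x)).
      + apply is_derive_profile1; auto.
      + apply is_derive_gap.
    - unfold scal; simpl; unfold mult; simpl. toR. ring. }
  assert (Gen : forall F dF, is_derive F x dF ->
    is_derive (fun x => F x * (- (2 * PI * cos (2 * PI * x)))) x
      (dF * (- (2 * PI * cos (2 * PI * x))) + F x * (4 * PI ^ 2 * sin (2 * PI * x)))).
  { intros F dF HF. auto_derive; [exists dF; exact HF|].
    replace (Derive (fun x => F x) x) with dF by (symmetry; apply is_derive_unique; exact HF).
    toR. ring. }
  evar_last; [apply (Gen _ _ D)|]. toR. ring.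
Qed.

Lemma line2_cts : cts line2.
Proof.
  intros x. unfold line2.
  assert (Hprof : ex_derive (profile g h) (b + gap x)).
  { eexists. apply is_derive_profile; auto. }
  assert (Hpow : ex_derive (fun s => Rpower s g) (b + gap x)).
  { eexists. apply is_derive_Rpower; auto. }
  assert (Hgap : forall x, ex_derive gap x).
  { intros y. unfold gap. auto_derive. trivial. }
  apply (ex_derive_continuous (fun x => profile2 g h (b + gap x) * (2 * PI * cos (2 * PI * x)) ^ 2
  + profile1 g h (b + gap x) * (4 * PI ^ 2 * sin (2 * PI * x)))).
  unfold profile2, profile1.
  pose proof (Hs x) as Hsx. pose proof (profile_pos g h (b + gap x) Hh) as Hp.
  auto_derive.
  assert (0 < (b + gap x) * profile g h (b + gap x)) by nra.
  repeat split; auto; apply Rgt_not_eq; repeat apply Rmult_lt_0_compat; lra.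
Qed.

Lemma line_periodic : periodic line.
Proof. intros x. unfold line. rewrite gap_periodic. reflexivity. Qed.

Lemma line1_periodic : periodic line1.
Proof.
  intros x. unfold line1. rewrite gap_periodic.
  replace (2 * PI * (x + 1)) with (2 * PI * x + 2 * INR 1 * PI) by (simpl; ring).
  rewrite cos_period. reflexivity.
Qed.

Definition curvature_constant : R := 4 * PI ^ 2 * (2 * (g * Rabs (g - 1) + g ^ 2) + g).

(** [cos ^ 2 <= 2 gap] gains back one of the two powers of [s] lost by
    differentiating the profile twice. *)
Lemma line2_bound x :
  Rabs (line2 x) <= curvature_constant * (Rpower (b + gap x) (g / 2) / (b + gap x)).
Proof.
  unfold line2, curvature_constant.
  pose proof (Hs x) as Hsx.
  pose proof (profile1_bound g h _ Hg Hh Hsx) as B1.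
  pose proof (profile2_bound g h _ Hg Hh Hsx) as B2.
  assert (Hcos : cos (2 * PI * x) ^ 2 <= 2 * (b + gap x)).
  { pose proof (sin2_cos2 (2 * PI * x)) as E. unfold Rsqr in E. unfold gap.
    pose proof (SIN_bound (2 * PI * x)). nra. }
  set (s := b + gap x) in *. set (r := Rpower s (g / 2)) in *.
  assert (Hr : 0 < r) by apply Rpower_pos.
  assert (Hrs : 0 < r / s) by (apply Rdiv_lt_0_compat; lra).
  set (K := g * Rabs (g - 1) + g ^ 2) in *.
  assert (HK : 0 <= K) by (unfold K; pose proof (Rabs_pos (g - 1)); nra).
  pose proof PI_RGT_0.
  assert (HPI : 0 < 4 * PI ^ 2) by nra.
  eapply Rle_trans; [apply Rabs_triang|].
  rewrite (Rabs_mult (profile2 g h s)), (Rabs_mult (profile1 g h s)).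
  apply Rle_trans with (K * (r / s ^ 2) * (4 * PI ^ 2 * (2 * s)) + g * (r / s) * (4 * PI ^ 2)).
  - apply Rplus_le_compat.
    + apply Rmult_le_compat; auto using Rabs_pos.
      rewrite Rabs_pos_eq by apply pow2_ge_0.
      replace ((2 * PI * cos (2 * PI * x)) ^ 2) with (4 * PI ^ 2 * cos (2 * PI * x) ^ 2) by ring.
      apply Rmult_le_compat_l; lra.
    + apply Rmult_le_compat; auto using Rabs_pos.
      rewrite Rabs_mult, (Rabs_pos_eq (4 * PI ^ 2)) by lra.
      rewrite <- (Rmult_1_r (4 * PI ^ 2)) at 2. apply Rmult_le_compat_l; [lra|].
      apply Rabs_le. apply SIN_bound.
  - right. field. lra.
Qed.

End Line.

Lemma cts_Rpower (f : R -> R) e : cts f -> (forall x, 0 < f x) -> cts (fun x => Rpower (f x) e).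
Proof.
  intros Hf Hp x. apply (continuous_comp f (fun s => Rpower s e)); [apply Hf|].
  apply (ex_derive_continuous (fun s => Rpower s e)). eexists. apply is_derive_Rpower; auto.
Qed.

Lemma Rpower_antitone a b e : 0 < a <= b -> 0 <= e -> Rpower b (- e) <= Rpower a (- e).
Proof.
  intros Hab He. rewrite !Rpower_Ropp. apply Rinv_le_contravar; [apply Rpower_pos|].
  apply Rle_Rpower_l; assumption.
Qed.

Lemma int_even (f : R -> R) a : cts f -> (forall x, f (- x) = f x) ->
  RInt f (- a) 0 = RInt f 0 a.
Proof.
  intros Hf He. pose proof (int_dilate f (- 1) 0 a Hf) as H.
  rewrite (int_ext (fun x => f (-1 * x)) f) in H
    by (intros x; replace (-1 * x) with (- x) by ring; apply He).
  replace (-1 * 0) with 0 in H by ring. replace (-1 * a) with (- a) in H by ring.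
  pose proof (int_Chasles f (- a) 0 (- a) Hf) as H1.
  replace (RInt f (- a) (- a)) with 0 in H1 by (symmetry; exact (RInt_point (- a) f)). lra.
Qed.

(** * A weight dominating the curvature along the lines *)

(** [- e / 2] is half of the exponent of the curvature bound, since the weight
    enters once in each coordinate. *)
Definition weight (k e y : R) : R := Rpower (gap y + k / 2) (- (e / 2)).

Lemma weight_cts k e : 0 < k -> cts (weight k e).
Proof.
  intros Hk. apply (cts_Rpower (fun y => gap y + k / 2)).
  - apply (cts_plus gap); [apply gap_cts | apply cts_const].
  - intros x. pose proof (gap_bound x). lra.
Qed.

Lemma weight_pos k e y : 0 < weight k e y.
Proof. apply Rpower_pos. Qed.

Lemma weight_periodic k e : periodic (weight k e).
Proof. intros x. unfold weight. rewrite gap_periodic. reflexivity. Qed.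

(** The minimum of [gap] is quadratic, so the weight is at most
    [|z| ^ (- e)] at distance [z] from it, uniformly in the regularisation. *)
Lemma weight_int k e : 0 < k <= 1 -> 0 < e < 1 ->
  RInt (weight k e) 0 1 <= 2 / (1 - e).
Proof.
  intros Hk He.
  set (r := sqrt k / 2).
  assert (Hs : 0 < sqrt k) by (apply sqrt_lt_R0; lra).
  assert (Hr : 0 < r) by (unfold r; lra).
  assert (Hrr : r * r = k / 4).
  { unfold r. replace (sqrt k / 2 * (sqrt k / 2)) with (sqrt k * sqrt k / 4) by field.
    rewrite sqrt_sqrt by lra. reflexivity. }
  set (v := fun z => Rpower (Rabs z + r) (- e)).
  assert (Hv : cts v).
  { apply (cts_Rpower (fun z => Rabs z + r)).
    - apply (cts_plus Rabs); [apply continuous_Rabs | apply cts_const].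
    - intros x. pose proof (Rabs_pos x). lra. }
  pose proof (weight_cts k e ltac:(lra)) as Hw.
  rewrite <- (int_periodic _ (- (1 / 2) + 1 / 4)) by (auto using weight_periodic).
  replace (- (1 / 2) + 1 / 4 + 1) with (1 / 2 + 1 / 4) by lra.
  rewrite <- int_shift by assumption.
  apply Rle_trans with (RInt v (- (1 / 2)) (1 / 2)).
  - apply int_le; [lra | apply cts_shift; assumption | assumption |].
    intros z Hz. unfold weight, v.
    assert (Hz' : Rabs z <= 1 / 2) by (apply Rabs_le; lra).
    assert (E : gap (z + 1 / 4) = 2 * sin (PI * z) ^ 2).
    { unfold gap. replace (2 * PI * (z + 1 / 4)) with (PI / 2 + 2 * (PI * z)) by field.
      rewrite <- cos_sin. rewrite cos_2a_sin. ring. }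
    pose proof (sin_PI_lower z Hz') as L. pose proof (Rabs_pos z) as P.
    assert (L2 : Rabs z ^ 2 <= sin (PI * z) ^ 2).
    { rewrite <- (pow2_abs (sin (PI * z))). apply pow_incr. lra. }
    assert (0 < Rabs z + r) by lra.
    assert (Q : (Rabs z + r) ^ 2 <= gap (z + 1 / 4) + k / 2) by (rewrite E; pose proof (pow2_ge_0 (Rabs z - r)); nra).
    replace (Rpower (Rabs z + r) (- e)) with (Rpower ((Rabs z + r) ^ 2) (- (e / 2))).
    + apply Rpower_antitone; [|lra]. split; [apply pow_lt; lra | assumption].
    + rewrite <- Rpower_pow by assumption. rewrite Rpower_mult. f_equal. simpl. field.
  - rewrite <- (int_Chasles v (- (1 / 2)) 0 (1 / 2)) by assumption.
    rewrite (int_even v (1 / 2)) by (auto; intros x; unfold v; rewrite Rabs_Ropp; reflexivity).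
    assert (H : RInt v 0 (1 / 2) <= 1 / (1 - e)).
    { rewrite (RInt_ext v (fun z => Rpower (z + r) (- e))).
      2:{ intros z. rewrite Rmin_left, Rmax_right by lra. intros Hz. unfold v.
          rewrite Rabs_pos_eq by lra. reflexivity. }
      assert (I : is_RInt (fun z => Rpower (z + r) (- e)) 0 (1 / 2)
        (Rpower (1 / 2 + r) (1 - e) / (1 - e) - Rpower (0 + r) (1 - e) / (1 - e))).
      { apply (is_RInt_derive (fun z => Rpower (z + r) (1 - e) / (1 - e))).
        - intros z. rewrite Rmin_left, Rmax_right by lra. intros Hz.
          unfold Rpower. auto_derive; [lra|].
          replace ((- e) * ln (z + r)) with ((1 - e) * ln (z + r) + - ln (z + r)) by ring.
          rewrite exp_plus, exp_Ropp, exp_ln by lra. toR. field. lra.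
        - intros z. rewrite Rmin_left, Rmax_right by lra. intros Hz.
          apply (ex_derive_continuous (fun z => Rpower (z + r) (- e))).
          unfold Rpower. auto_derive. lra. }
      rewrite (is_RInt_unique _ _ _ _ I).
      assert (r <= 1 / 2).
      { unfold r. assert (sqrt k <= 1) by (rewrite <- sqrt_1; apply sqrt_le_1; lra). lra. }
      assert (Rpower (1 / 2 + r) (1 - e) <= 1).
      { apply Rle_trans with (Rpower 1 (1 - e)); [apply Rle_Rpower_l; lra|].
        unfold Rpower. rewrite ln_1, Rmult_0_r, exp_0. lra. }
      pose proof (Rpower_pos (0 + r) (1 - e)).
      assert (0 < / (1 - e)) by (apply Rinv_0_lt_compat; lra).
      unfold Rdiv. nra. }
    lra.
Qed.

(** A number of [(0, 1)] with [s ^ (g / 2 - 1) <= C s ^ (- exponent g)] for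
    bounded [s]: by [1 / (1 + x) >= 1 - x]. *)
Definition exponent (g : R) : R := / (1 + g / 2).

Lemma exponent_bound g : 0 < g -> 0 < exponent g < 1 /\ 0 <= g / 2 - 1 + exponent g.
Proof.
  intros Hg. unfold exponent.
  assert (Hi : 0 < / (1 + g / 2)) by (apply Rinv_0_lt_compat; lra).
  assert (E : / (1 + g / 2) * (1 + g / 2) = 1) by (field; lra).
  set (i := / (1 + g / 2)) in *. split; nra.
Qed.

Definition line_constant (g : R) : R :=
  curvature_constant g * Rpower 5 (g / 2 - 1 + exponent g).

Lemma line_constant_pos g : 0 < g -> 0 < line_constant g.
Proof.
  intros Hg. apply Rmult_lt_0_compat; [|apply Rpower_pos].
  unfold curvature_constant. pose proof PI_RGT_0. pose proof (Rabs_pos (g - 1)).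
  apply Rmult_lt_0_compat; nra.
Qed.

(** The sum [s] of the two gaps is at least the square root of their product, so
    the negative power of [s] is dominated by a product of two integrable
    functions of one variable. *)
Lemma line2_weight g h k x y : 0 < g -> 0 <= h -> 0 < k <= 1 ->
  Rabs (line2 g h (k + gap y) x) <=
  line_constant g * weight k (exponent g) y * weight k (exponent g) x.
Proof.
  intros Hg Hh Hk.
  pose proof (gap_bound x) as Hx. pose proof (gap_bound y) as Hy.
  destruct (exponent_bound g Hg) as [He1 He2].
  set (e := exponent g) in *.
  eapply Rle_trans; [apply line2_bound; lra|].
  unfold line_constant. fold e. rewrite !Rmult_assoc.
  apply Rmult_le_compat_l.
  { unfold curvature_constant. pose proof PI_RGT_0. pose proof (Rabs_pos (g - 1)).
    apply Rmult_le_pos; nra. }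
  set (s := k + gap y + gap x).
  assert (Hs : 0 < s <= 5) by (unfold s; lra).
  replace (Rpower s (g / 2) / s) with (Rpower s (g / 2 - 1 + e) * Rpower s (- e)).
  2:{ rewrite <- Rpower_plus. replace (g / 2 - 1 + e + - e) with (g / 2 + - (1)) by ring.
      rewrite Rpower_plus, Rpower_Ropp, Rpower_1 by lra. reflexivity. }
  apply Rmult_le_compat; try (apply Rlt_le, Rpower_pos).
  - apply Rle_Rpower_l; lra.
  - unfold weight. set (p := gap y + k / 2). set (q := gap x + k / 2).
    assert (Hp : 0 < p) by (unfold p; lra). assert (Hq : 0 < q) by (unfold q; lra).
    replace s with (p + q) by (unfold s, p, q; field).
    rewrite Rpower_mult_distr by assumption.
    replace (Rpower (p + q) (- e)) with (Rpower ((p + q) ^ 2) (- (e / 2))).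
    + apply Rpower_antitone; [|lra]. split; nra.
    + rewrite <- Rpower_pow by lra. rewrite Rpower_mult. f_equal. simpl. field.
Qed.

Lemma line2_int g h k y : 0 < g -> 0 <= h -> 0 < k <= 1 ->
  RInt (fun x => Rabs (line2 g h (k + gap y) x)) 0 1 <=
  line_constant g * (2 / (1 - exponent g)) * weight k (exponent g) y.
Proof.
  intros Hg Hh Hk.
  destruct (exponent_bound g Hg) as [He1 He2].
  pose proof (gap_bound y) as Hy. pose proof (line_constant_pos g Hg) as Hl.
  apply Rle_trans with
    (RInt (fun x => line_constant g * weight k (exponent g) y * weight k (exponent g) x) 0 1).
  - apply int_le; [lra | apply cts_abs, line2_cts; lra | | ].
    + apply (cts_mult (fun _ => _)); [apply cts_const | apply weight_cts; lra].
    + intros x _. apply line2_weight; lra.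
  - rewrite int_scal by (apply weight_cts; lra).
    pose proof (weight_int k (exponent g) Hk He1) as Hw.
    pose proof (weight_pos k (exponent g) y).
    rewrite (Rmult_assoc _ (2 / _)), (Rmult_comm (2 / _)), <- Rmult_assoc.
    apply Rmult_le_compat_l; [|assumption]. nra.
Qed.

(** * The linear flow on the torus *)

Lemma cts_2d_fst (f : R -> R -> R) y : (forall x y, continuity_2d_pt f x y) -> cts (fun x => f x y).
Proof.
  intros H x. apply continuity_pt_filterlim. intros e He.
  destruct (H x y (mkposreal e He)) as [d Hd].
  exists d. split; [apply cond_pos|]. intros z [_ Hz]. apply Hd; [exact Hz|].
  rewrite Rminus_diag, Rabs_R0. apply cond_pos.
Qed.

Lemma cts_2d_comp (f : R -> R -> R) (p q : R -> R) : (forall x y, continuity_2d_pt f x y) ->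
  cts p -> cts q -> cts (fun x => f (p x) (q x)).
Proof.
  intros H Hp Hq x. apply continuity_pt_filterlim. intros e He.
  destruct (H (p x) (q x) (mkposreal e He)) as [d Hd].
  pose proof (Hp x) as Hpx. pose proof (Hq x) as Hqx.
  apply continuity_pt_filterlim in Hpx. apply continuity_pt_filterlim in Hqx.
  destruct (Hpx d (cond_pos d)) as [d1 [Hd1 H1]]. destruct (Hqx d (cond_pos d)) as [d2 [Hd2 H2]].
  exists (Rmin d1 d2). split; [apply Rmin_pos; assumption|].
  intros z [Hz1 Hz2].
  destruct (Req_dec z x) as [->|Hne].
  { simpl. unfold Rdist. rewrite Rminus_diag, Rabs_R0. assumption. }
  apply Hd.
  - apply (H1 z). split; [exact Hz1|]. eapply Rlt_le_trans; [exact Hz2 | apply Rmin_l].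
  - apply (H2 z). split; [exact Hz1|]. eapply Rlt_le_trans; [exact Hz2 | apply Rmin_r].
Qed.

Lemma int_param_cts (f : R -> R -> R) : (forall x y, continuity_2d_pt f x y) ->
  cts (fun y => RInt (fun x => f x y) 0 1).
Proof.
  intros H y. apply continuity_pt_filterlim. intros e He.
  destruct (uniform_continuity_2d_1d f 0 1 y (fun x _ => H x y) (mkposreal (e / 2) ltac:(lra)))
    as [d Hd]. simpl in Hd.
  exists d. split; [apply cond_pos|]. intros z [_ Hz]. simpl in *. unfold Rdist in *.
  rewrite <- int_minus by (apply cts_2d_fst; assumption).
  apply Rle_lt_trans with (RInt (fun _ => e / 2) 0 1); [|rewrite int_const; lra].
  apply int_abs_le; [lra | | apply cts_const |].
  - apply cts_minus; apply cts_2d_fst; assumption.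
  - intros x Hx. left. apply Rabs_def2 in Hz. pose proof (cond_pos d).
    apply Hd; try lra. rewrite Rminus_diag, Rabs_R0. apply cond_pos.
Qed.

(** The shift [k > 0] removes the singularity of [s ^ g] at the minimum of the
    potential. No bound on discrepancies below depends on it. *)
Definition torus_profile (g h k y1 y2 : R) : R := profile g h (k + gap y2 + gap y1).

Section Flow.
Variables (g h k : R).
Hypothesis Hg : 0 < g.
Hypothesis Hh : 0 <= h.
Hypothesis Hk : 0 < k <= 1.

Let F := torus_profile g h k.

Lemma torus_profile_cts x y : continuity_2d_pt F x y.
Proof.
  unfold F, torus_profile.
  apply (continuity_1d_2d_pt_comp (profile g h) (fun y1 y2 => k + gap y2 + gap y1)).
  - apply continuity_pt_filterlim, (ex_derive_continuous (profile g h)).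
    eexists. apply is_derive_profile; auto.
    pose proof (gap_bound x). pose proof (gap_bound y). lra.
  - assert (Hg1 : forall z, continuity_pt gap z)
      by (intros z; apply continuity_pt_filterlim, gap_cts).
    apply continuity_2d_pt_plus; [apply continuity_2d_pt_plus|].
    + apply continuity_2d_pt_const.
    + apply (continuity_1d_2d_pt_comp gap (fun _ v => v)); [apply Hg1 | apply continuity_2d_pt_id2].
    + apply (continuity_1d_2d_pt_comp gap (fun u _ => u)); [apply Hg1 | apply continuity_2d_pt_id1].
Qed.

Let slice_mean (t : R) : R := RInt (fun x => F x t) 0 1.

Definition torus_mean : R := RInt slice_mean 0 1.

Let slice_mean_cts : cts slice_mean.
Proof. apply int_param_cts, torus_profile_cts. Qed.

Lemma torus_profile_range x y :
  sqrt (2 * h) <= F x y <= sqrt (2 * h) + sqrt (2 * Rpower 5 g).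
Proof.
  unfold F, torus_profile, profile.
  pose proof (gap_bound x). pose proof (gap_bound y).
  set (s := k + gap y + gap x).
  pose proof (Rpower_pos s g) as Hs.
  assert (Hs5 : Rpower s g <= Rpower 5 g) by (apply Rle_Rpower_l; unfold s; lra).
  split.
  - apply sqrt_le_1; lra.
  - apply Rle_trans with (sqrt (2 * h + 2 * Rpower 5 g)); [apply sqrt_le_1; lra|].
    pose proof (sqrt_pos (2 * h)). pose proof (sqrt_pos (2 * Rpower 5 g)).
    apply Rsqr_incr_0; [|apply sqrt_pos|lra].
    unfold Rsqr. rewrite sqrt_sqrt by lra.
    pose proof (sqrt_sqrt (2 * h) ltac:(lra)). pose proof (sqrt_sqrt (2 * Rpower 5 g) ltac:(lra)). nra.
Qed.

Lemma torus_mean_range : sqrt (2 * h) <= torus_mean <= sqrt (2 * h) + sqrt (2 * Rpower 5 g).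
Proof.
  assert (Hc : forall lo hi f, cts f -> (forall x, lo <= f x <= hi) -> lo <= RInt f 0 1 <= hi).
  { intros lo hi f Hf Hb. split.
    - replace lo with (RInt (fun _ => lo) 0 1) by (rewrite int_const; toR; ring).
      apply int_le; auto using cts_const; [lra | intros; apply Hb].
    - replace hi with (RInt (fun _ => hi) 0 1) by (rewrite int_const; toR; ring).
      apply int_le; auto using cts_const; [lra | intros; apply Hb]. }
  apply Hc; [apply slice_mean_cts|]. intros t. apply Hc.
  - apply cts_2d_fst, torus_profile_cts.
  - intros x. apply torus_profile_range.
Qed.

Lemma torus_profile_periodic2 x y : F x (y + 1) = F x y.
Proof. unfold F, torus_profile. rewrite gap_periodic. reflexivity. Qed.

Lemma torus_profile_periodic2_nat x y (n : nat) : F x (y + INR n) = F x y.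
Proof.
  induction n; [simpl; f_equal; ring|].
  rewrite S_INR, <- Rplus_assoc, torus_profile_periodic2. assumption.
Qed.

Definition flow_constant (c : R) : R :=
  48 / c * (line_constant g * (2 / (1 - exponent g)) * (2 / (1 - exponent g))).

Lemma int_split_unit (f : R -> R) n : cts f ->
  RInt f 0 (INR n) = psum (fun j => RInt (fun t => f (t + INR j)) 0 1) n.
Proof.
  intros Hf. induction n.
  - simpl. exact (RInt_point 0 f).
  - rewrite psum_S, <- IHn, int_shift by assumption.
    rewrite Rplus_0_l, (Rplus_comm 1), <- S_INR. symmetry. apply int_Chasles. assumption.
Qed.

(** On each circle [y2 = t] the flow induces the rotation by [alpha], to which
    [birkhoff_sum_bound] applies; the total curvature of the slice is integrable
    in [t]. *)
Lemma flow_unit_bound c alpha th t0 n : 0 < c -> badly_approximable c alpha ->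
  Rabs (RInt (fun z => F (th + alpha * z) (t0 + z)) 0 (INR n) - INR n * torus_mean)
    <= flow_constant c.
Proof.
  intros Hc Hb.
  destruct (exponent_bound g Hg) as [He1 He2].
  pose proof (line_constant_pos g Hg) as Hl.
  assert (Haff : forall a b, cts (fun x => a + b * x)).
  { intros a b x. apply (continuous_ext (fun x => b * x + a)); [intros; toR; ring | apply cts_affine]. }
  assert (Haff1 : forall a, cts (fun x => a + x)).
  { intros a x. apply (continuous_ext (fun x => a + 1 * x)); [intros; toR; ring | apply Haff]. }
  assert (HF : forall th t0, cts (fun z => F (th + alpha * z) (t0 + z))).
  { intros. apply cts_2d_comp; auto. apply torus_profile_cts. }
  rewrite int_split_unit by auto.
  rewrite (psum_ext _ (fun j => RInt (fun t => F (th + alpha * t + INR j * alpha) (t0 + t)) 0 1)).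
  2:{ intros j _. apply int_ext. intros t.
      rewrite <- Rplus_assoc, torus_profile_periodic2_nat. f_equal. ring. }
  assert (HFj : forall j, cts (fun t => F (th + alpha * t + INR j * alpha) (t0 + t))).
  { intros j t. apply (continuous_ext (fun t => F ((th + INR j * alpha) + alpha * t) (t0 + t))).
    - intros x. f_equal. ring.
    - apply HF. }
  rewrite <- (int_psum (fun j t => F (th + alpha * t + INR j * alpha) (t0 + t))) by assumption.
  assert (Hm : torus_mean = RInt (fun t => slice_mean (t + t0)) 0 1).
  { rewrite int_shift by apply slice_mean_cts. rewrite Rplus_0_l, Rplus_comm.
    symmetry. apply int_periodic; [apply slice_mean_cts|].
    intros t. apply int_ext. intros x. apply torus_profile_periodic2. }
  rewrite Hm, <- int_scal by (apply cts_shift, slice_mean_cts).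
  assert (Hmc : cts (fun t => INR n * slice_mean (t + t0))).
  { apply (cts_mult (fun _ => _)); [apply cts_const | apply cts_shift, slice_mean_cts]. }
  rewrite <- int_minus; [|apply (psum_cts (fun j t => F (th + alpha * t + INR j * alpha) (t0 + t))); assumption | assumption].
  set (K := 48 / c * (line_constant g * (2 / (1 - exponent g)))).
  apply Rle_trans with (RInt (fun t => K * weight k (exponent g) (t + t0)) 0 1).
  - apply int_abs_le; [lra | | |].
    + apply cts_minus; [|assumption].
      apply (psum_cts (fun j t => F (th + alpha * t + INR j * alpha) (t0 + t))); assumption.
    + apply (cts_mult (fun _ => _)); [apply cts_const | apply cts_shift, weight_cts; lra].
    + intros t _.
      assert (Hb0 : 0 < k + gap (t + t0)) by (pose proof (gap_bound (t + t0)); lra).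
      rewrite (Rplus_comm t0 t).
      pose proof (birkhoff_sum_bound c alpha (line g h (k + gap (t + t0))) _ _ Hc Hb
        (line_periodic g h _) (line1_periodic g h _) (is_derive_line g h _ Hh Hb0)
        (is_derive_line1 g h _ Hh Hb0) (line2_cts g h _ Hh Hb0) n (th + alpha * t)) as B.
      eapply Rle_trans; [exact B|].
      unfold K. rewrite Rmult_assoc. apply Rmult_le_compat_l.
      * apply Rlt_le, Rdiv_lt_0_compat; lra.
      * apply line2_int; assumption.
  - rewrite int_scal by (apply cts_shift, weight_cts; lra).
    rewrite int_shift by (apply weight_cts; lra).
    rewrite (Rplus_comm 0), Rplus_0_r, (Rplus_comm 1).
    rewrite int_periodic by (auto using weight_periodic; apply weight_cts; lra).
    unfold flow_constant. rewrite <- (Rmult_assoc _ (line_constant g * _)). fold K.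
    apply Rmult_le_compat_l; [|apply weight_int; lra].
    unfold K. apply Rmult_le_pos; [apply Rlt_le, Rdiv_lt_0_compat; lra|].
    apply Rmult_le_pos; [lra|]. apply Rlt_le, Rdiv_lt_0_compat; lra.
Qed.

(** The incomplete last turn costs the oscillation of the profile, which is
    bounded independently of [h] although the profile is not. *)
Lemma flow_bound c alpha th t0 Z : 0 < c -> badly_approximable c alpha -> 0 <= Z ->
  Rabs (RInt (fun z => F (th + alpha * z) (t0 + z)) 0 Z - Z * torus_mean)
    <= flow_constant c + sqrt (2 * Rpower 5 g).
Proof.
  intros Hc Hb HZ.
  assert (HF : cts (fun z => F (th + alpha * z) (t0 + z))).
  { apply cts_2d_comp; [apply torus_profile_cts | |]; intros x.
    - apply (continuous_ext (fun x => alpha * x + th)); [intros; toR; ring | apply cts_affine].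
    - apply (continuous_ext (fun x => 1 * x + t0)); [intros; toR; ring | apply cts_affine]. }
  destruct (nfloor_ex Z HZ) as [n Hn].
  rewrite <- (int_Chasles _ 0 (INR n) Z) by assumption.
  match goal with |- Rabs ?e <= _ => replace e with
    ((RInt (fun z => F (th + alpha * z) (t0 + z)) 0 (INR n) - INR n * torus_mean) +
     (RInt (fun z => F (th + alpha * z) (t0 + z)) (INR n) Z - RInt (fun _ => torus_mean) (INR n) Z))
    by (rewrite int_const; toR; ring) end.
  eapply Rle_trans; [apply Rabs_triang|].
  apply Rplus_le_compat; [apply flow_unit_bound; assumption|].
  rewrite <- int_minus by (auto using cts_const).
  apply Rle_trans with (RInt (fun _ => sqrt (2 * Rpower 5 g)) (INR n) Z).
  - apply int_abs_le; [lra | apply cts_minus; auto using cts_const | apply cts_const |].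
    intros z _. pose proof (torus_profile_range (th + alpha * z) (t0 + z)).
    pose proof torus_mean_range. apply Rabs_le. lra.
  - rewrite int_const. pose proof (sqrt_pos (2 * Rpower 5 g)).
    rewrite <- (Rmult_1_l (sqrt _)) at 2. apply Rmult_le_compat_r; lra.
Qed.

End Flow.

(** * Orbits of a Diophantine direction *)

Lemma diophantine_abs C omega (a b : Z) : 0 < C -> diophantine 1 C omega ->
  (a, b) <> (0, 0)%Z ->
  C <= (Rabs (IZR a) + Rabs (IZR b)) * Rabs (IZR a * fst omega + IZR b * snd omega).
Proof.
  intros HC H Hab. specialize (H (a, b) Hab). simpl in H.
  unfold euclidean_norm in H. simpl in H.
  set (n := sqrt _) in H.
  pose proof (Rabs_pos (IZR a)) as Pa. pose proof (Rabs_pos (IZR b)) as Pb.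
  assert (Hq : 0 < IZR a * (IZR a * 1) + IZR b * (IZR b * 1)).
  { assert (0 <= IZR a * IZR a) by nra. assert (0 <= IZR b * IZR b) by nra.
    destruct (Z.eq_dec a 0) as [->|Ha].
    - assert (Hb : b <> 0%Z) by (intros ->; apply Hab; reflexivity).
      apply not_0_IZR in Hb. assert (0 < IZR b * IZR b) by nra. lra.
    - apply not_0_IZR in Ha. assert (0 < IZR a * IZR a) by nra. lra. }
  assert (Hn : 0 < n) by (apply sqrt_lt_R0; assumption).
  assert (Hn1 : n <= Rabs (IZR a) + Rabs (IZR b)).
  { apply Rsqr_incr_0; [|lra|lra]. unfold Rsqr, n. rewrite sqrt_sqrt by lra.
    pose proof (pow2_abs (IZR a)). pose proof (pow2_abs (IZR b)). nra. }
  rewrite Rpower_Ropp, Rpower_1 in H by assumption.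
  set (w := Rabs (_ + _)) in *.
  assert (C = n * (C * / n)) by (field; lra).
  assert (0 < C * / n) by (apply Rmult_lt_0_compat; [lra | apply Rinv_0_lt_compat; lra]).
  rewrite H0. apply Rmult_le_compat; lra.
Qed.

Lemma diophantine_opp C omega : diophantine 1 C omega ->
  diophantine 1 C (- fst omega, - snd omega).
Proof.
  intros H k Hk. simpl. specialize (H k Hk).
  replace (IZR (fst k) * - fst omega + IZR (snd k) * - snd omega)
    with (- (IZR (fst k) * fst omega + IZR (snd k) * snd omega)) by ring.
  rewrite Rabs_Ropp. exact H.
Qed.

Lemma diophantine_snd C omega : 0 < C -> diophantine 1 C omega -> 0 < Rabs (snd omega).
Proof.
  intros HC H. pose proof (diophantine_abs C omega 0 1 HC H ltac:(discriminate)) as D.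
  rewrite Rmult_0_l, Rmult_1_l, Rplus_0_l, Rabs_R0, Rabs_R1 in D. lra.
Qed.

(** The Diophantine exponent 1 is the one of badly approximable numbers. *)
Lemma diophantine_slope C omega : 0 < C -> diophantine 1 C omega ->
  exists c, 0 < c /\ badly_approximable c (fst omega / Rabs (snd omega)).
Proof.
  intros HC H. pose proof (diophantine_snd C omega HC H) as Hw.
  set (w := Rabs (snd omega)) in *. set (al := fst omega / w).
  set (c := C / (w * (Rabs al + 2))).
  assert (Pal := Rabs_pos al).
  assert (Hc : 0 < c) by (apply Rdiv_lt_0_compat; nra).
  exists (Rmin 1 c). split; [apply Rmin_pos; lra|].
  intros k n Hk.
  assert (Hk1 : 1 <= INR k) by (apply (le_INR 1); lia).
  assert (Hm1 : Rmin 1 c <= 1) by apply Rmin_l.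
  assert (Hm2 : Rmin 1 c <= c) by apply Rmin_r.
  assert (Hm0 : 0 < Rmin 1 c) by (apply Rmin_pos; lra).
  destruct (Rle_dec 1 (Rabs (INR k * al - IZR n))) as [Hbig|Hsmall].
  - apply Rle_trans with 1; [|assumption].
    apply (Rmult_le_reg_r (INR k)); [lra|]. unfold Rdiv.
    rewrite Rmult_assoc, Rinv_l by lra. lra.
  - assert (Hn : Rabs (IZR n) <= INR k * Rabs al + 1).
    { replace (IZR n) with (INR k * al - (INR k * al - IZR n)) by ring.
      eapply Rle_trans; [apply Rabs_triang|]. rewrite Rabs_Ropp, Rabs_mult, (Rabs_pos_eq (INR k)) by lra.
      lra. }
    assert (Hex : exists m : Z, Rabs (IZR m) = Rabs (IZR n) /\
      IZR m * snd omega = - IZR n * w).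
    { unfold w, Rabs at 3. destruct (Rcase_abs (snd omega)).
      - exists n. split; [reflexivity | ring].
      - exists (- n)%Z. rewrite opp_IZR, Rabs_Ropp. split; [reflexivity | ring]. }
    destruct Hex as [m [Hm3 Hm4]].
    pose proof (diophantine_abs C omega (Z.of_nat k) m HC H) as D.
    rewrite <- INR_IZR_INZ, Hm3, Hm4 in D.
    assert (Hne : (Z.of_nat k, m) <> (0, 0)%Z) by (intros E; injection E; lia).
    specialize (D Hne).
    replace (INR k * fst omega + - IZR n * w) with (w * (INR k * al - IZR n)) in D
      by (unfold al; field; lra).
    rewrite Rabs_mult, (Rabs_pos_eq w), (Rabs_pos_eq (INR k)) in D by lra.
    set (d := Rabs (INR k * al - IZR n)) in *.
    assert (Hd : 0 <= d) by apply Rabs_pos.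
    assert (D2 : C <= INR k * (Rabs al + 2) * (w * d)).
    { eapply Rle_trans; [exact D|]. apply Rmult_le_compat_r; nra. }
    apply Rle_trans with (c / INR k).
    { apply Rmult_le_compat_r; [apply Rlt_le, Rinv_0_lt_compat; lra | assumption]. }
    unfold c. apply (Rmult_le_reg_r (INR k * (w * (Rabs al + 2)))); [nra|].
    replace (C / (w * (Rabs al + 2)) / INR k * (INR k * (w * (Rabs al + 2)))) with C by (field; lra).
    nra.
Qed.

(** When [omega_2 < 0] the second coordinate runs backwards. For [gap] a
    reflection is a shift by a half, so the orbit has again the form treated by
    [flow_bound]. *)
Lemma orbit_reparametrize g h k omega x : 0 < Rabs (snd omega) ->
  let w := Rabs (snd omega) in
  torus_profile g h k (fst omega * x) (snd omega * x) =
  torus_profile g h k (0 + fst omega / w * (w * x))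
     ((if Rcase_abs (snd omega) then 1 / 2 else 0) + w * x).
Proof.
  intros Hw w. unfold torus_profile.
  replace (0 + fst omega / w * (w * x)) with (fst omega * x) by (field; unfold w; lra).
  replace (gap (snd omega * x)) with
    (gap ((if Rcase_abs (snd omega) then 1 / 2 else 0) + w * x)); [reflexivity|].
  unfold w, Rabs. destruct (Rcase_abs (snd omega)).
  - rewrite Rplus_comm, <- gap_half. f_equal. ring.
  - f_equal. ring.
Qed.

Lemma orbit_bound g C omega : 0 < g -> 0 < C -> diophantine 1 C omega ->
  exists K, 0 <= K /\ forall h k T, 0 <= h -> 0 < k <= 1 -> 0 <= T ->
    Rabs (RInt (fun x => torus_profile g h k (fst omega * x) (snd omega * x)) 0 T
          - T * torus_mean g h k) <= K.
Proof.
  intros Hg HC H.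
  pose proof (diophantine_snd C omega HC H) as Hw.
  destruct (diophantine_slope C omega HC H) as [c [Hc Hb]].
  set (w := Rabs (snd omega)) in *.
  set (B := flow_constant g c + sqrt (2 * Rpower 5 g)).
  exists (Rabs B / w). split.
  { apply Rmult_le_pos; [apply Rabs_pos | apply Rlt_le, Rinv_0_lt_compat; lra]. }
  intros h k T Hh Hk HT.
  set (t0 := if Rcase_abs (snd omega) then 1 / 2 else 0).
  pose proof (flow_bound g h k Hg Hh Hk c (fst omega / w) 0 t0 (w * T) Hc Hb ltac:(nra)) as Fb.
  fold B in Fb.
  rewrite (int_ext _ (fun x => torus_profile g h k (0 + fst omega / w * (w * x)) (t0 + w * x)))
    by (intros x; apply orbit_reparametrize; assumption).
  assert (HF : cts (fun z => torus_profile g h k (0 + fst omega / w * z) (t0 + z))).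
  { apply (cts_2d_comp (torus_profile g h k)); [intros; apply torus_profile_cts; assumption | |]; intros x.
    - apply (continuous_ext (fun x => fst omega / w * x + 0)); [intros; toR; ring | apply cts_affine].
    - apply (continuous_ext (fun x => 1 * x + t0)); [intros; toR; ring | apply cts_affine]. }
  set (f := fun z : R => torus_profile g h k (0 + fst omega / w * z) (t0 + z)) in *.
  pose proof (int_dilate f w 0 T HF) as D. rewrite Rmult_0_r in D.
  rewrite <- D in Fb.
  change (Rabs (RInt (fun x => f (w * x)) 0 T - T * torus_mean g h k) <= Rabs B / w).
  set (I := RInt _ 0 T) in *.
  replace (w * I - w * T * torus_mean g h k) with (w * (I - T * torus_mean g h k)) in Fb by ring.
  rewrite Rabs_mult, (Rabs_pos_eq w) in Fb by lra.
  apply (Rmult_le_reg_l w); [lra|].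
  replace (w * (Rabs B / w)) with (Rabs B) by (field; lra).
  eapply Rle_trans; [exact Fb | apply Rle_abs].
Qed.

(** * Removing the regularisation *)

Lemma nonneg_power_cts g : 0 < g -> cts (fun x => nonneg_power x g).
Proof.
  intros Hg x.
  destruct (Rtotal_order x 0) as [Hx|[->|Hx]].
  - apply (continuous_ext_loc _ (fun _ => 0)); [|apply continuous_const].
    exists (mkposreal (- x) ltac:(lra)). intros y Hy.
    apply Rabs_def2 in Hy. unfold minus, plus, opp in Hy; simpl in Hy.
    unfold nonneg_power. destruct (Rlt_dec 0 y); [lra | reflexivity].
  - apply continuity_pt_filterlim. intros e He.
    exists (Rpower e (/ g)). split; [apply Rpower_pos|]. intros y [_ Hy].
    simpl in *. unfold Rdist in *. unfold nonneg_power at 2.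
    destruct (Rlt_dec 0 0); [lra|]. rewrite Rminus_0_r in *.
    unfold nonneg_power. destruct (Rlt_dec 0 y); [|rewrite Rabs_R0; assumption].
    rewrite Rabs_pos_eq by (apply Rlt_le, Rpower_pos). rewrite Rabs_pos_eq in Hy by lra.
    replace e with (Rpower (Rpower e (/ g)) g).
    + apply Rlt_Rpower_l; [assumption | split; lra].
    + rewrite Rpower_mult, Rinv_l, Rpower_1 by lra. reflexivity.
  - apply (continuous_ext_loc _ (fun x => Rpower x g)).
    + exists (mkposreal x Hx). intros y Hy.
      apply Rabs_def2 in Hy. unfold minus, plus, opp in Hy; simpl in Hy.
      unfold nonneg_power. destruct (Rlt_dec 0 y); [reflexivity | lra].
    + apply (ex_derive_continuous (fun x => Rpower x g)). eexists. apply is_derive_Rpower; assumption.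
Qed.

Lemma nonneg_power_nonneg s g : 0 <= nonneg_power s g.
Proof.
  unfold nonneg_power. destruct (Rlt_dec 0 s); [apply Rlt_le, Rpower_pos | lra].
Qed.

Lemma nonneg_power_shift g eta : 0 < g -> 0 < eta ->
  exists k, 0 < k <= 1 /\ forall s, 0 <= s <= 4 ->
    nonneg_power s g <= Rpower (s + k) g <= nonneg_power s g + eta.
Proof.
  intros Hg He.
  destruct (Heine (fun x => nonneg_power x g) (fun c => 0 <= c <= 5) (compact_P3 0 5)
    (fun x _ => proj2 (continuity_pt_filterlim _ _) (nonneg_power_cts g Hg x))
    (mkposreal eta He)) as [d Hd].
  pose proof (cond_pos d) as Hd0.
  assert (Hk : 0 < Rmin 1 (d / 2)) by (apply Rmin_pos; lra).
  pose proof (Rmin_l 1 (d / 2)). pose proof (Rmin_r 1 (d / 2)).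
  exists (Rmin 1 (d / 2)). split; [lra|]. intros s Hs.
  set (k := Rmin 1 (d / 2)) in *.
  replace (Rpower (s + k) g) with (nonneg_power (s + k) g).
  2:{ unfold nonneg_power. destruct (Rlt_dec 0 (s + k)); [reflexivity | lra]. }
  split.
  - unfold nonneg_power. destruct (Rlt_dec 0 (s + k)); [|lra].
    destruct (Rlt_dec 0 s); [apply Rle_Rpower_l; lra | apply Rlt_le, Rpower_pos].
  - assert (Rabs (nonneg_power (s + k) g - nonneg_power s g) < eta).
    { apply (Hd (s + k) s); try lra. replace (s + k - s) with k by ring. rewrite Rabs_pos_eq; lra. }
    apply Rabs_def2 in H1. lra.
Qed.

Lemma potential_gap g omega x :
  potential g omega x = nonneg_power (gap (snd omega * x) + gap (fst omega * x)) g.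
Proof. unfold potential, f_torus, gap. simpl. f_equal. ring. Qed.

Lemma scale_cts a : cts (fun x => a * x).
Proof.
  intros x. apply (cts_mult (fun _ => a) (fun x => x)); intros; [apply cts_const | apply continuous_id].
Qed.

Lemma potential_cts g omega : 0 < g -> cts (potential g omega).
Proof.
  intros Hg x.
  apply (continuous_ext (fun x => nonneg_power (gap (snd omega * x) + gap (fst omega * x)) g)).
  { intros y. symmetry. apply potential_gap. }
  apply (cts_comp (fun s => nonneg_power s g)); [apply nonneg_power_cts; assumption|].
  apply cts_plus; apply (cts_comp gap); auto using gap_cts, scale_cts.
Qed.

Lemma potential_range g omega x : 0 < g -> 0 <= potential g omega x <= Rpower 5 g.
Proof.
  intros Hg. rewrite potential_gap. split; [apply nonneg_power_nonneg|].
  pose proof (gap_bound (snd omega * x)). pose proof (gap_bound (fst omega * x)).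
  unfold nonneg_power. destruct (Rlt_dec _ _).
  - apply Rle_Rpower_l; lra.
  - apply Rlt_le, Rpower_pos.
Qed.

(** The slope of a solution of the stationary equation at level [h]. *)
Definition momentum (V : R -> R) (h x : R) : R := sqrt (2 * (V x + h)).

Lemma cts_sqrt (f : R -> R) : cts f -> cts (fun x => sqrt (f x)).
Proof. intros Hf x. apply (continuous_comp f sqrt); [apply Hf | apply continuous_sqrt]. Qed.

Lemma momentum_cts V h : cts V -> cts (momentum V h).
Proof.
  intros HV. apply (cts_sqrt (fun x => 2 * (V x + h))).
  apply (cts_mult (fun _ => 2)); [apply cts_const|]. apply cts_plus; auto using cts_const.
Qed.

Lemma sqrt_plus_le a b : 0 <= a -> 0 <= b -> sqrt (a + b) <= sqrt a + sqrt b.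
Proof.
  intros Ha Hb. pose proof (sqrt_pos a). pose proof (sqrt_pos b).
  apply Rsqr_incr_0; [|apply sqrt_pos|lra].
  unfold Rsqr. rewrite sqrt_sqrt by lra.
  pose proof (sqrt_sqrt a Ha). pose proof (sqrt_sqrt b Hb). nra.
Qed.

(** Before the regularisation is removed, both averages are close to the same
    torus mean, because that mean is the same for [omega] and [- omega]. Comparing
    them with each other makes the limit [k -> 0] harmless: the lengths are fixed
    and the mean has disappeared. *)
Lemma orbit_average_compare g C omega : 0 < g -> 0 < C -> diophantine 1 C omega ->
  exists K, 0 <= K /\ forall h S T e e', 0 <= h -> 0 <= S -> 0 <= T ->
    (e = 1 \/ e = -1) -> (e' = 1 \/ e' = -1) ->
    T * RInt (fun x => momentum (potential g omega) h (e * x)) 0 S <=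
    S * RInt (fun x => momentum (potential g omega) h (e' * x)) 0 T + K * (S + T).
Proof.
  intros Hg HC H.
  destruct (orbit_bound g C omega Hg HC H) as [K1 [HK1 B1]].
  destruct (orbit_bound g C _ Hg HC (diophantine_opp C omega H)) as [K2 [HK2 B2]].
  exists (K1 + K2). split; [lra|].
  intros h S T e e' Hh HS HT He He'.
  assert (B : forall e k T, (e = 1 \/ e = -1) -> 0 < k <= 1 -> 0 <= T ->
    Rabs (RInt (fun x => torus_profile g h k (fst omega * (e * x)) (snd omega * (e * x))) 0 T
          - T * torus_mean g h k) <= K1 + K2).
  { clear - B1 B2 HK1 HK2 Hh. intros e k T [->| ->] Hk HT.
    - rewrite (int_ext _ (fun x => torus_profile g h k (fst omega * x) (snd omega * x)))
        by (intros; f_equal; ring).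
      specialize (B1 h k T Hh Hk HT). lra.
    - rewrite (int_ext _ (fun x => torus_profile g h k (- fst omega * x) (- snd omega * x)))
        by (intros; f_equal; ring).
      specialize (B2 h k T Hh Hk HT). simpl in B2. lra. }
  assert (Hmc : forall e, cts (fun x => momentum (potential g omega) h (e * x))).
  { intros e0. apply (cts_comp (momentum (potential g omega) h)); [|apply scale_cts].
    apply momentum_cts, potential_cts; assumption. }
  apply le_epsilon. intros d Hd.
  (* an error [r] in the integrand contributes [S T r <= d] *)
  set (r := d / (S * T + 1)).
  assert (HST : 0 <= S * T) by nra.
  assert (Hr : 0 < r) by (apply Rdiv_lt_0_compat; lra).
  destruct (nonneg_power_shift g (r * r / 2) Hg) as [k [Hk Hkp]]; [nra|].
  assert (Hcmp : forall x,
    momentum (potential g omega) h x <= torus_profile g h k (fst omega * x) (snd omega * x)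
    <= momentum (potential g omega) h x + r).
  { intros x. unfold momentum, torus_profile, profile. rewrite potential_gap.
    pose proof (gap_bound (snd omega * x)) as G2. pose proof (gap_bound (fst omega * x)) as G1.
    destruct (Hkp (gap (snd omega * x) + gap (fst omega * x)) ltac:(lra)) as [L U].
    replace (k + gap (snd omega * x) + gap (fst omega * x))
      with (gap (snd omega * x) + gap (fst omega * x) + k) by ring.
    pose proof (nonneg_power_nonneg (gap (snd omega * x) + gap (fst omega * x)) g).
    set (a := nonneg_power _ g) in *. set (b := Rpower _ g) in *.
    split; [apply sqrt_le_1; lra|].
    apply Rle_trans with (sqrt (2 * (a + h) + r * r)); [apply sqrt_le_1; nra|].
    eapply Rle_trans; [apply sqrt_plus_le; nra|]. rewrite sqrt_square by lra. lra. }
  assert (Htc : forall e, cts (fun x => torus_profile g h k (fst omega * (e * x)) (snd omega * (e * x)))).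
  { intros e0. apply (cts_2d_comp (torus_profile g h k)).
    - intros; apply torus_profile_cts; assumption.
    - apply (cts_comp (fun x => fst omega * x)); apply scale_cts.
    - apply (cts_comp (fun x => snd omega * x)); apply scale_cts. }
  pose proof (B e k S He Hk HS) as BS. pose proof (B e' k T He' Hk HT) as BT.
  assert (I1 : RInt (fun x => momentum (potential g omega) h (e * x)) 0 S <=
    RInt (fun x => torus_profile g h k (fst omega * (e * x)) (snd omega * (e * x))) 0 S).
  { apply int_le; auto. intros x _. apply Hcmp. }
  assert (I2 : RInt (fun x => torus_profile g h k (fst omega * (e' * x)) (snd omega * (e' * x))) 0 T
    <= RInt (fun x => momentum (potential g omega) h (e' * x)) 0 T + T * r).
  { replace (T * r) with (RInt (fun _ => r) 0 T) by (rewrite int_const; toR; ring).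
    rewrite <- int_plus by auto using cts_const.
    apply int_le; auto.
    - apply cts_plus; auto using cts_const.
    - intros x _. apply Hcmp. }
  set (IS := RInt (fun x => momentum _ h (e * x)) 0 S) in *.
  set (IT := RInt (fun x => momentum _ h (e' * x)) 0 T) in *.
  set (JS := RInt _ 0 S) in *. set (JT := RInt _ 0 T) in *.
  apply Rabs_le_between in BS. apply Rabs_le_between in BT.
  assert (S * T * r <= d).
  { unfold r. apply (Rmult_le_reg_r (S * T + 1)); [lra|].
    replace (S * T * (d / (S * T + 1)) * (S * T + 1)) with (S * T * d) by (field; lra). nra. }
  assert (T * IS <= T * (S * torus_mean g h k + (K1 + K2))) by (apply Rmult_le_compat_l; lra).
  assert (S * (T * torus_mean g h k - (K1 + K2)) <= S * (IT + T * r)) by (apply Rmult_le_compat_l; lra).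
  lra.
Qed.

(** * The potential has infimum zero along the orbit *)

Lemma badly_approximable_opp c alpha : badly_approximable c alpha -> badly_approximable c (- alpha).
Proof.
  intros H k n Hk. rewrite <- (Rabs_Ropp (_ - _)).
  replace (- (INR k * - alpha - IZR n)) with (INR k * alpha - IZR (- n)) by (rewrite opp_IZR; ring).
  apply H; assumption.
Qed.

(** Along the orbit the Fejer kernel has mean tending to 1, but it is small
    away from its centre: the orbit comes close to the centre. *)
Lemma rotation_dense c alpha th eta : 0 < c -> badly_approximable c alpha -> 0 < eta ->
  exists j : nat, gap (th + INR j * alpha) < eta.
Proof.
  intros Hc Hb He.
  destruct (nfloor_ex (4 / eta)) as [M [_ HM]].
  { apply Rlt_le, Rdiv_lt_0_compat; lra. }
  set (D := 2 * psum (fun k => small_divisor (- alpha) (S k)) M).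
  destruct (nfloor_ex (2 * Rabs D)) as [N [_ HN]].
  { pose proof (Rabs_pos D). lra. }
  rewrite <- S_INR in HM, HN.
  assert (HSM : 0 < INR (S M)) by (apply lt_0_INR; lia).
  destruct (Classical_Prop.classic (exists j : nat, gap (th + INR j * alpha) < eta)) as [|Hno]; [assumption|].
  exfalso.
  assert (Hbig : forall j, eta <= gap (th + INR j * alpha)).
  { intros j. apply Rnot_lt_le. intros Hj. apply Hno. exists j. exact Hj. }
  set (x := th - 1 / 4).
  assert (Hsmall : forall j, fejer M (x - INR j * - alpha) <= 1 / 2).
  { intros j. specialize (Hbig j).
    pose proof (fejer_identity M (x - INR j * - alpha)) as E.
    assert (G : gap (th + INR j * alpha) = 2 * sin (PI * (x - INR j * - alpha)) ^ 2).
    { unfold gap, x.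
      replace (2 * PI * (th + INR j * alpha))
        with (PI / 2 + 2 * (PI * (th - 1 / 4 - INR j * - alpha))) by field.
      rewrite <- cos_sin, cos_2a_sin. ring. }
    rewrite G in Hbig.
    set (s := sin _ ^ 2) in *. set (f := fejer _ _) in *.
    assert (Hs : sin (INR (S M) * (PI * (x - INR j * - alpha))) ^ 2 <= 1).
    { pose proof (SIN_bound (INR (S M) * (PI * (x - INR j * - alpha)))). nra. }
    assert (s * f <= / INR (S M)).
    { rewrite E. unfold Rdiv. rewrite <- (Rmult_1_l (/ INR (S M))) at 2.
      apply Rmult_le_compat_r; [apply Rlt_le, Rinv_0_lt_compat; lra | assumption]. }
    assert (/ INR (S M) <= eta / 4).
    { replace (eta / 4) with (/ (4 / eta)) by (field; lra).
      apply Rinv_le_contravar; [apply Rdiv_lt_0_compat; lra | lra]. }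
    destruct (Rle_dec f (1 / 2)); [assumption|]. nra. }
  assert (Hsum : psum (fun j => fejer M (x - INR j * - alpha)) (S N) =
    INR (S N) + 2 * psum (fun k => (1 - INR (S k) / INR (S M)) *
       psum (fun j => mode k (x - INR j * - alpha)) (S N)) M).
  { unfold fejer. rewrite psum_plus, psum_const, psum_scal, psum_swap, Rmult_1_r.
    do 2 f_equal. apply psum_ext. intros k _. apply psum_scal. }
  assert (Hlow : Rabs (2 * psum (fun k => (1 - INR (S k) / INR (S M)) *
       psum (fun j => mode k (x - INR j * - alpha)) (S N)) M) <= D).
  { rewrite Rabs_mult, (Rabs_pos_eq 2) by lra. unfold D. apply Rmult_le_compat_l; [lra|].
    eapply Rle_trans; [apply psum_abs|]. apply psum_le. intros k Hk.
    rewrite Rabs_mult.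
    assert (0 < INR (S k)) by (apply lt_0_INR; lia).
    assert (0 < INR (S k) / INR (S M)) by (apply Rdiv_lt_0_compat; lra).
    assert (INR (S k) / INR (S M) <= 1).
    { apply (Rmult_le_reg_r (INR (S M))); [assumption|]. unfold Rdiv.
      rewrite Rmult_assoc, Rinv_l, Rmult_1_r, Rmult_1_l by lra. apply le_INR; lia. }
    rewrite (Rabs_pos_eq (1 - _)) by lra.
    rewrite <- (Rmult_1_l (small_divisor _ _)).
    apply Rmult_le_compat; try lra; [apply Rabs_pos|].
    apply (mode_orbit_sum c); [assumption | apply badly_approximable_opp; assumption]. }
  assert (Hup : psum (fun j => fejer M (x - INR j * - alpha)) (S N) <= INR (S N) * (1 / 2)).
  { rewrite <- psum_const. apply psum_le. auto. }
  rewrite Hsum in Hup. apply Rabs_le_between in Hlow.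
  pose proof (Rle_abs D). lra.
Qed.

Lemma gap_int_shift y (j : nat) : gap (y + INR j) = gap y.
Proof.
  induction j; [simpl; f_equal; ring|].
  rewrite S_INR, <- Rplus_assoc, gap_periodic. assumption.
Qed.

Lemma potential_inf g C omega eta : 0 < g -> 0 < C -> diophantine 1 C omega -> 0 < eta ->
  exists x, potential g omega x < eta.
Proof.
  intros Hg HC H He.
  pose proof (diophantine_snd C omega HC H) as Hw.
  destruct (diophantine_slope C omega HC H) as [c [Hc Hb]].
  pose proof (nonneg_power_cts g Hg 0) as H0. apply continuity_pt_filterlim in H0.
  destruct (H0 eta He) as [d [Hd Hcl]]. simpl in Hcl. unfold Rdist in Hcl.
  set (w := Rabs (snd omega)) in *.
  assert (Ht : exists t0, forall j : nat, gap (snd omega * ((t0 + INR j) / w)) = 0).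
  { unfold w, Rabs. destruct (Rcase_abs (snd omega)).
    - exists (1 / 4 + 1 / 2). intros j.
      replace (snd omega * ((1 / 4 + 1 / 2 + INR j) / - snd omega))
        with (- (1 / 4 + 1 / 2 + INR j)) by (field; lra).
      rewrite gap_half.
      replace (1 / 4 + 1 / 2 + INR j + 1 / 2) with (1 / 4 + INR j + 1) by field.
      rewrite gap_periodic, gap_int_shift. unfold gap.
      replace (2 * PI * (1 / 4)) with (PI / 2) by field. rewrite sin_PI2. ring.
    - exists (1 / 4). intros j.
      assert (Hw0 : snd omega <> 0).
      { intros E. unfold w in Hw. rewrite E, Rabs_R0 in Hw. lra. }
      replace (snd omega * ((1 / 4 + INR j) / snd omega)) with (1 / 4 + INR j) by (field; assumption).
      rewrite gap_int_shift. unfold gap.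
      replace (2 * PI * (1 / 4)) with (PI / 2) by field. rewrite sin_PI2. ring. }
  destruct Ht as [t0 Ht].
  destruct (rotation_dense c (fst omega / w) (fst omega / w * t0) d Hc Hb Hd) as [j Hj].
  exists ((t0 + INR j) / w). rewrite potential_gap, Ht, Rplus_0_l.
  replace (fst omega * ((t0 + INR j) / w)) with (fst omega / w * t0 + INR j * (fst omega / w))
    by (field; lra).
  set (s := gap _) in *.
  pose proof (nonneg_power_nonneg s g) as Hn.
  destruct (Req_dec s 0) as [E|Hs0].
  { unfold nonneg_power. destruct (Rlt_dec 0 s); lra. }
  specialize (Hcl s).
  assert (Hs : 0 <= s) by (unfold s; apply gap_bound).
  rewrite Rminus_0_r, (Rabs_pos_eq s) in Hcl by assumption.
  assert (Hx : Rabs (nonneg_power s g - nonneg_power 0 g) < eta).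
  { apply Hcl. split; [|assumption]. split; [exact I | auto]. }
  unfold nonneg_power at 2 in Hx. destruct (Rlt_dec 0 0); [lra|].
  rewrite Rminus_0_r, Rabs_pos_eq in Hx by assumption. exact Hx.
Qed.

(** * Growth of correctors *)

Lemma exp_ge_linear x : 0 <= x -> 1 + x <= exp x.
Proof.
  intros Hx. destruct (Req_dec x 0) as [->|H]; [rewrite exp_0; lra|].
  left. apply exp_ineq1. lra.
Qed.

Lemma max_on_segment (f : R -> R) a b : a <= b -> cts f ->
  exists x, a <= x <= b /\ forall y, a <= y <= b -> f y <= f x.
Proof.
  intros Hab Hf. destruct (continuity_ab_maj f a b Hab) as [x [Hx1 Hx2]].
  - intros; apply continuity_pt_filterlim, Hf.
  - exists x. auto.
Qed.

Lemma locally_interval (P : R -> Prop) a b x : a < x < b ->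
  (forall y, a <= y <= b -> P y) -> locally x P.
Proof.
  intros Hx HP. assert (Hd : 0 < Rmin (x - a) (b - x)) by (apply Rmin_pos; lra).
  exists (mkposreal _ Hd). intros y Hy.
  apply Rabs_def2 in Hy. unfold minus, plus, opp in Hy; simpl in Hy.
  pose proof (Rmin_l (x - a) (b - x)). pose proof (Rmin_r (x - a) (b - x)).
  apply HP. lra.
Qed.

(** A parabola centred at [y] that rises over the distance [r] by more than [g]
    can do touches [g] strictly inside the interval. *)
Lemma touched_from_above (g : R -> R) y r : cts g -> 0 < r ->
  exists z phi, y - r < z < y + r /\ C1_line phi /\
    locally z (fun t => g t - phi t <= g z - phi z).
Proof.
  intros Hg Hr.
  destruct (max_on_segment g (y - r) (y + r) ltac:(lra) Hg) as [m' [_ Hm']].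
  set (K := (g m' - g y + 1) / r ^ 2).
  assert (HK : K * r ^ 2 = g m' - g y + 1) by (unfold K; field; lra).
  set (phi := fun z => K * (z - y) ^ 2).
  assert (Hd : forall z, is_derive phi z (K * (2 * (z - y)))).
  { intros z. unfold phi. auto_derive; [trivial | toR; ring]. }
  destruct (max_on_segment (fun z => g z - phi z) (y - r) (y + r)) as [z [Hz Hzm]]; [lra | |].
  { apply cts_minus; [assumption | apply (cts_of_derive phi _ Hd)]. }
  assert (Hzy := Hzm y ltac:(lra)). unfold phi in Hzy.
  replace (K * (y - y) ^ 2) with 0 in Hzy by ring.
  assert (Hgz := Hm' z Hz).
  assert (Hz1 : z <> y - r).
  { intros E. rewrite E in Hzy. replace (y - r - y) with (- r) in Hzy by ring.
    rewrite E in Hgz. nra. }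
  assert (Hz2 : z <> y + r).
  { intros E. rewrite E in Hzy. replace (y + r - y) with r in Hzy by ring.
    rewrite E in Hgz. nra. }
  exists z, phi. split; [lra|]. split.
  - intros t. split; [eexists; apply Hd|].
    apply (continuous_ext (fun t => K * (2 * (t - y)))).
    + intros t'. symmetry. apply is_derive_unique, Hd.
    + apply (ex_derive_continuous (fun t => K * (2 * (t - y)))). auto_derive. trivial.
  - apply (locally_interval _ (y - r) (y + r)); [lra | exact Hzm].
Qed.

(** If [g] gained more, its difference with a slightly steeper primitive of [F]
    would have an interior maximum, where the test function is too steep. The
    exponential term keeps that maximum away from the right end of the interval
    and only makes the test function steeper. *)
Lemma viscosity_growth (g F : R -> R) a b : a <= b -> cts g -> cts F ->
  (forall x, 0 <= F x) ->
  (forall phi x, C1_line phi -> locally x (fun y => g y - phi y <= g x - phi x) ->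
     Rabs (Derive phi x) <= F x) ->
  g b - g a <= RInt F a b.
Proof.
  intros Hab Hg HF Fpos Hv.
  destruct (Req_dec a b) as [<-|Hne].
  { replace (RInt F a a) with 0 by (symmetry; exact (RInt_point a F)). lra. }
  destruct (Rle_dec (g b - g a) (RInt F a b)) as [|Hno]; [assumption|]. exfalso.
  set (d := (g b - g a - RInt F a b) / 3).
  assert (Hd : 0 < d) by (unfold d; lra).
  destruct (max_on_segment g a (b + 1) ltac:(lra) Hg) as [m [_ Hm]].
  set (N := (Rabs (g m) + Rabs (g a)) / d).
  assert (HN : 0 <= N).
  { apply Rmult_le_pos; [|apply Rlt_le, Rinv_0_lt_compat; lra].
    pose proof (Rabs_pos (g m)). pose proof (Rabs_pos (g a)). lra. }
  set (phi := fun x => RInt F a x + (d / (b - a) * (x - a) + d * exp (N * (x - b)))).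
  set (dphi := fun x => F x + (d / (b - a) + d * (N * exp (N * (x - b))))).
  assert (Hphi : forall x, is_derive phi x (dphi x)).
  { intros x. apply (is_derive_plus (fun x => RInt F a x)).
    - apply int_derive_upper; assumption.
    - auto_derive; [trivial|]. unfold Rminus. toR. ring. }
  assert (Hdphi : cts dphi).
  { apply cts_plus; [assumption|]. intros x.
    apply (ex_derive_continuous (fun x => d / (b - a) + d * (N * exp (N * (x - b))))).
    auto_derive. trivial. }
  assert (HC1 : C1_line phi).
  { intros x. split; [exists (dphi x); apply Hphi|].
    apply (continuous_ext dphi); [|apply Hdphi].
    intros y. symmetry. apply is_derive_unique, Hphi. }
  assert (Hcphi : cts phi) by (apply (cts_of_derive phi dphi); assumption).
  destruct (max_on_segment (fun x => g x - phi x) a (b + 1) ltac:(lra)) as [x [Hx Hmax]].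
  { apply cts_minus; assumption. }
  assert (Hb : g a < g b - phi b).
  { unfold phi. rewrite Rminus_diag, Rmult_0_r, exp_0.
    replace (d / (b - a) * (b - a)) with d by (field; lra). unfold d; lra. }
  assert (Hxb := Hmax b ltac:(lra)).
  assert (Hxa : x <> a).
  { intros ->. unfold phi at 2 in Hxb.
    replace (RInt F a a) with 0 in Hxb by (symmetry; exact (RInt_point a F)).
    rewrite Rminus_diag, Rmult_0_r in Hxb.
    assert (0 < d * exp (N * (a - b))) by (apply Rmult_lt_0_compat; [lra | apply exp_pos]). lra. }
  assert (Ipos : forall t, a <= t -> 0 <= RInt F a t).
  { intros t Ht. apply RInt_ge_0; [assumption | apply cts_int; assumption | auto]. }
  assert (Hxb1 : x <> b + 1).
  { intros ->. unfold phi at 2 in Hxb.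
    replace (b + 1 - b) with 1 in Hxb by ring. rewrite Rmult_1_r in Hxb.
    pose proof (Ipos (b + 1) ltac:(lra)). pose proof (exp_ge_linear N HN).
    pose proof (Hm (b + 1) ltac:(lra)).
    assert (0 <= d / (b - a) * (b + 1 - a)).
    { apply Rmult_le_pos; [apply Rlt_le, Rdiv_lt_0_compat; lra | lra]. }
    assert (d * (1 + N) <= d * exp N) by (apply Rmult_le_compat_l; lra).
    assert (d * N = Rabs (g m) + Rabs (g a)) by (unfold N; field; lra).
    pose proof (Rle_abs (g m)). pose proof (Rle_abs (- g a)). rewrite Rabs_Ropp in *. lra. }
  assert (Hle : Rabs (Derive phi x) <= F x).
  { apply Hv; [assumption|]. apply (locally_interval _ a (b + 1)); [lra | exact Hmax]. }
  rewrite (is_derive_unique _ _ _ (Hphi x)) in Hle.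
  pose proof (Rle_abs (dphi x)). unfold dphi in *.
  assert (0 < d / (b - a)) by (apply Rdiv_lt_0_compat; lra).
  assert (0 <= d * (N * exp (N * (x - b)))).
  { apply Rmult_le_pos; [lra|]. apply Rmult_le_pos; [assumption | apply Rlt_le, exp_pos]. }
  lra.
Qed.

Lemma Derive_of_C1 phi x : C1_line phi -> is_derive phi x (Derive phi x).
Proof. intros H. apply Derive_correct, H. Qed.

Lemma C1_line_minus_linear phi p : C1_line phi ->
  C1_line (fun y => phi y - p * y) /\
  forall x, Derive (fun y => phi y - p * y) x = Derive phi x - p.
Proof.
  intros H.
  assert (D : forall x, is_derive (fun y => phi y - p * y) x (Derive phi x - p)).
  { intros x. apply (is_derive_minus phi (fun y => p * y)); [apply Derive_of_C1; assumption|].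
    auto_derive; [trivial | toR; ring]. }
  split; [|intros x; apply is_derive_unique, D].
  intros x. split; [eexists; apply D|].
  apply (continuous_ext (fun y => Derive phi y - p)).
  - intros y. symmetry. apply is_derive_unique, D.
  - apply (cts_minus (Derive phi)); [intros; apply H | apply cts_const].
Qed.

Lemma C1_line_reflect phi : C1_line phi ->
  C1_line (fun y => phi (- y)) /\
  forall x, Derive (fun y => phi (- y)) x = - Derive phi (- x).
Proof.
  intros H.
  assert (D : forall x, is_derive (fun y => phi (- y)) x (- Derive phi (- x))).
  { intros x.
    assert (Dn : is_derive (fun y : R => - y) x (-1)) by (auto_derive; [trivial | toR; ring]).
    evar_last.
    - apply (is_derive_comp phi (fun y => - y)); [apply Derive_of_C1; assumption | exact Dn].
    - unfold scal, opp, one; simpl. unfold mult; simpl. toR. ring. }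
  split; [|intros x; apply is_derive_unique, D].
  intros x. split; [eexists; apply D|].
  apply (continuous_ext (fun y => (-1) * Derive phi (-1 * y))).
  - intros y. replace (-1 * y) with (- y) by ring.
    transitivity (- Derive phi (- y)); [toR; ring | symmetry; apply is_derive_unique, D].
  - apply (cts_mult (fun _ => -1)); [apply cts_const|].
    apply (cts_comp (Derive phi)); [intros; apply H | apply scale_cts].
Qed.

Lemma BUC_cts w : BUC w -> cts w.
Proof.
  intros [_ H] x. apply continuity_pt_filterlim. intros e He.
  destruct (H (mkposreal e He)) as [d Hd].
  exists d. split; [apply cond_pos|]. intros y [_ Hy]. apply Hd; auto.
Qed.

Section Corrector.
Variables (V : R -> R) (p c d : R) (w : R -> R).
Hypothesis HVc : cts V.
Hypothesis HV : forall x, 0 <= V x.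
Hypothesis Hw : approximate_corrector V p c d w.

Let w_cts : cts w.
Proof. destruct Hw as [B _]. apply BUC_cts; assumption. Qed.

(** Wherever a test function touches, [- V] is at most the level; this happens
    arbitrarily close to points where [V] is almost zero. *)
Lemma corrector_level_nonneg : (forall eta, 0 < eta -> exists x, V x < eta) -> 0 <= c + d.
Proof.
  intros Hinf. apply le_epsilon. intros eta He.
  destruct (Hinf (eta / 2) ltac:(lra)) as [x Hx].
  pose proof (HVc x) as Hcx. apply continuity_pt_filterlim in Hcx.
  destruct (Hcx (eta / 2) ltac:(lra)) as [r [Hr Hcl]]. simpl in Hcl. unfold Rdist in Hcl.
  destruct (touched_from_above w x r w_cts Hr) as [z [phi [Hz [HC HL]]]].
  destruct Hw as [_ [Hsub _]]. specialize (Hsub phi z HC HL). simpl in Hsub.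
  assert (HVz : V z < eta).
  { destruct (Req_dec z x) as [->|Hne]; [lra|].
    assert (Hq : Rabs (V z - V x) < eta / 2).
    { apply Hcl. split; [split; [exact I | auto]|]. apply Rabs_def1; lra. }
    apply Rabs_def2 in Hq. lra. }
  pose proof (pow2_ge_0 (p + Derive phi z)). lra.
Qed.

Let slope_bound phi x : 0 <= c + d -> C1_line phi ->
  locally x (fun y => (p * y + w y) - phi y <= (p * x + w x) - phi x) ->
  Rabs (Derive phi x) <= momentum V (c + d) x.
Proof.
  intros Hcd HC HL.
  destruct (C1_line_minus_linear phi p HC) as [HC' HD].
  destruct Hw as [_ [Hsub _]].
  assert (HL' : locally x (fun y => w y - (phi y - p * y) <= w x - (phi x - p * x))).
  { revert HL. apply filter_imp. intros y Hy. lra. }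
  specialize (Hsub _ x HC' HL'). simpl in Hsub. rewrite HD in Hsub.
  replace (p + (Derive phi x - p)) with (Derive phi x) in Hsub by ring.
  unfold momentum. rewrite <- sqrt_Rsqr_abs. apply sqrt_le_1; [apply Rle_0_sqr | |].
  - pose proof (HV x). lra.
  - unfold Rsqr. lra.
Qed.

(** The function [p x + w x] has slope at most [momentum] in the viscosity sense
    and stays within a bounded distance of [p x]. *)
Lemma corrector_growth : 0 <= c + d -> exists M, forall S, 0 <= S ->
  Rabs p * S <=
  RInt (fun x => momentum V (c + d) ((if Rle_dec 0 p then 1 else -1) * x)) 0 S + M.
Proof.
  intros Hcd. destruct Hw as [[[M HM] _] _].
  exists (2 * M). intros S HS.
  assert (Hmc : cts (momentum V (c + d))) by (apply momentum_cts; assumption).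
  assert (Hw2 : forall x y, w x - w y <= 2 * M).
  { intros x y. pose proof (HM x) as Hx. pose proof (HM y) as Hy.
    apply Rabs_le_between in Hx. apply Rabs_le_between in Hy. lra. }
  assert (Hg : cts (fun x => p * x + w x)).
  { apply cts_plus; [apply scale_cts | apply w_cts]. }
  destruct (Rle_dec 0 p) as [Hp|Hp].
  - rewrite Rabs_pos_eq by assumption.
    rewrite (int_ext _ (momentum V (c + d))) by (intros; f_equal; ring).
    pose proof (viscosity_growth (fun x => p * x + w x) (momentum V (c + d)) 0 S HS Hg Hmc
      (fun x => sqrt_pos _) (fun phi x => slope_bound phi x Hcd)) as G.
    specialize (Hw2 0 S). cbv beta in G. lra.
  - rewrite Rabs_left by lra.
    rewrite (int_ext _ (fun x => momentum V (c + d) (- x))) by (intros; f_equal; ring).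
    assert (Hneg : forall f : R -> R, cts f -> cts (fun x => f (- x))).
    { intros f Hf x. apply (continuous_ext (fun x => f (-1 * x))).
      - intros y. f_equal. toR. ring.
      - apply (cts_comp f); [assumption | apply scale_cts]. }
    pose proof (viscosity_growth (fun x => p * - x + w (- x)) (fun x => momentum V (c + d) (- x))
      0 S HS (Hneg _ Hg) (Hneg _ Hmc) (fun x => sqrt_pos _)) as G.
    assert (G' : (p * - S + w (- S)) - (p * - 0 + w (- 0)) <= RInt (fun x => momentum V (c + d) (- x)) 0 S).
    { apply G. intros phi x HC HL.
      destruct (C1_line_reflect phi HC) as [HC' HD].
      pose proof (slope_bound (fun y => phi (- y)) (- x) Hcd HC') as B.
      rewrite HD, Ropp_involutive, Rabs_Ropp in B. apply B.
      destruct HL as [e HL]. exists e. intros y Hy.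
      specialize (HL (- y)). simpl in HL. rewrite Ropp_involutive in HL. apply HL.
      change (Rabs (- y - x) < e). change (Rabs (y - - x) < e) in Hy.
      replace (- y - x) with (- (y - - x)) by ring. rewrite Rabs_Ropp. assumption. }
    specialize (Hw2 (- 0) (- S)). lra.
Qed.

End Corrector.

Lemma momentum_level_le V c d x : 0 <= V x -> 0 <= c -> 0 <= d ->
  momentum V (c + d) x <= momentum V c x + sqrt (2 * d).
Proof.
  intros HV Hc Hd. unfold momentum.
  replace (2 * (V x + (c + d))) with (2 * (V x + c) + 2 * d) by ring.
  apply sqrt_plus_le; lra.
Qed.

Section EffectiveHamiltonian.
Variables (g C : R) (omega : R * R) (Hbar : R -> R).
Hypothesis Hg : 0 < g.
Hypothesis HC : 0 < C.
Hypothesis Homega : diophantine 1 C omega.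
Hypothesis HH : effective_hamiltonian (potential g omega) Hbar.

Lemma effective_hamiltonian_nonneg p : 0 <= Hbar p.
Proof.
  apply le_epsilon. intros d Hd. destruct (HH p) as [Hw _].
  destruct (Hw d Hd) as [w Hcw].
  apply (corrector_level_nonneg (potential g omega) p (Hbar p) d w).
  - apply potential_cts; assumption.
  - assumption.
  - intros eta He. apply (potential_inf g C); assumption.
Qed.

(** [corrector_growth] on a long segment shows that the mean momentum is at least
    [|p|]; [orbit_average_compare] transfers this to the segment of length [T]. The
    error of the long segment, which depends on the corrector, is divided by its
    length and disappears. *)
Lemma effective_momentum : exists K, 0 <= K /\
  forall p T e, 0 <= T -> (e = 1 \/ e = -1) ->
    Rabs p * T <= RInt (fun x => momentum (potential g omega) (Hbar p) (e * x)) 0 T + K.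
Proof.
  destruct (orbit_average_compare g C omega Hg HC Homega) as [K [HK Hcmp]].
  exists K. split; [assumption|]. intros p T e HT He.
  set (V := potential g omega) in *.
  assert (HVc : cts V) by (apply potential_cts; assumption).
  assert (HV : forall x, 0 <= V x) by (intros; apply potential_range; assumption).
  pose proof (effective_hamiltonian_nonneg p) as Hp0.
  assert (Hmc : forall h, cts (fun x => momentum V h (e * x))).
  { intros h. apply (cts_comp (momentum V h)); [apply momentum_cts; assumption | apply scale_cts]. }
  assert (Hstep : forall d, 0 < d -> Rabs p * T <= RInt (fun x => momentum V (Hbar p + d) (e * x)) 0 T + K).
  { intros d Hd. destruct (HH p) as [Hw _]. destruct (Hw d Hd) as [w Hcw].
    destruct (corrector_growth V p (Hbar p) d w HVc HV Hcw ltac:(lra)) as [M HM].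
    apply le_epsilon. intros eta Heta.
    set (S := (K * T + T * Rabs M) / eta + 1).
    assert (HKT : 0 <= K * T + T * Rabs M).
    { pose proof (Rabs_pos M). assert (0 <= K * T) by nra. assert (0 <= T * Rabs M) by nra. lra. }
    assert (HS0 : 0 <= (K * T + T * Rabs M) / eta).
    { apply Rmult_le_pos; [assumption | apply Rlt_le, Rinv_0_lt_compat; lra]. }
    assert (HS : 0 < S) by (unfold S; lra).
    specialize (HM S ltac:(lra)).
    specialize (Hcmp (Hbar p + d) S T (if Rle_dec 0 p then 1 else -1) e ltac:(lra) ltac:(lra) HT
      ltac:(destruct (Rle_dec 0 p); auto) He).
    set (IS := RInt _ 0 S) in *. set (IT := RInt _ 0 T) in *.
    assert (T * (Rabs p * S) <= T * (IS + M)) by (apply Rmult_le_compat_l; lra).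
    assert (T * M <= T * Rabs M) by (apply Rmult_le_compat_l; [lra | apply Rle_abs]).
    assert (K * T + T * Rabs M <= S * eta).
    { unfold S. replace (((K * T + T * Rabs M) / eta + 1) * eta) with (K * T + T * Rabs M + eta)
        by (field; lra). lra. }
    apply (Rmult_le_reg_l S); [assumption|]. lra. }
  apply le_epsilon. intros eta Heta.
  set (r := eta / (T + 1)).
  assert (Hr : 0 < r) by (apply Rdiv_lt_0_compat; lra).
  specialize (Hstep (r * r / 2) ltac:(nra)).
  assert (I : RInt (fun x => momentum V (Hbar p + r * r / 2) (e * x)) 0 T <=
    RInt (fun x => momentum V (Hbar p) (e * x)) 0 T + T * r).
  { replace (T * r) with (RInt (fun _ => r) 0 T) by (rewrite int_const; toR; ring).
    rewrite <- int_plus by auto using cts_const.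
    apply int_le; auto.
    - apply cts_plus; auto using cts_const.
    - intros x _. eapply Rle_trans; [apply momentum_level_le; auto; nra|].
      replace (2 * (r * r / 2)) with (r * r) by field. rewrite sqrt_square by lra. lra. }
  assert (T * r <= eta).
  { unfold r. apply (Rmult_le_reg_r (T + 1)); [lra|].
    replace (T * (eta / (T + 1)) * (T + 1)) with (T * eta) by (field; lra). nra. }
  lra.
Qed.

End EffectiveHamiltonian.

(** * Continuous functions on rectangles *)

Lemma bounded_on_rectangle (f : R -> R -> R) a b c d :
  (forall x y, continuity_2d_pt f x y) ->
  exists M, forall x y, a <= x <= b -> c <= y <= d -> f x y <= M.
Proof.
  intros Hf.
  assert (Hex : forall x y, exists r : posreal,
    (forall u v, Rabs (u - x) < r -> Rabs (v - y) < r -> f u v <= f x y + 1) /\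
    r * (Rabs (f x y) + 1) <= 1).
  { intros x y. destruct (Hf x y (mkposreal 1 Rlt_0_1)) as [r Hr].
    pose proof (Rabs_pos (f x y)) as Hp.
    assert (Hi : 0 < / (Rabs (f x y) + 1)) by (apply Rinv_0_lt_compat; lra).
    assert (Hm : 0 < Rmin r (/ (Rabs (f x y) + 1))) by (apply Rmin_pos; [apply cond_pos | assumption]).
    exists (mkposreal _ Hm). simpl.
    pose proof (Rmin_l r (/ (Rabs (f x y) + 1))). pose proof (Rmin_r r (/ (Rabs (f x y) + 1))).
    split.
    - intros u v Hu Hv. specialize (Hr u v ltac:(lra) ltac:(lra)). simpl in Hr.
      apply Rabs_def2 in Hr. lra.
    - apply Rle_trans with (/ (Rabs (f x y) + 1) * (Rabs (f x y) + 1)).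
      + apply Rmult_le_compat_r; lra.
      + rewrite Rinv_l; lra. }
  assert (Hch : exists r : R -> R -> posreal, forall x y,
    (forall u v, Rabs (u - x) < r x y -> Rabs (v - y) < r x y -> f u v <= f x y + 1) /\
    r x y * (Rabs (f x y) + 1) <= 1).
  { exists (fun x y => proj1_sig (constructive_indefinite_description _ (Hex x y))).
    intros x y. apply (proj2_sig (constructive_indefinite_description _ (Hex x y))). }
  destruct Hch as [r Hr].
  destruct (compactness_value_2d a b c d r) as [e He].
  exists (/ e + 1). intros x y Hx Hy.
  apply NNPP. intros Hno. apply (He x y Hx Hy). intros [u [v [Hu [Hv [H1 [H2 H3]]]]]].
  apply Hno. destruct (Hr u v) as [B1 B2].
  eapply Rle_trans; [apply (B1 x y); assumption|].
  apply Rplus_le_compat_r.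
  pose proof (Rabs_pos (f u v)). pose proof (Rle_abs (f u v)). pose proof (cond_pos e).
  apply (Rmult_le_reg_l e); [assumption|]. rewrite Rinv_r by lra. nra.
Qed.

Lemma Rmax_lipschitz a x y : Rabs (Rmax a x - Rmax a y) <= Rabs (x - y).
Proof.
  unfold Rmax. destruct (Rle_dec a x), (Rle_dec a y);
    unfold Rabs; repeat destruct (Rcase_abs _); lra.
Qed.

Lemma Rmin_lipschitz a x y : Rabs (Rmin a x - Rmin a y) <= Rabs (x - y).
Proof.
  unfold Rmin. destruct (Rle_dec a x), (Rle_dec a y);
    unfold Rabs; repeat destruct (Rcase_abs _); lra.
Qed.

Lemma max_on_rectangle (f : R -> R -> R) a b c d : a <= b -> c <= d ->
  (forall x y, continuity_2d_pt f x y) ->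
  exists x y, (a <= x <= b /\ c <= y <= d) /\
    forall u v, a <= u <= b -> c <= v <= d -> f u v <= f x y.
Proof.
  intros Hab Hcd Hf.
  set (E := fun z => exists x y, a <= x <= b /\ c <= y <= d /\ z = f x y).
  destruct (bounded_on_rectangle f a b c d Hf) as [M HM].
  destruct (completeness E) as [s [Hs1 Hs2]].
  { exists M. intros z [x [y [Hx [Hy ->]]]]. auto. }
  { exists (f a c), a, c. repeat split; lra. }
  apply NNPP. intros Hno.
  assert (Hlt : forall x y, a <= x <= b -> c <= y <= d -> f x y < s).
  { intros x y Hx Hy.
    destruct (Rle_lt_or_eq_dec (f x y) s) as [|E0]; [|assumption|].
    - apply Hs1. exists x, y. auto.
    - exfalso. apply Hno. exists x, y. split; [auto|]. intros u v Hu Hv. rewrite E0.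
      apply Hs1. exists u, v. auto. }
  (* clamping the arguments makes the reciprocal gap continuous on the plane *)
  set (cl := fun lo hi x => Rmax lo (Rmin hi x)).
  assert (Hcl : forall lo hi x, lo <= hi -> lo <= cl lo hi x <= hi).
  { intros lo hi x H. unfold cl, Rmax, Rmin.
    destruct (Rle_dec hi x), (Rle_dec lo _); lra. }
  assert (Hcl1 : forall lo hi x, lo <= x <= hi -> cl lo hi x = x).
  { intros lo hi x H. unfold cl. rewrite Rmin_right, Rmax_right; lra. }
  assert (Hclc : forall lo hi x, continuity_pt (cl lo hi) x).
  { intros lo hi x e He. exists e. split; [assumption|]. intros y [_ Hy]. simpl in *.
    unfold Rdist in *. eapply Rle_lt_trans; [|exact Hy].
    unfold cl. eapply Rle_trans; [apply Rmax_lipschitz | apply Rmin_lipschitz]. }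
  set (k := fun x y => / (s - f (cl a b x) (cl c d y))).
  destruct (bounded_on_rectangle k a b c d) as [K HK].
  { intros x y. unfold k. apply continuity_2d_pt_inv.
    - apply continuity_2d_pt_minus; [apply continuity_2d_pt_const|].
      intros e. destruct (Hf (cl a b x) (cl c d y) e) as [r Hr].
      destruct (Hclc a b x r (cond_pos r)) as [r1 [Hr1 C1]].
      destruct (Hclc c d y r (cond_pos r)) as [r2 [Hr2 C2]].
      assert (Hm : 0 < Rmin r1 r2) by (apply Rmin_pos; assumption).
      exists (mkposreal _ Hm). simpl. intros u v Hu Hv.
      pose proof (Rmin_l r1 r2). pose proof (Rmin_r r1 r2). apply Hr.
      + destruct (Req_dec u x) as [->|Hne]; [rewrite Rminus_diag, Rabs_R0; apply cond_pos|].
        apply (C1 u). split; [split; [exact I | auto]|]. simpl. unfold Rdist. lra.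
      + destruct (Req_dec v y) as [->|Hne]; [rewrite Rminus_diag, Rabs_R0; apply cond_pos|].
        apply (C2 v). split; [split; [exact I | auto]|]. simpl. unfold Rdist. lra.
    - specialize (Hlt (cl a b x) (cl c d y) (Hcl a b x Hab) (Hcl c d y Hcd)). lra. }
  assert (HK0 : 0 < K).
  { specialize (HK a c ltac:(lra) ltac:(lra)). unfold k in HK. rewrite !Hcl1 in HK by lra.
    eapply Rlt_le_trans; [|exact HK]. apply Rinv_0_lt_compat.
    specialize (Hlt a c ltac:(lra) ltac:(lra)). lra. }
  assert (Hup : s <= s - / K).
  { apply Hs2. intros z [x [y [Hx [Hy ->]]]].
    specialize (HK x y Hx Hy). unfold k in HK. rewrite !Hcl1 in HK by lra.
    specialize (Hlt x y Hx Hy).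
    assert (/ K <= s - f x y); [|lra].
    rewrite <- (Rinv_inv (s - f x y)). apply Rinv_le_contravar; [|assumption].
    apply Rinv_0_lt_compat. lra. }
  assert (0 < / K) by (apply Rinv_0_lt_compat; assumption). lra.
Qed.

Lemma continuous_upper_clamp u : continuous_upper u ->
  forall x t, continuity_2d_pt (fun y s => u y (Rmax 0 s)) x t.
Proof.
  intros Hu x t e.
  assert (H0 : 0 <= Rmax 0 t) by apply Rmax_l.
  destruct (Hu x (Rmax 0 t) H0 (ball (u x (Rmax 0 t)) e) (locally_ball _ e)) as [d Hd].
  exists d. intros y s Hy Hs.
  apply (Hd (y, Rmax 0 s)).
  - split; [exact Hy|]. change (Rabs (Rmax 0 s - Rmax 0 t) < d).
    eapply Rle_lt_trans; [apply Rmax_lipschitz | exact Hs].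
  - apply Rmax_l.
Qed.

(** * Calculus of continuously differentiable functions on the plane *)

Definition C1_2d (f fx ft : R -> R -> R) : Prop :=
  (forall x t : R, is_derive (fun y : R => f y t) x (fx x t)) /\
  (forall x t : R, is_derive (fun s : R => f x s) t (ft x t)) /\
  (forall x t, continuity_2d_pt f x t) /\
  (forall x t, continuity_2d_pt fx x t) /\
  (forall x t, continuity_2d_pt ft x t).

Lemma C1_2d_upper f fx ft : C1_2d f fx ft -> C1_upper f.
Proof.
  intros (Hx & Ht & _ & Cx & Ct) x t _. repeat split.
  - eexists; apply Hx.
  - eexists; apply Ht.
  - apply (continuity_2d_pt_ext fx); [|apply Cx]. intros. symmetry. apply is_derive_unique, Hx.
  - apply (continuity_2d_pt_ext ft); [|apply Ct]. intros. symmetry. apply is_derive_unique, Ht.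
Qed.

Lemma C1_2d_plus f fx ft g gx gt : C1_2d f fx ft -> C1_2d g gx gt ->
  C1_2d (fun x t => f x t + g x t) (fun x t => fx x t + gx x t) (fun x t => ft x t + gt x t).
Proof.
  intros (Hx & Ht & C & Cx & Ct) (Gx & Gt & D & Dx & Dt).
  split; [|split; [|split; [|split]]]; intros x t.
  - apply (is_derive_plus (fun y => f y t)); auto.
  - apply (is_derive_plus (fun s => f x s)); auto.
  - apply continuity_2d_pt_plus; auto.
  - apply continuity_2d_pt_plus; auto.
  - apply continuity_2d_pt_plus; auto.
Qed.

Lemma C1_2d_mult f fx ft g gx gt : C1_2d f fx ft -> C1_2d g gx gt ->
  C1_2d (fun x t => f x t * g x t) (fun x t => fx x t * g x t + f x t * gx x t)
        (fun x t => ft x t * g x t + f x t * gt x t).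
Proof.
  intros (Hx & Ht & C & Cx & Ct) (Gx & Gt & D & Dx & Dt).
  split; [|split; [|split; [|split]]]; intros x t.
  - apply (is_derive_mult (fun y => f y t) (fun y => g y t)); auto. intros; apply Rmult_comm.
  - apply (is_derive_mult (fun s => f x s) (fun s => g x s)); auto. intros; apply Rmult_comm.
  - apply continuity_2d_pt_mult; auto.
  - apply continuity_2d_pt_plus; apply continuity_2d_pt_mult; auto.
  - apply continuity_2d_pt_plus; apply continuity_2d_pt_mult; auto.
Qed.

Lemma C1_2d_comp h h' f fx ft : C1_2d f fx ft ->
  (forall x t, is_derive h (f x t) (h' (f x t))) -> (forall x t, continuity_pt h' (f x t)) ->
  C1_2d (fun x t => h (f x t)) (fun x t => h' (f x t) * fx x t) (fun x t => h' (f x t) * ft x t).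
Proof.
  intros (Hx & Ht & C & Cx & Ct) Hh Ch'.
  assert (Ch : forall x t, continuity_pt h (f x t)).
  { intros x t. apply continuity_pt_filterlim, (ex_derive_continuous h). eexists. apply Hh. }
  assert (Cc : forall x t, continuity_2d_pt (fun x t => h' (f x t)) x t).
  { intros x t. apply (continuity_1d_2d_pt_comp h' f); auto. }
  split; [|split; [|split; [|split]]]; intros x t.
  - rewrite Rmult_comm. apply (is_derive_comp h (fun y => f y t)); auto.
  - rewrite Rmult_comm. apply (is_derive_comp h (fun s => f x s)); auto.
  - apply (continuity_1d_2d_pt_comp h f); auto.
  - apply continuity_2d_pt_mult; auto.
  - apply continuity_2d_pt_mult; auto.
Qed.

Lemma C1_2d_space f f' : (forall x, is_derive f x (f' x)) -> cts f' ->
  C1_2d (fun x _ => f x) (fun x _ => f' x) (fun _ _ => 0).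
Proof.
  intros Hf Hc.
  assert (Cf : cts f) by (apply (cts_of_derive f f'); assumption).
  split; [|split; [|split; [|split]]]; intros x t.
  - apply Hf.
  - apply (is_derive_const (f x)).
  - apply (continuity_1d_2d_pt_comp f (fun u _ => u));
      [apply continuity_pt_filterlim, Cf | apply continuity_2d_pt_id1].
  - apply (continuity_1d_2d_pt_comp f' (fun u _ => u));
      [apply continuity_pt_filterlim, Hc | apply continuity_2d_pt_id1].
  - apply continuity_2d_pt_const.
Qed.

Lemma C1_2d_time f f' : (forall x, is_derive f x (f' x)) -> cts f' ->
  C1_2d (fun _ t => f t) (fun _ _ => 0) (fun _ t => f' t).
Proof.
  intros Hf Hc.
  assert (Cf : cts f) by (apply (cts_of_derive f f'); assumption).
  split; [|split; [|split; [|split]]]; intros x t.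
  - apply (is_derive_const (f t)).
  - apply Hf.
  - apply (continuity_1d_2d_pt_comp f (fun _ v => v));
      [apply continuity_pt_filterlim, Cf | apply continuity_2d_pt_id2].
  - apply continuity_2d_pt_const.
  - apply (continuity_1d_2d_pt_comp f' (fun _ v => v));
      [apply continuity_pt_filterlim, Hc | apply continuity_2d_pt_id2].
Qed.

(** * A subsolution along straight lines *)

Lemma locally_2d_rectangle (P : R -> R -> Prop) a b c d x y : a < x < b -> c < y < d ->
  (forall u v, a <= u <= b -> c <= v <= d -> P u v) -> locally_2d P x y.
Proof.
  intros Hx Hy HP.
  set (r := Rmin (Rmin (x - a) (b - x)) (Rmin (y - c) (d - y))).
  assert (Hr : 0 < r) by (unfold r; repeat apply Rmin_pos; lra).
  assert (Hr1 : r <= x - a /\ r <= b - x /\ r <= y - c /\ r <= d - y).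
  { unfold r. pose proof (Rmin_l (Rmin (x - a) (b - x)) (Rmin (y - c) (d - y))).
    pose proof (Rmin_r (Rmin (x - a) (b - x)) (Rmin (y - c) (d - y))).
    pose proof (Rmin_l (x - a) (b - x)). pose proof (Rmin_r (x - a) (b - x)).
    pose proof (Rmin_l (y - c) (d - y)). pose proof (Rmin_r (y - c) (d - y)). lra. }
  exists (mkposreal r Hr). simpl. intros u v Hu Hv.
  apply Rabs_def2 in Hu. apply Rabs_def2 in Hv. apply HP; lra.
Qed.

Lemma exp_barrier_derive k N s t :
  is_derive (fun t => k * exp (N * (t - s))) t (k * (N * exp (N * (t - s)))).
Proof. auto_derive; [trivial|]. toR. unfold Rminus. ring. Qed.

Lemma exp_barrier_cts k N s : cts (fun t => k * (N * exp (N * (t - s)))).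
Proof.
  intros t. apply (ex_derive_continuous (fun t => k * (N * exp (N * (t - s))))).
  auto_derive. trivial.
Qed.

(** The hypothesis makes [u] a subsolution of the transport equation
    [u_t + v u_x <= l]. Subtract a steep parabola transported along the line and a
    function of time growing faster than [l]: the maximum of the difference can only
    sit at the initial time, near the line. Only a thin tube
    around the line matters, so nothing has to be known about the growth of [u]. *)
Lemma subsolution_along_line (H : R -> R -> R) (u : R -> R -> R) v l x0 t0 t1 :
  continuous_upper u -> evolution_subsolution H u ->
  (forall x q, q * v - l <= H x q) -> 0 <= t0 < t1 ->
  u (x0 + v * (t1 - t0)) t1 <= u x0 t0 + l * (t1 - t0).
Proof.
  intros Hc Hsub HH Ht.
  destruct (Rle_dec (u (x0 + v * (t1 - t0)) t1) (u x0 t0 + l * (t1 - t0))) as [|Hno]; [assumption|].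
  exfalso.
  set (d := (u (x0 + v * (t1 - t0)) t1 - u x0 t0 - l * (t1 - t0)) / 3).
  assert (Hd : 0 < d) by (unfold d; lra).
  set (X := fun t => x0 + v * (t - t0)).
  (* the solution in coordinates moving along the line *)
  set (U := fun z t => u (X t + z) (Rmax 0 t)).
  assert (HU : forall z t, continuity_2d_pt U z t).
  { intros z t e. destruct (continuous_upper_clamp u Hc (X t + z) t e) as [r Hr].
    pose proof (Rabs_pos v) as Pv.
    assert (Hr2 : 0 < r / (Rabs v + 1)) by (apply Rdiv_lt_0_compat; [apply cond_pos | lra]).
    assert (Hr2' : r / (Rabs v + 1) * (Rabs v + 1) = r) by (field; lra).
    exists (mkposreal _ Hr2). simpl. intros z' t' Hz Ht'. apply Hr.
    - replace (X t' + z' - (X t + z)) with (v * (t' - t) + (z' - z)) by (unfold X; ring).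
      eapply Rle_lt_trans; [apply Rabs_triang|]. rewrite Rabs_mult.
      assert (Rabs v * Rabs (t' - t) <= Rabs v * (r / (Rabs v + 1))) by (apply Rmult_le_compat_l; lra).
      lra.
    - eapply Rlt_le_trans; [exact Ht'|]. nra. }
  destruct (bounded_on_rectangle (fun z t => Rabs (U z t)) (-1) 1 t0 (t1 + 1)) as [M HM].
  { intros z t. apply (continuity_1d_2d_pt_comp Rabs U); [|apply HU].
    apply continuity_pt_filterlim, continuous_Rabs. }
  assert (HM' : forall z t, -1 <= z <= 1 -> t0 <= t <= t1 + 1 -> - M <= U z t <= M).
  { intros z t Hz Ht'. apply Rabs_le_between. apply HM; assumption. }
  assert (HM0 : 0 <= M).
  { eapply Rle_trans; [apply Rabs_pos | apply (HM 0 t0); lra]. }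
  destruct (HU 0 t0 (mkposreal d Hd)) as [r0 Hr0]. simpl in Hr0.
  set (r := Rmin r0 1).
  assert (Hr : 0 < r) by (apply Rmin_pos; [apply cond_pos | lra]).
  assert (Hr1 : r <= 1) by apply Rmin_r. assert (Hr2 : r <= r0) by apply Rmin_l.
  set (l' := l + d / (t1 - t0)).
  assert (Hl' : (l' - l) * (t1 - t0) = d) by (unfold l'; field; lra).
  assert (Hll : l < l') by nra.
  set (B := 2 * M + Rabs l' * (t1 - t0 + 1) + 1).
  assert (HB0 : 0 <= Rabs l' * (t1 - t0 + 1)).
  { apply Rmult_le_pos; [apply Rabs_pos | lra]. }
  assert (HB : 1 <= B) by (unfold B; lra).
  set (K := B / r ^ 2).
  assert (HK : K * r ^ 2 = B) by (unfold K; field; lra).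
  assert (HK0 : 0 < K) by (apply Rdiv_lt_0_compat; [lra | apply pow_lt; lra]).
  set (N := B / (d / 2)).
  assert (HN : d / 2 * N = B) by (unfold N; field; lra).
  assert (HN0 : 0 <= N) by (apply Rlt_le, Rdiv_lt_0_compat; lra).
  set (ex := fun t => d / 2 * exp (N * (t - t1))).
  assert (Hex : forall t, 0 < ex t) by (intros; apply Rmult_lt_0_compat; [lra | apply exp_pos]).
  set (time := fun t => l' * (t - t0) + ex t).
  set (W := fun z t => U z t + (- K * z ^ 2 + - time t)).
  assert (Htl : forall t, t0 <= t <= t1 + 1 -> - (Rabs l' * (t1 - t0 + 1)) <= l' * (t - t0)).
  { intros t Htt. pose proof (Rle_abs (- l')) as Ha. rewrite Rabs_Ropp in Ha.
    pose proof (Rabs_pos l'). nra. }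
  destruct (max_on_rectangle W (-1) 1 t0 (t1 + 1)) as [z [t [[Hz Htt] Hmax]]]; [lra | lra | |].
  { assert (Cex : forall t, continuity_pt time t).
    { intros t. apply continuity_pt_filterlim.
      apply (ex_derive_continuous (fun t => l' * (t - t0) + d / 2 * exp (N * (t - t1)))).
      auto_derive. trivial. }
    assert (Csq : forall z, continuity_pt (fun z => - K * z ^ 2) z).
    { intros z. apply continuity_pt_filterlim.
      apply (ex_derive_continuous (fun z => - K * z ^ 2)). auto_derive. trivial. }
    intros z t. apply continuity_2d_pt_plus; [apply HU|]. apply continuity_2d_pt_plus.
    - apply (continuity_1d_2d_pt_comp (fun z => - K * z ^ 2) (fun u _ => u));
        [apply Csq | apply continuity_2d_pt_id1].
    - apply continuity_2d_pt_opp.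
      apply (continuity_1d_2d_pt_comp time (fun _ v => v)); [apply Cex | apply continuity_2d_pt_id2]. }
  assert (Hend : u x0 t0 + 3 / 2 * d <= W z t).
  { eapply Rle_trans; [|apply (Hmax 0 t1); lra].
    unfold W, U, X, time, ex. rewrite Rmax_right by lra.
    rewrite Rminus_diag, Rmult_0_r, exp_0, !Rplus_0_r.
    replace (l' * (t1 - t0)) with (l * (t1 - t0) + d) by lra.
    unfold d. simpl. lra. }
  assert (Hu0 : u x0 t0 = U 0 t0).
  { unfold U, X. rewrite Rmax_right by lra. f_equal. ring. }
  assert (Hu0M : - M <= u x0 t0) by (rewrite Hu0; apply HM'; lra).
  assert (HKz : z ^ 2 < r ^ 2).
  { apply Rnot_le_lt. intros Hbig.
    assert (B <= K * z ^ 2) by (rewrite <- HK; apply Rmult_le_compat_l; lra).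
    pose proof (HM' z t Hz Htt). pose proof (Htl t Htt). pose proof (Hex t).
    unfold W, time in Hend. unfold B in *. lra. }
  assert (Hzr : - r < z < r) by nra.
  assert (Hzz : 0 <= K * z ^ 2) by (apply Rmult_le_pos; [lra | apply pow2_ge_0]).
  assert (Ht0 : t <> t0).
  { intros ->. specialize (Hr0 z t0). rewrite Rminus_diag, Rabs_R0, Rminus_0_r in Hr0.
    specialize (Hr0 ltac:(apply Rabs_def1; lra) (cond_pos r0)).
    apply Rabs_def2 in Hr0. pose proof (Hex t0).
    unfold W, time in Hend. rewrite Rminus_diag, Rmult_0_r in Hend. lra. }
  assert (Ht1 : t <> t1 + 1).
  { intros ->. pose proof (HM' z (t1 + 1) Hz Htt). pose proof (Htl (t1 + 1) Htt).
    pose proof (exp_ge_linear N HN0).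
    assert (B <= ex (t1 + 1)).
    { unfold ex. replace (t1 + 1 - t1) with 1 by ring. rewrite Rmult_1_r. nra. }
    unfold W, time in Hend. unfold B in *. lra. }
  assert (Csp : C1_2d (fun x t => K * (x + - X t) ^ 2)
    (fun x t => K * (2 * (x + - X t)) * (1 + 0)) (fun x t => K * (2 * (x + - X t)) * (0 + - v))).
  { apply (C1_2d_comp (fun z => K * z ^ 2) (fun z => K * (2 * z)) (fun x t => x + - X t)
      (fun _ _ => 1 + 0) (fun _ _ => 0 + - v)).
    - apply (C1_2d_plus (fun x _ => x) (fun _ _ => 1) (fun _ _ => 0) (fun _ t => - X t)
        (fun _ _ => 0) (fun _ _ => - v)).
      + apply (C1_2d_space (fun x => x) (fun _ => 1)); [intros; apply (is_derive_id x) | apply cts_const].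
      + apply (C1_2d_time (fun t => - X t) (fun _ => - v)); [|apply cts_const].
        intros s. unfold X. auto_derive; [trivial | toR; ring].
    - intros. auto_derive; [trivial | toR; ring].
    - intros. apply continuity_pt_filterlim.
      apply (ex_derive_continuous (fun z => K * (2 * z))). auto_derive. trivial. }
  assert (Ctm : C1_2d (fun _ t => time t) (fun _ _ => 0)
     (fun _ t => l' + d / 2 * (N * exp (N * (t - t1))))).
  { apply (C1_2d_time time (fun t => l' + d / 2 * (N * exp (N * (t - t1))))).
    - intros s. apply (is_derive_plus (fun t => l' * (t - t0)) ex).
      + auto_derive; [trivial | toR; ring].
      + apply exp_barrier_derive.
    - apply cts_plus; [apply cts_const | apply exp_barrier_cts]. }
  pose proof (C1_2d_plus _ _ _ _ _ _ Csp Ctm) as Cphi.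
  set (phi := fun x t => K * (x + - X t) ^ 2 + time t) in *.
  specialize (Hsub phi (X t + z) t ltac:(lra) (C1_2d_upper _ _ _ Cphi)).
  destruct Cphi as (Px & Pt & _).
  rewrite (is_derive_unique _ _ _ (Pt (X t + z) t)), (is_derive_unique _ _ _ (Px (X t + z) t)) in Hsub.
  assert (Hloc : locally_2d (fun y s => u y s - phi y s <= u (X t + z) t - phi (X t + z) t) (X t + z) t).
  { assert (L : locally_2d (fun z' s => W z' s <= W z t) z t).
    { apply (locally_2d_rectangle _ (-1) 1 t0 (t1 + 1)); [lra | lra | exact Hmax]. }
    destruct L as [e He].
    pose proof (Rabs_pos v) as Pv.
    set (e' := Rmin (e / (Rabs v + 1)) t).
    assert (Hm1 : e' <= e / (Rabs v + 1)) by apply Rmin_l.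
    assert (Hm2 : e' <= t) by apply Rmin_r.
    assert (Hee : e / (Rabs v + 1) * (Rabs v + 1) = e) by (field; lra).
    assert (He' : 0 < e').
    { apply Rmin_pos; [apply Rdiv_lt_0_compat; [apply cond_pos | lra] | lra]. }
    exists (mkposreal e' He'). simpl. intros y s Hy Hs.
    assert (Hspos : 0 <= s) by (apply Rabs_def2 in Hs; lra).
    specialize (He (y - X s) s).
    assert (Hq : W (y - X s) s <= W z t).
    { apply He.
      - replace (y - X s - z) with ((y - (X t + z)) + - (v * (s - t))) by (unfold X; ring).
        eapply Rle_lt_trans; [apply Rabs_triang|]. rewrite Rabs_Ropp, Rabs_mult.
        assert (Rabs v * Rabs (s - t) <= Rabs v * e') by (apply Rmult_le_compat_l; lra). nra.
      - assert (e' <= e) by nra. lra. }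
    unfold W, U in Hq. rewrite !Rmax_right in Hq by lra.
    replace (X s + (y - X s)) with y in Hq by ring.
    unfold phi. replace (X t + z + - X t) with z by ring.
    replace (y + - X s) with (y - X s) by ring. lra. }
  specialize (Hsub Hloc).
  replace (X t + z + - X t) with z in Hsub by ring.
  pose proof (HH (X t + z) (K * (2 * z) * (1 + 0) + 0)) as HHq.
  assert (0 <= d / 2 * (N * exp (N * (t - t1)))).
  { apply Rmult_le_pos; [lra|]. apply Rmult_le_pos; [assumption | apply Rlt_le, exp_pos]. }
  lra.
Qed.

(** * Smooth barriers *)

(** [x, t |-> - b x t] is a classical subsolution of
    [z_t + z_x ^ 2 / 2 - W = 0] up to time 3. *)
Definition barrier (W : R -> R) (b : R -> R -> R) : Prop :=
  exists bx bt, C1_2d b bx bt /\ forall x t, t <= 3 -> bx x t ^ 2 / 2 - W x <= bt x t.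

Lemma barrier_eikonal W S S' c : (forall x, is_derive S x (S' x)) -> cts S' ->
  (forall x, S' x ^ 2 / 2 - W x <= c) -> barrier W (fun x t => S x + - (c * (1 - t))).
Proof.
  intros HS HS' Hc.
  exists (fun x t => S' x + 0), (fun x t => 0 + c). split.
  - apply (C1_2d_plus (fun x _ => S x) _ _ (fun _ t => - (c * (1 - t))) _ (fun _ _ => c)).
    + apply C1_2d_space; assumption.
    + apply (C1_2d_time (fun t => - (c * (1 - t))) (fun _ => c)); [|apply cts_const].
      intros t. auto_derive; [trivial | toR; ring].
  - intros x t _. rewrite Rplus_0_r, Rplus_0_l. apply Hc.
Qed.

(** The factor [a = exp (t - 3)] satisfies [a' >= a ^ 2] as long as it is at most
    1, which is what [a x ^ 2 / 2] needs. It is defined for all times, unlike the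
    solution [1 / (T - t)] of [a' = a ^ 2]. *)
Definition coercive_barrier (x t : R) : R := exp (t - 3) * (x ^ 2 / 2).

Lemma coercive_barrier_barrier W : (forall x, 0 <= W x) -> barrier W coercive_barrier.
Proof.
  intros HW.
  exists (fun x t => 0 * (x ^ 2 / 2) + exp (t - 3) * x), (fun x t => exp (t - 3) * (x ^ 2 / 2) + exp (t - 3) * 0).
  split.
  - apply (C1_2d_mult (fun _ t => exp (t - 3)) (fun _ _ => 0) (fun _ t => exp (t - 3))
      (fun x _ => x ^ 2 / 2) (fun x _ => x) (fun _ _ => 0)).
    + apply (C1_2d_time (fun t => exp (t - 3)) (fun t => exp (t - 3))).
      * intros t. auto_derive; [trivial | toR; unfold Rminus; ring].
      * intros t. apply (ex_derive_continuous (fun t => exp (t - 3))). auto_derive. trivial.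
    + apply (C1_2d_space (fun x => x ^ 2 / 2) (fun x => x)).
      * intros x. auto_derive; [trivial | toR; field].
      * intros x. apply continuous_id.
  - intros x t Ht. specialize (HW x). pose proof (exp_pos (t - 3)) as Hp.
    assert (He : exp (t - 3) <= 1).
    { rewrite <- exp_0. destruct (Req_dec t 3) as [->|]; [rewrite Rminus_diag; lra|].
      left. apply exp_increasing. lra. }
    set (E := exp (t - 3)) in *.
    assert (Hx : 0 <= x ^ 2) by apply pow2_ge_0.
    replace (0 * (x ^ 2 / 2) + E * x) with (E * x) by ring.
    assert ((E * x) ^ 2 <= E * x ^ 2); [|lra].
    replace ((E * x) ^ 2) with (E * (E * x ^ 2)) by ring.
    apply Rmult_le_compat_l; nra.
Qed.

Lemma ln_2_le_1 : ln 2 <= 1.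
Proof.
  rewrite <- (ln_exp 1). left. apply ln_increasing; [lra|].
  pose proof (exp_ineq1 1 ltac:(lra)). lra.
Qed.

(** The gradient of [m ln (exp (f / m) + exp (g / m))] is a convex combination of
    those of [f] and [g], and the Hamiltonian is convex in the gradient. *)
Lemma barrier_soft_max W f g m : barrier W f -> barrier W g -> 0 < m ->
  exists b, barrier W b /\ (forall x t, f x t <= b x t) /\ (forall x t, g x t <= b x t) /\
    forall x t, b x t <= Rmax (f x t) (g x t) + m.
Proof.
  intros [fx [ft [Cf Hf]]] [gx [gt [Cg Hg]]] Hm.
  set (ef := fun x t => exp (/ m * f x t)). set (eg := fun x t => exp (/ m * g x t)).
  assert (Hexp : forall y, is_derive (fun y => exp (/ m * y)) y (/ m * exp (/ m * y))).
  { intros y. auto_derive; [trivial | toR; ring]. }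
  assert (Hexpc : forall y, continuity_pt (fun y => / m * exp (/ m * y)) y).
  { intros y. apply continuity_pt_filterlim.
    apply (ex_derive_continuous (fun y => / m * exp (/ m * y))). auto_derive. trivial. }
  assert (Cef := C1_2d_comp _ _ _ _ _ Cf (fun x t => Hexp (f x t)) (fun x t => Hexpc (f x t))).
  assert (Ceg := C1_2d_comp _ _ _ _ _ Cg (fun x t => Hexp (g x t)) (fun x t => Hexpc (g x t))).
  assert (Pf : forall x t, 0 < ef x t) by (intros; apply exp_pos).
  assert (Pg : forall x t, 0 < eg x t) by (intros; apply exp_pos).
  pose proof (C1_2d_plus _ _ _ _ _ _ Cef Ceg) as Cs.
  assert (Hln : forall y, 0 < y -> is_derive (fun y => m * ln y) y (m * / y)).
  { intros y Hy. auto_derive; [assumption | toR; field; lra]. }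
  assert (Hlnc : forall y, 0 < y -> continuity_pt (fun y => m * / y) y).
  { intros y Hy. apply continuity_pt_filterlim.
    apply (ex_derive_continuous (fun y => m * / y)). auto_derive. lra. }
  assert (Psum : forall x t, 0 < exp (/ m * f x t) + exp (/ m * g x t)).
  { intros x t. specialize (Pf x t). specialize (Pg x t). unfold ef, eg in *. lra. }
  pose proof (C1_2d_comp (fun y => m * ln y) (fun y => m * / y) _ _ _ Cs
    (fun x t => Hln _ (Psum x t)) (fun x t => Hlnc _ (Psum x t))) as Cb.
  exists (fun x t => m * ln (exp (/ m * f x t) + exp (/ m * g x t))).
  assert (Hi : 0 < / m) by (apply Rinv_0_lt_compat; assumption).
  assert (Hback : forall y, m * ln (exp (/ m * y)) = y).
  { intros y. rewrite ln_exp. field. lra. }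
  split; [|split; [|split]].
  - eexists; eexists. split; [exact Cb|]. intros x t Ht. cbv beta.
    specialize (Hf x t Ht). specialize (Hg x t Ht).
    specialize (Pf x t). specialize (Pg x t). unfold ef, eg in *.
    set (a := exp (/ m * f x t)) in *. set (b := exp (/ m * g x t)) in *.
    set (w := a / (a + b)).
    assert (Hw : 0 <= w <= 1).
    { unfold w. split; [apply Rlt_le, Rdiv_lt_0_compat; lra|].
      apply (Rmult_le_reg_r (a + b)); [lra|]. unfold Rdiv. rewrite Rmult_assoc, Rinv_l by lra. lra. }
    replace (m * / (a + b) * (/ m * a * fx x t + / m * b * gx x t))
      with (w * fx x t + (1 - w) * gx x t) by (unfold w; field; lra).
    replace (m * / (a + b) * (/ m * a * ft x t + / m * b * gt x t))
      with (w * ft x t + (1 - w) * gt x t) by (unfold w; field; lra).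
    set (p := fx x t) in *. set (q := gx x t) in *.
    assert (Hconv : (w * p + (1 - w) * q) ^ 2 <= w * p ^ 2 + (1 - w) * q ^ 2).
    { assert (0 <= w * (1 - w) * (p - q) ^ 2); [|nra].
      apply Rmult_le_pos; [nra | apply pow2_ge_0]. }
    assert (w * (p ^ 2 / 2 - W x) <= w * ft x t) by (apply Rmult_le_compat_l; lra).
    assert ((1 - w) * (q ^ 2 / 2 - W x) <= (1 - w) * gt x t) by (apply Rmult_le_compat_l; lra).
    lra.
  - intros x t. rewrite <- (Hback (f x t)) at 1. apply Rmult_le_compat_l; [lra|].
    left. apply ln_increasing; [apply exp_pos|]. specialize (Pg x t). unfold eg in Pg. lra.
  - intros x t. rewrite <- (Hback (g x t)) at 1. apply Rmult_le_compat_l; [lra|].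
    left. apply ln_increasing; [apply exp_pos|]. specialize (Pf x t). unfold ef in Pf. lra.
  - intros x t.
    assert (Hmono : forall y z, y <= z -> exp (/ m * y) <= exp (/ m * z)).
    { intros y z [Hyz| ->]; [|lra]. left. apply exp_increasing. nra. }
    pose proof (Hmono _ _ (Rmax_l (f x t) (g x t))) as M1.
    pose proof (Hmono _ _ (Rmax_r (f x t) (g x t))) as M2.
    set (M := Rmax (f x t) (g x t)) in *.
    assert (L : ln (exp (/ m * f x t) + exp (/ m * g x t)) <= ln (2 * exp (/ m * M))).
    { destruct (Rle_lt_or_eq_dec (exp (/ m * f x t) + exp (/ m * g x t)) (2 * exp (/ m * M)) ltac:(lra))
        as [Hl|He]; [left; apply ln_increasing; [apply Psum | assumption] | rewrite He; lra]. }
    rewrite ln_mult, ln_exp in L by (try apply exp_pos; lra).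
    pose proof ln_2_le_1.
    replace (M + m) with (m * (1 + / m * M)) by (field; lra).
    apply Rmult_le_compat_l; lra.
Qed.

Lemma barrier_list_max W b0 l m : barrier W b0 -> b0 0 1 <= 0 ->
  (forall b, In b l -> barrier W b /\ b 0 1 <= 0) -> 0 < m ->
  exists b, barrier W b /\ b 0 1 <= m /\ (forall x t, b0 x t <= b x t) /\
    forall f, In f l -> forall x t, f x t <= b x t.
Proof.
  intros Hb0 H0 Hl. revert m. induction l as [|f l IH]; intros m Hm.
  - exists b0. repeat split; auto; [lra | intros; lra | intros ? []].
  - destruct (IH (fun b Hb => Hl b (or_intror Hb)) (m / 2) ltac:(lra)) as [b1 [B1 [B2 [B3 B4]]]].
    destruct (Hl f (or_introl eq_refl)) as [F1 F2].
    destruct (barrier_soft_max W f b1 (m / 2) F1 B1 ltac:(lra)) as [b [C1 [C2 [C3 C4]]]].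
    exists b. split; [assumption|]. split; [|split].
    + specialize (C4 0 1). assert (Rmax (f 0 1) (b1 0 1) <= m / 2) by (apply Rmax_lub; lra). lra.
    + intros x t. eapply Rle_trans; [apply B3 | apply C3].
    + intros f' [<-|Hin] x t; [apply C2|]. eapply Rle_trans; [apply B4; assumption | apply C3].
Qed.

(** * Comparison with a barrier *)

Section Comparison.
Variables (W u0 : R -> R) (u : R -> R -> R) (Wmax : R).
Hypothesis HW : forall x, 0 <= W x <= Wmax.
Hypothesis Hu : viscosity_solution (fun x q => q ^ 2 / 2 - W x) u0 u.

(** Along the line from [(y, s)] to [(0, 100)] the subsolution property bounds the
    late value by the early one; read backwards it is a lower bound for the early
    value. The long time makes the quadratic coefficient small. *)
Lemma solution_lower_bound y s : 0 <= s <= 2 ->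
  u 0 100 - 100 * Wmax - y ^ 2 / 196 <= u y s.
Proof.
  intros Hs. destruct Hu as [Hc [Hsub _]].
  set (T := 100 - s). assert (HT : 98 <= T <= 100) by (unfold T; lra).
  set (v := - y / T).
  pose proof (subsolution_along_line _ u v (v ^ 2 / 2 + Wmax) y s 100 Hc Hsub) as L.
  assert (HL : u (y + v * (100 - s)) 100 <= u y s + (v ^ 2 / 2 + Wmax) * (100 - s)).
  { apply L; [|lra]. intros x q. specialize (HW x). pose proof (pow2_ge_0 (q - v)). nra. }
  fold T in HL. replace (y + v * T) with 0 in HL by (unfold v; field; lra).
  assert (HWm : 0 <= Wmax) by (specialize (HW 0); lra).
  assert (Hv : v ^ 2 / 2 * T <= y ^ 2 / 196).
  { replace (v ^ 2 / 2 * T) with (y ^ 2 * / (2 * T)) by (unfold v; field; lra).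
    unfold Rdiv. apply Rmult_le_compat_l; [apply pow2_ge_0|].
    apply Rinv_le_contravar; lra. }
  nra.
Qed.

Lemma exp_m3_lower : / 27 <= exp (- 3).
Proof.
  replace (-3) with (- (3)) by ring. rewrite exp_Ropp. apply Rinv_le_contravar; [apply exp_pos|].
  replace 3 with (1 + 1 + 1) by ring. rewrite !exp_plus.
  pose proof exp_le_3. pose proof (exp_pos 1).
  assert (exp 1 * exp 1 <= 9) by nra. nra.
Qed.

(** Minimise [u + b] on a large rectangle. The coercive barrier beats the
    quadratic lower bound of [u] on the lateral sides, the exponential term
    excludes the final time, and an interior minimum would contradict the
    supersolution property. *)
Lemma solution_above_barrier b m : barrier W b ->
  (forall x t, coercive_barrier x t <= b x t) -> 0 < m ->
  exists y, u0 y + b y 0 <= u 0 1 + b 0 1 + m.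
Proof.
  intros [bx [bt [Cb Hb]]] Hbc Hm.
  assert (HWm : 0 <= Wmax) by (specialize (HW 0); lra).
  set (A := Rabs (u 0 100) + 100 * Wmax).
  assert (HA : 0 <= A) by (unfold A; pose proof (Rabs_pos (u 0 100)); lra).
  assert (Hlow : forall y t, 0 <= t <= 2 -> y ^ 2 / 100 - A <= u y t + b y t).
  { intros y t Ht. pose proof (solution_lower_bound y t Ht) as L.
    specialize (Hbc y t). unfold coercive_barrier in Hbc.
    assert (He : / 27 <= exp (t - 3)).
    { apply Rle_trans with (exp (- 3)); [apply exp_m3_lower|].
      destruct (Req_dec t 0) as [->|]; [replace (0 - 3) with (-3) by ring; lra|].
      left. apply exp_increasing. lra. }
    pose proof (pow2_ge_0 y).
    assert (/ 27 * (y ^ 2 / 2) <= exp (t - 3) * (y ^ 2 / 2)) by (apply Rmult_le_compat_r; lra).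
    pose proof (Rle_abs (- u 0 100)). rewrite Rabs_Ropp in *. unfold A. lra. }
  set (q1 := u 0 1 + b 0 1 + m).
  pose proof (Rle_abs q1) as Hq1. pose proof (Rabs_pos q1) as Hq0.
  set (R0 := 100 * (Rabs q1 + A + 1)).
  assert (HR : q1 + A < R0 ^ 2 / 100).
  { unfold R0. set (z := Rabs q1 + A + 1) in *. assert (1 <= z) by (unfold z; lra).
    replace ((100 * z) ^ 2 / 100) with (100 * (z * z)) by field.
    assert (z <= z * z) by nra. apply Rlt_le_trans with z; [unfold z; lra | lra]. }
  assert (HR0 : 0 < R0) by (unfold R0; lra).
  set (N := (Rabs q1 + A) / (m / 2)).
  assert (HN : m / 2 * N = Rabs q1 + A) by (unfold N; field; lra).
  assert (HN0 : 0 <= N) by (apply Rmult_le_pos; [lra | apply Rlt_le, Rinv_0_lt_compat; lra]).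
  set (time := fun t => m / 2 * t + m / 2 * exp (N * (t - 1))).
  set (time' := fun t => m / 2 + m / 2 * (N * exp (N * (t - 1)))).
  assert (Htime : forall t, is_derive time t (time' t)).
  { intros t. apply (is_derive_plus (fun t => m / 2 * t) (fun t => m / 2 * exp (N * (t - 1)))).
    - auto_derive; [trivial | toR; ring].
    - apply exp_barrier_derive. }
  assert (Htime' : cts time') by (apply cts_plus; [apply cts_const | apply exp_barrier_cts]).
  assert (Htpos : forall t, 0 <= t -> 0 < time t).
  { intros t Ht. unfold time. pose proof (exp_pos (N * (t - 1))). nra. }
  pose proof (C1_2d_plus _ _ _ _ _ _ Cb (C1_2d_time time time' Htime Htime')) as Cs.
  assert (Hneg1 : forall y : R, is_derive (fun y => - y) y (-1)).
  { intros y. auto_derive; [trivial | toR; ring]. }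
  pose proof (C1_2d_comp (fun y => - y) (fun _ => -1) _ _ _ Cs
    (fun x t => Hneg1 _) (fun x t => proj2 (continuity_pt_filterlim _ _) (cts_const (-1) _))) as Cphi.
  destruct Hu as [Hc [_ [Hsup Hinit]]].
  set (Q := fun y t => u y (Rmax 0 t) + (b y t + time t)).
  assert (HQ : forall y t, continuity_2d_pt Q y t).
  { intros y t. apply continuity_2d_pt_plus; [apply continuous_upper_clamp; assumption|].
    destruct Cs as (_ & _ & C & _). apply C. }
  destruct (max_on_rectangle (fun y t => - Q y t) (- R0) R0 0 2) as [y [t [[Hy Ht] Hmax]]];
    [lra | lra | intros; apply continuity_2d_pt_opp, HQ |].
  assert (Hmin : forall z s, - R0 <= z <= R0 -> 0 <= s <= 2 -> Q y t <= Q z s).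
  { intros z s Hz Hs. specialize (Hmax z s Hz Hs). lra. }
  assert (Hq : Q y t <= q1).
  { eapply Rle_trans; [apply (Hmin 0 1); lra|]. unfold Q, q1, time.
    rewrite Rmax_right by lra. rewrite Rminus_diag, Rmult_0_r, exp_0. lra. }
  unfold Q in Hq. rewrite Rmax_right in Hq by lra.
  pose proof (Hlow y t Ht) as Hl. pose proof (Htpos t ltac:(lra)) as Htp.
  destruct (Req_dec t 0) as [->|Ht0].
  { exists y. rewrite <- Hinit. fold q1. lra. }
  exfalso.
  assert (HyR : y ^ 2 < R0 ^ 2) by lra.
  assert (Hy' : - R0 < y < R0) by nra.
  assert (Ht2 : t <> 2).
  { intros ->. unfold time in Hq. replace (2 - 1) with 1 in Hq by ring. rewrite Rmult_1_r in Hq.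
    pose proof (exp_ge_linear N HN0). pose proof (pow2_ge_0 y). nra. }
  specialize (Hsup _ y t ltac:(lra) (C1_2d_upper _ _ _ Cphi)).
  destruct Cphi as (Px & Pt & _).
  cbv beta in Hsup, Px, Pt. rewrite (is_derive_unique _ _ _ (Px y t)), (is_derive_unique _ _ _ (Pt y t)) in Hsup.
  assert (Hloc : locally_2d (fun z s => u z s - - (b z s + time s) >= u y t - - (b y t + time t)) y t).
  { apply (locally_2d_rectangle _ (- R0) R0 0 2); [lra | lra |].
    intros z s Hz Hs. specialize (Hmin z s Hz Hs). unfold Q in Hmin.
    rewrite !Rmax_right in Hmin by lra. lra. }
  specialize (Hsup Hloc). specialize (Hb y t ltac:(lra)).
  assert (0 <= m / 2 * (N * exp (N * (t - 1)))).
  { apply Rmult_le_pos; [lra|]. apply Rmult_le_pos; [assumption | apply Rlt_le, exp_pos]. }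
  unfold time' in Hsup. rewrite Rplus_0_r in Hsup.
  replace ((-1 * bx y t) ^ 2) with (bx y t ^ 2) in Hsup by ring. lra.
Qed.

End Comparison.

(** * Comparison of the two solutions *)

Section Rate.
Variables (g : R) (omega : R * R) (Hbar : R -> R) (K : R).
Hypothesis Hg : 0 < g.
Hypothesis HK : 0 <= K.
Hypothesis Hnonneg : forall p, 0 <= Hbar p.
Let V := potential g omega.
Hypothesis Hmomentum : forall p T e, 0 <= T -> (e = 1 \/ e = -1) ->
    Rabs p * T <= RInt (fun x => momentum V (Hbar p) (e * x)) 0 T + K.

Let Vmax := Rpower 5 g.
Let V_cts : cts V.
Proof. apply potential_cts; assumption. Qed.
Let V_range x : 0 <= V x <= Vmax.
Proof. apply potential_range; assumption. Qed.
Let Vmax_pos : 0 < Vmax.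
Proof. apply Rpower_pos. Qed.

Lemma effective_hamiltonian_coercive p : p ^ 2 / 2 - Vmax <= Hbar p.
Proof.
  set (s := sqrt (2 * (Vmax + Hbar p))).
  pose proof (Hnonneg p) as Hp.
  assert (Hs : Rabs p <= s).
  { apply le_epsilon. intros e He.
    set (T := K / e + 1).
    assert (HT0 : 0 <= K / e) by (apply Rmult_le_pos; [assumption | apply Rlt_le, Rinv_0_lt_compat; lra]).
    assert (HT : 0 < T) by (unfold T; lra).
    pose proof (Hmomentum p T 1 ltac:(lra) (or_introl eq_refl)) as H.
    assert (I : RInt (fun x => momentum V (Hbar p) (1 * x)) 0 T <= T * s).
    { replace (T * s) with (RInt (fun _ => s) 0 T) by (rewrite int_const; toR; ring).
      apply int_le; [lra | | apply cts_const |].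
      - apply (cts_comp (momentum V (Hbar p))); [apply momentum_cts; assumption | apply scale_cts].
      - intros x _. unfold momentum, s. pose proof (V_range (1 * x)). apply sqrt_le_1; lra. }
    assert (K <= T * e).
    { unfold T. replace ((K / e + 1) * e) with (K + e) by (field; lra). lra. }
    apply (Rmult_le_reg_l T); [assumption|]. lra. }
  pose proof (sqrt_sqrt (2 * (Vmax + Hbar p)) ltac:(lra)) as E. fold s in E.
  rewrite <- (pow2_abs p). pose proof (Rabs_pos p). nra.
Qed.

(** For [e = 1] or [- 1] this is minus an exact solution, and on the side of the
    origin with sign [e] its space part is the distance to the origin for the
    length element [momentum]. The maximum over both signs has a convex kink at
    the origin, which the soft maximum smooths. *)
Definition eikonal_barrier (eps c e x t : R) : R :=
  e * RInt (fun z => momentum V c (z / eps)) 0 x + - (c * (1 - t)).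

Let stretched_cts c eps : cts (fun z => momentum V c (z / eps)).
Proof.
  intros x. apply (continuous_ext (fun z => momentum V c (/ eps * z))).
  - intros z. f_equal. toR. unfold Rdiv. ring.
  - apply (cts_comp (momentum V c)); [apply momentum_cts; assumption | apply scale_cts].
Qed.

Lemma eikonal_barrier_barrier eps c e : 0 <= c -> (e = 1 \/ e = -1) ->
  barrier (fun x => V (x / eps)) (eikonal_barrier eps c e) /\ eikonal_barrier eps c e 0 1 <= 0.
Proof.
  intros Hc He. split.
  - apply (barrier_eikonal _ (fun x => e * RInt (fun z => momentum V c (z / eps)) 0 x)
      (fun x => e * momentum V c (x / eps))).
    + intros x. apply (is_derive_scal (fun x => RInt (fun z => momentum V c (z / eps)) 0 x)).
      apply (int_derive_upper (fun z => momentum V c (z / eps))). auto.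
    + apply (cts_mult (fun _ => e)); auto using cts_const.
    + intros x. unfold momentum. pose proof (V_range (x / eps)) as Hv.
      replace ((e * sqrt (2 * (V (x / eps) + c))) ^ 2)
        with (e * e * (sqrt (2 * (V (x / eps) + c)) * sqrt (2 * (V (x / eps) + c)))) by ring.
      rewrite sqrt_sqrt by lra.
      replace (e * e) with 1 by (destruct He as [-> | ->]; ring). lra.
  - unfold eikonal_barrier.
    replace (RInt (fun z => momentum V c (z / eps)) 0 0) with 0
      by (symmetry; exact (RInt_point 0 (fun z => momentum V c (z / eps)))).
    right. ring.
Qed.

Lemma eikonal_barrier_lower eps p e y : 0 < eps -> (e = 1 \/ e = -1) -> e * Rabs y = y ->
  - p * y - Hbar p - K * eps <= eikonal_barrier eps (Hbar p) e y 0.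
Proof.
  intros Heps He Hy. unfold eikonal_barrier.
  set (f := fun z => momentum V (Hbar p) (z / eps)).
  assert (Hf : cts f) by apply stretched_cts.
  assert (HT : 0 <= Rabs y / eps).
  { apply Rmult_le_pos; [apply Rabs_pos | apply Rlt_le, Rinv_0_lt_compat; lra]. }
  pose proof (int_dilate f (e * eps) 0 (Rabs y / eps) Hf) as D.
  rewrite Rmult_0_r in D.
  replace (e * eps * (Rabs y / eps)) with y in D by (rewrite <- Hy at 1; field; lra).
  rewrite <- D. clear D.
  rewrite (int_ext _ (fun x => momentum V (Hbar p) (e * x))).
  2:{ intros x. unfold f. f_equal. field. lra. }
  pose proof (Hmomentum p (Rabs y / eps) e HT He) as M.
  set (I := RInt _ 0 (Rabs y / eps)) in *.
  replace (e * (e * eps * I)) with (e * e * (eps * I)) by ring.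
  replace (e * e) with 1 by (destruct He as [-> | ->]; ring).
  assert (eps * (Rabs p * (Rabs y / eps)) <= eps * (I + K)) by (apply Rmult_le_compat_l; [lra | exact M]).
  replace (eps * (Rabs p * (Rabs y / eps))) with (Rabs p * Rabs y) in H by (field; lra).
  pose proof (Rle_abs (- (p * y))) as A. rewrite Rabs_Ropp, Rabs_mult in A. lra.
Qed.

Variables (u0 : R -> R) (u : R -> R -> R).
Hypothesis Hu0 : W1inf u0.
Hypothesis Hu : viscosity_solution (fun _ q => Hbar q) u0 u.

(** Otherwise the line from [(y, 0)] to [(0, 1)] would give [u 0 1 <= u 0 1 - d] by
    [subsolution_along_line]. *)
Lemma almost_optimal_slope y d : 0 < d ->
  exists p, u 0 1 - u0 y - d < - p * y - Hbar p.
Proof.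
  intros Hd. apply NNPP. intros Hno.
  destruct Hu as [Hc [Hsub [_ Hinit]]].
  assert (H : u (y + - y * (1 - 0)) 1 <= u y 0 + (u 0 1 - u0 y - d) * (1 - 0)).
  { apply (subsolution_along_line (fun _ q => Hbar q) u (- y) (u 0 1 - u0 y - d)); auto; [|lra].
    intros _ q. destruct (Rle_dec (- q * y - Hbar q) (u 0 1 - u0 y - d)) as [|Hgt]; [lra|].
    exfalso. apply Hno. exists q. lra. }
  rewrite Hinit in H. replace (y + - y * (1 - 0)) with 0 in H by ring. lra.
Qed.

(** The barrier is the soft maximum of finitely many eikonal barriers, whose
    slopes are almost optimal for a fine grid of foot points. The foot point [y]
    found by [solution_above_barrier] is not known in advance, but the slopes of
    the grid are bounded, so the slope of a neighbouring node is almost optimal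
    for [y]. *)
Lemma solutions_compare eps ue : 0 < eps ->
  viscosity_solution (fun x q => q ^ 2 / 2 - V (x / eps)) u0 ue ->
  u 0 1 - K * eps <= ue 0 1.
Proof.
  intros Heps Hue.
  apply le_epsilon. intros d0 Hd0. set (d := d0 / 4). assert (Hd : 0 < d) by (unfold d; lra).
  destruct Hu0 as [[M HM] [L0 HL0]].
  assert (HM0 : 0 <= M) by (eapply Rle_trans; [apply Rabs_pos | apply (HM 0)]).
  set (L := Rabs L0). assert (HLp : 0 <= L) by apply Rabs_pos.
  assert (HL : forall x y, u0 y - u0 x <= L * Rabs (y - x)).
  { intros x y. eapply Rle_trans; [apply Rle_abs|]. eapply Rle_trans; [apply HL0|].
    apply Rmult_le_compat_r; [apply Rabs_pos | apply Rle_abs]. }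
  (* outside [- r, r] the coercive barrier, at least [y ^ 2 / 54], is sufficient *)
  set (B := Rabs (u 0 1) + M + d). assert (HB : 0 < B) by (unfold B; pose proof (Rabs_pos (u 0 1)); lra).
  set (r := 54 * (B + 1)). assert (Hr : 0 < r) by (unfold r; lra).
  set (P := 2 * r + 2 + Vmax + B).
  destruct (choice (fun y p => u 0 1 - u0 y - d < - p * y - Hbar p)
    (fun y => almost_optimal_slope y d Hd)) as [slope Hslope].
  assert (HP : forall y, - r <= y <= r -> Rabs (slope y) <= P).
  { intros y Hy. apply Rnot_lt_le. intros Hbig. specialize (Hslope y).
    pose proof (effective_hamiltonian_coercive (slope y)) as Hco.
    set (p := slope y) in *.
    pose proof (Rle_abs (- (p * y))) as A. rewrite Rabs_Ropp, Rabs_mult in A.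
    assert (Hyr : Rabs y <= r) by (apply Rabs_le; lra).
    rewrite <- (pow2_abs p) in Hco.
    pose proof (HM y) as My. apply Rabs_le_between in My.
    pose proof (Rle_abs (- u 0 1)) as U. rewrite Rabs_Ropp in U.
    set (q := Rabs p) in *.
    assert (q * Rabs y <= q * r) by (apply Rmult_le_compat_l; [unfold P in *; lra | assumption]).
    assert (HqP : q * (2 + Vmax + B) <= q * (q - 2 * r)).
    { apply Rmult_le_compat_l; unfold P in *; lra. }
    assert (2 * (2 + Vmax + B) <= q * (2 + Vmax + B)).
    { apply Rmult_le_compat_r; unfold P in *; lra. }
    unfold B in *. lra. }
  assert (HP0 : 0 < P) by (unfold P; lra).
  destruct (nfloor_ex ((P + L) * (2 * r) / d)) as [n0 [_ Hn0]].
  { apply Rmult_le_pos; [nra | apply Rlt_le, Rinv_0_lt_compat; lra]. }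
  rewrite <- S_INR in Hn0. set (n := S n0) in *.
  assert (Hn : 0 < INR n) by (apply lt_0_INR; unfold n; lia).
  set (h := 2 * r / INR n).
  assert (Hh : 0 < h) by (apply Rdiv_lt_0_compat; lra).
  assert (Hnh : INR n * h = 2 * r) by (unfold h; field; lra).
  assert (HPLh : (P + L) * h <= d).
  { unfold h. apply (Rmult_le_reg_r (INR n / d)); [apply Rdiv_lt_0_compat; lra|].
    replace ((P + L) * (2 * r / INR n) * (INR n / d)) with ((P + L) * (2 * r) / d) by (field; lra).
    replace (d * (INR n / d)) with (INR n) by (field; lra). lra. }
  set (node := fun j : nat => - r + INR j * h).
  set (comp := fun e (j : nat) => eikonal_barrier eps (Hbar (slope (node j))) e).
  set (l := map (comp 1) (seq 0 (S n)) ++ map (comp (-1)) (seq 0 (S n))).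
  set (W := fun x => V (x / eps)).
  assert (HWr : forall x, 0 <= W x <= Vmax) by (intros; apply V_range).
  destruct (barrier_list_max W coercive_barrier l d) as [b [Hb1 [Hb2 [Hb3 Hb4]]]].
  { apply coercive_barrier_barrier. intros; apply HWr. }
  { unfold coercive_barrier. right. field. }
  { intros b Hin. apply in_app_or in Hin.
    destruct Hin as [Hin|Hin]; apply in_map_iff in Hin; destruct Hin as [j [<- _]];
      apply eikonal_barrier_barrier; auto. }
  { assumption. }
  destruct (solution_above_barrier W u0 ue Vmax HWr Hue b d Hb1 Hb3 Hd) as [y Hy].
  pose proof (HM y) as My. apply Rabs_le_between in My.
  destruct (Rle_dec (Rabs y) r) as [Hyr|Hyr].
  - apply Rabs_le_between in Hyr.
    destruct (nfloor_ex ((y + r) / h)) as [j [Hj1 Hj2]].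
    { apply Rmult_le_pos; [lra | apply Rlt_le, Rinv_0_lt_compat; lra]. }
    assert (Hq : (y + r) / h * h = y + r) by (field; lra).
    assert (Hj1' : INR j * h <= y + r) by (rewrite <- Hq; apply Rmult_le_compat_r; lra).
    assert (Hj2' : y + r < INR j * h + h).
    { rewrite <- Hq. replace (INR j * h + h) with ((INR j + 1) * h) by ring.
      apply Rmult_lt_compat_r; assumption. }
    assert (Hjn : (j <= n)%nat).
    { apply INR_le. apply (Rmult_le_reg_r h); [assumption|]. lra. }
    assert (Hnode : - r <= node j <= r).
    { unfold node. pose proof (pos_INR j). assert (0 <= INR j * h) by nra. lra. }
    assert (Hdist : Rabs (y - node j) <= h) by (apply Rabs_le; unfold node; lra).
    set (e := if Rle_dec 0 y then 1 else -1).
    assert (He : e = 1 \/ e = -1) by (unfold e; destruct (Rle_dec 0 y); auto).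
    assert (Hey : e * Rabs y = y).
    { unfold e. destruct (Rle_dec 0 y); [rewrite Rabs_pos_eq by lra | rewrite Rabs_left by lra]; ring. }
    assert (Hcomp : comp e j y 0 <= b y 0).
    { apply Hb4. unfold l. apply in_or_app.
      destruct He as [-> | ->]; [left | right]; apply in_map_iff; exists j; split;
        auto; apply in_seq; lia. }
    pose proof (eikonal_barrier_lower eps (slope (node j)) e y Heps He Hey) as Hlow.
    unfold comp in Hcomp. specialize (Hslope (node j)). specialize (HP (node j) Hnode).
    set (p := slope (node j)) in *.
    assert (Hpy : p * (y - node j) <= P * h).
    { eapply Rle_trans; [apply Rle_abs|]. rewrite Rabs_mult.
      apply Rmult_le_compat; auto using Rabs_pos. }
    pose proof (HL y (node j)) as Hl. rewrite Rabs_minus_sym in Hl.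
    assert (L * Rabs (y - node j) <= L * h) by (apply Rmult_le_compat_l; assumption).
    unfold d in *. lra.
  - specialize (Hb3 y 0). unfold coercive_barrier in Hb3.
    replace (0 - 3) with (-3) in Hb3 by ring.
    pose proof exp_m3_lower as E3.
    assert (Hyr2 : r * r <= y ^ 2).
    { rewrite <- (pow2_abs y). nra. }
    assert (/ 27 * (y ^ 2 / 2) <= exp (-3) * (y ^ 2 / 2)).
    { apply Rmult_le_compat_r; [pose proof (pow2_ge_0 y); lra | assumption]. }
    assert (B + 1 <= / 54 * (r * r)).
    { unfold r. replace (/ 54 * (54 * (B + 1) * (54 * (B + 1)))) with (54 * ((B + 1) * (B + 1))) by field.
      nra. }
    pose proof (Rle_abs (u 0 1)). assert (0 <= K * eps) by nra.
    unfold B, d in *. lra.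
Qed.

End Rate.

(** For [g < 1] because [eps < 1], for [g = 1] because [|ln eps|] is at least
    [|ln eps0|]. *)
Lemma rate_dominates_eps g eps0 : 0 < eps0 < 1 ->
  exists c, 0 < c /\ forall eps, 0 < eps < 1 -> (g = 1 -> eps <= eps0) -> c * eps <= rate g eps.
Proof.
  intros H0.
  assert (Hln : 0 < - ln eps0) by (pose proof (ln_increasing eps0 1 ltac:(lra) ltac:(lra)); rewrite ln_1 in *; lra).
  exists (Rmin 1 (- ln eps0)). split; [apply Rmin_pos; lra|].
  intros eps He Hg.
  pose proof (Rmin_l 1 (- ln eps0)). pose proof (Rmin_r 1 (- ln eps0)).
  set (c := Rmin 1 (- ln eps0)) in *.
  unfold rate. destruct (total_order_T g 1) as [[Hlt|Heq]|Hgt].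
  - apply Rle_trans with eps; [nra|].
    rewrite <- (Rpower_1 eps) at 1 by lra. unfold Rpower.
    assert (ln eps < 0) by (rewrite <- ln_1; apply ln_increasing; lra).
    left. apply exp_increasing. nra.
  - specialize (Hg Heq).
    assert (ln eps <= ln eps0).
    { destruct Hg as [Hg| ->]; [left; apply ln_increasing; lra | lra]. }
    rewrite Rabs_left by lra. rewrite Rmult_comm. apply Rmult_le_compat_l; lra.
  - nra.
Qed.

(* The factor |ln eps| vanishes as eps -> 1, where the left-hand side need not,
   so for gamma = 1 (and only then) eps is kept in (0, eps0] with eps0 < 1
   arbitrary. *)
Theorem lemma4p2
  (omega : R * R) (Comega gamma : R)
  (hComega : 0 < Comega)
  (homega : diophantine 1 Comega omega)
  (hgamma : 0 < gamma)
  (u0 : R -> R) (hu0 : W1inf u0)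
  (Hbar : R -> R)
  (hHbar : effective_hamiltonian (potential gamma omega) Hbar)
  (ueps : R -> R -> R -> R)
  (hueps : forall eps : R, 0 < eps < 1 ->
     viscosity_solution
       (fun x q => q ^ 2 / 2 - potential gamma omega (x / eps)) u0 (ueps eps))
  (u : R -> R -> R)
  (hu : viscosity_solution (fun _ q => Hbar q) u0 u)
  (eps0 : R) (heps0 : 0 < eps0 < 1) :
  exists C : R, 0 < C /\
    forall eps : R, 0 < eps < 1 -> (gamma = 1 -> eps <= eps0) ->
      ueps eps 0 1 - u 0 1 >= - C * rate gamma eps.
Proof.
  destruct (effective_momentum gamma Comega omega Hbar hgamma hComega homega hHbar) as [K [HK Hm]].
  destruct (rate_dominates_eps gamma eps0 heps0) as [c [Hc Hrate]].
  exists ((K + 1) / c). split; [apply Rdiv_lt_0_compat; lra|].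
  intros eps He He0.
  pose proof (solutions_compare gamma omega Hbar K hgamma HK
    (effective_hamiltonian_nonneg gamma Comega omega Hbar hgamma hComega homega hHbar) Hm
    u0 u hu0 hu eps (ueps eps) ltac:(lra) (hueps eps He)) as H.
  specialize (Hrate eps He He0).
  assert ((K + 1) / c * (c * eps) <= (K + 1) / c * rate gamma eps).
  { apply Rmult_le_compat_l; [apply Rlt_le, Rdiv_lt_0_compat; lra | assumption]. }
  replace ((K + 1) / c * (c * eps)) with ((K + 1) * eps) in H0 by (field; lra).
  apply Rle_ge. lra.
Qed.
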